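(* Let $s \ge 2$, let $R \in \mathbb{R}^{m\times m}$ be (symmetric) positive definite, and let $f:\mathbb{R}^d\to\mathbb{R}^d$, $g:\mathbb{R}^d\to\mathbb{R}^{d\times m}$, $\ell:\mathbb{R}^d\to[0,\infty)$ satisfy $f,g,\ell\in\mathcal{B}^s(\mathbb{R}^d)$ and $\|g\|_{\mathcal{B}^s(\mathbb{R}^d)}>0$. Then there exists a positive constant $C(f,g,\ell,R)$ depending on $f,g,\ell,R$ such that, whenever the discount factor satisfies $\gamma\ge C(f,g,\ell,R)$, there exist a sequence $\{u^{(i)}\}$ in $\mathcal{B}^s(\mathbb{R}^d)$ (with values in $\mathbb{R}^m$) converging to some $\bar u$ in $C^1_{\mathrm{loc}}(\mathbb{R}^d)$ and a sequence $\{V^{(i)}\}$ of real-valued functions in $\mathcal{B}^{s+1}(\mathbb{R}^d)$ converging to some $\bar V$ in $C^2_{\mathrm{loc}}(\mathbb{R}^d)$, where $(\bar u,\bar V)$ is an optimal solution of the Hamilton-Jacobi-Bellman equation $$-\gamma V(x)+\min_{u\in\mathbb{R}^m}\left\{(f(x)+g(x)u)\cdot\nabla V(x)+\Delta V(x)+\ell(x)+u^TRu\right\}=0,\qquad x\in\mathbb{R}^d.$$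
   Context: Fourier transform: $\hat f(\xi)=(2\pi)^{-d}\int_{\mathbb{R}^d} f(x)e^{-\mathrm{i}x\cdot\xi}\,\mathrm{d}x$, extended to tempered distributions $\mathcal{S}'(\mathbb{R}^d)$. For $s\in\mathbb{R}$, the spectral Barron norm of $f\in\mathcal{S}'(\mathbb{R}^d)$ is $\|f\|_{\mathcal{B}^s(\mathbb{R}^d)}=\int_{\mathbb{R}^d}|\hat f(\xi)|(1+|\xi|)^s\,\mathrm{d}\xi$, and $\mathcal{B}^s(\mathbb{R}^d)$ is the space of those $f\in\mathcal{S}'(\mathbb{R}^d)$ for which $\hat f$ is a function and this norm is finite; for $s\ge0$ such $f$ is identified with the continuous function $f(x)=\int\hat f(\xi)e^{\mathrm{i}x\cdot\xi}\,\mathrm{d}\xi$. A vector/matrix-valued function $f=(f_{ij})$ belongs to $\mathcal{B}^s(\mathbb{R}^d)$ if every entry does, and then $\|f\|_{\mathcal{B}^s(\mathbb{R}^d)}:=\sum_{i,j}\|f_{ij}\|_{\mathcal{B}^s(\mathbb{R}^d)}$. A pair $(u,V)$ is an optimal solution of the HJB equation if $V\in C^2(\mathbb{R}^d)$ satisfies the equation on $\mathbb{R}^d$ and, for each $x\in\mathbb{R}^d$, $u(x)=\mathrm{argmin}_{u\in\mathbb{R}^m}\{(f(x)+g(x)u)\cdot\nabla V(x)+\Delta V(x)+\ell(x)+u^TRu\}$. Convergence in $C^k_{\mathrm{loc}}(\mathbb{R}^d)$ means uniform convergence on every compact set of all derivatives of order at most $k$. *)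

(* Defs.v *)
From HB Require Import structures.
From mathcomp Require Import all_boot all_order all_algebra.
From mathcomp Require Import complex.
From mathcomp Require Import all_classical all_reals all_analysis.
Set Implicit Arguments.
Unset Strict Implicit.
Unset Printing Implicit Defensive.
Import Order.TTheory GRing.Theory Num.Theory.
Import numFieldNormedType.Exports.
Local Open Scope classical_set_scope.
Local Open Scope ring_scope.
Local Open Scope complex_scope.

Definition cV_display : measure_display.
Proof. exact: default_measure_display. Qed.

Section measurable_cV.
Context {R : realType}.
Variable n : nat.

(* The sigma-algebra generated by the coordinates, i.e. the Borel sets. *)
Definition cV_measurable : set (set 'cV[R]_n) :=
  <<s \bigcup_(i in [set: 'I_n])
        preimage_set_system setT (fun x : 'cV[R]_n => x i 0) measurable >>.

Let cV_set0 : cV_measurable set0.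
Proof. exact: sigma_algebra0. Qed.

Let cV_setC A : cV_measurable A -> cV_measurable (~` A).
Proof. exact: sigma_algebraC. Qed.

Let cV_bigcup (F : _^nat) : (forall i, cV_measurable (F i)) ->
  cV_measurable (\bigcup_i (F i)).
Proof. exact: sigma_algebra_bigcup. Qed.

HB.instance Definition _ := @isMeasurable.Build cV_display
  'cV[R]_n cV_measurable cV_set0 cV_setC cV_bigcup.

End measurable_cV.

Lemma measurable_coord (R : realType) n (i : 'I_n) :
  measurable_fun [set: 'cV[R]_n] (fun x : 'cV[R]_n => x i 0).
Proof.
by move=> _ A mA; apply: sub_sigma_algebra; exists i => //; exists A.
Qed.

Lemma measurable_fun_cV d (T : measurableType d) (R : realType) n
    (h : T -> 'cV[R]_n) :
  (forall i, measurable_fun [set: T] (fun t => h t i 0)) ->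
  measurable_fun [set: T] h.
Proof.
move=> mh; apply: (measurability (\bigcup_(i in [set: 'I_n])
  preimage_set_system setT (fun x : 'cV[R]_n => x i 0) measurable)) => //.
move=> _ [_ [i _ [A mA <-]] <-]; rewrite (setTI (_ @^-1` A)).
exact: mh.
Qed.

Section lebesgue_measure_step.
Context {R : realType}.
Variables (n : nat) (mu : {sigma_finite_measure set 'cV[R]_n -> \bar R}).

Definition cons_cV (p : measurableTypeR R * 'cV[R]_n) : 'cV[R]_n.+1 :=
  \col_i oapp (fun j => p.2 j 0) p.1 (unlift ord0 i).

Lemma cons_cV0 p : cons_cV p ord0 0 = p.1.
Proof. by rewrite mxE unlift_none. Qed.

Lemma cons_cVS p i : cons_cV p (lift ord0 i) 0 = p.2 i 0.
Proof. by rewrite mxE liftK. Qed.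

Lemma measurable_cons_cV : measurable_fun setT cons_cV.
Proof.
apply: measurable_fun_cV => i; case: (unliftP ord0 i) => [j ->|->].
  under eq_fun do rewrite cons_cVS.
  exact: measurableT_comp (measurable_coord j) measurable_snd.
by under eq_fun do rewrite cons_cV0; exact: measurable_fst.
Qed.

Definition lebesgue_cV_succ : set 'cV[R]_n.+1 -> \bar R :=
  pushforward (lebesgue_measure \x mu)%E cons_cV.

Let succ0 : lebesgue_cV_succ set0 = 0%E.
Proof. by rewrite /lebesgue_cV_succ /pushforward preimage_set0 measure0. Qed.

Let succ_ge0 A : (0 <= lebesgue_cV_succ A)%E.
Proof. by rewrite /lebesgue_cV_succ /pushforward; exact: measure_ge0. Qed.

Let succ_sigma_additive : semi_sigma_additive lebesgue_cV_succ.
Proof.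
move=> F mF tF mUF; rewrite /lebesgue_cV_succ /pushforward preimage_bigcup.
have mpre A : measurable A -> measurable (cons_cV @^-1` A).
  by move=> mA; rewrite -[X in measurable X]setTI; exact: measurable_cons_cV.
apply: measure_semi_sigma_additive.
- by move=> k; exact: mpre.
- apply/trivIsetP => /= i j _ _ ij; rewrite -preimage_setI.
  by move/trivIsetP : tF => /(_ _ _ _ _ ij) ->//; rewrite preimage_set0.
- by rewrite -preimage_bigcup; exact: mpre.
Qed.

HB.instance Definition _ := isMeasure.Build _ _ _ lebesgue_cV_succ
  succ0 succ_ge0 succ_sigma_additive.

Let succ_sigma_finite : sigma_finite setT lebesgue_cV_succ.
Proof.
have [F TF mF] : sigma_finite setT
    ((@lebesgue_measure R) \x mu : set (measurableTypeR R * _) -> _)%E.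
  have /sigma_finiteP[F [TF ndF Foo]] := sigma_finiteT (@lebesgue_measure R).
  have /sigma_finiteP[G [TG ndG Goo]] := sigma_finiteT mu.
  exists (fun k => F k `*` G k).
    rewrite -setXTT TF TG predeqE => -[x y]; split.
      move=> [/= [i _ Fix] [j _ Gjy]]; exists (maxn i j) => //; split.
      - by move: x Fix; exact/subsetPset/ndF/leq_maxl.
      - by move: y Gjy; exact/subsetPset/ndG/leq_maxr.
    by move=> [k _ []/= ? ?]; split; exists k.
  move=> k; have [? ?] := Foo k; have [? ?] := Goo k.
  split; first exact: measurableX.
  by rewrite product_measure1E// lte_mul_pinfty// ge0_fin_numE.
pose uncons (x : 'cV[R]_n.+1) : R * 'cV[R]_n :=
  (x ord0 0, \col_i x (lift ord0 i) 0).
have unconsK p : uncons (cons_cV p) = p.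
  case: p => a v; rewrite /uncons cons_cV0; congr pair.
  by apply/matrixP => i j; rewrite mxE cons_cVS ord1.
have muncons : measurable_fun setT uncons.
  apply: measurable_fun_pair; first exact: measurable_coord.
  apply: measurable_fun_cV => i; under eq_fun do rewrite mxE.
  exact: measurable_coord.
exists (fun k => uncons @^-1` F k); first by rewrite -preimage_bigcup -TF.
move=> k; have [mFk Fk] := mF k; split.
  by rewrite -[X in measurable X]setTI; exact: muncons.
rewrite /lebesgue_cV_succ /pushforward -comp_preimage.
by rewrite (_ : uncons \o cons_cV = id) //; apply/funext.
Qed.

HB.instance Definition _ := Measure_isSigmaFinite.Build _ _ _ lebesgue_cV_succ
  succ_sigma_finite.

End lebesgue_measure_step.

(* d-fold product of the one-dimensional Lebesgue measure; on the one-point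
   space R^0 it is the unit mass. *)
Fixpoint lebesgue_cV (R : realType) (d : nat) :
    {sigma_finite_measure set 'cV[R]_d -> \bar R} :=
  match d with
  | 0%N => dirac (0 : 'cV[R]_0)
  | n.+1 => lebesgue_cV_succ (lebesgue_cV R n)
  end.

Section calculus.
Context {R : realType} {d : nat}.
Implicit Types (f : 'cV[R]_d -> R) (x y : 'cV[R]_d) (l : seq 'I_d).

Definition dot x y : R := \sum_i x i 0 * y i 0.

(* The norm that matrices carry in the library is the sup norm. *)
Definition enorm x : R := Num.sqrt (dot x x).

Definition partial (i : 'I_d) f : 'cV[R]_d -> R :=
  fun x => 'D_(delta_mx i 0) f x.

Definition partials l f : 'cV[R]_d -> R := foldr partial f l.

Definition Ck (k : nat) f : Prop := forall l, (size l <= k)%N ->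
  continuous (partials l f) /\
  ((size l < k)%N -> forall i x, derivable (partials l f) x (delta_mx i 0)).

(* {family compact, _ --> _} is uniform convergence on every compact set. *)
Definition cvg_Ck_loc (k : nat) (f_ : nat -> 'cV[R]_d -> R) f : Prop :=
  [/\ forall n, Ck k (f_ n), Ck k f &
      forall l, (size l <= k)%N ->
        {family compact, (fun n => partials l (f_ n)) @ \oo --> partials l f}].

Definition grad f x : 'cV[R]_d := \col_i partial i f x.

Definition laplacian f x : R := \sum_i partials [:: i; i] f x.

End calculus.

Section barron.
Context {R : realType} {d : nat}.
Implicit Types (f : 'cV[R]_d -> R) (F phi : 'cV[R]_d -> R[i]) (s : R).

Local Notation mu := (lebesgue_cV R d).

Definition cintegrable F : Prop :=
  mu.-integrable setT (EFin \o (@complex.Re R \o F)) /\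
  mu.-integrable setT (EFin \o (@complex.Im R \o F)).

Definition cintegral F : R[i] :=
  (\int[mu]_x complex.Re (F x)) +i* (\int[mu]_x complex.Im (F x)).

Definition cis (t : R) : R[i] := cos t +i* sin t.

Definition schwartz_real f : Prop :=
  (forall k, Ck k f) /\
  forall (N : nat) (l : seq 'I_d), exists M : R,
    forall x, (1 + enorm x) ^+ N * `|partials l f x| <= M.

Definition schwartz phi : Prop :=
  schwartz_real (@complex.Re R \o phi) /\ schwartz_real (@complex.Im R \o phi).

Definition fourier phi : 'cV[R]_d -> R[i] := fun xi =>
  ((2 * pi) ^- d)%:C * cintegral (fun x => phi x * cis (- dot x xi)).

(* F is an integrable function, F is the Fourier transform of f in S'(R^d)
   (<f^, phi> = <f, phi^> for every Schwartz phi), and f is the continuous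
   representative of its class, f(x) = int F(xi) e^(i x.xi) dxi.  Since F is
   integrable, f is bounded and continuous and all the integrals converge. *)
Definition is_fourier f F : Prop :=
  [/\ cintegrable F,
      forall phi, schwartz phi ->
        cintegral (fun x => (f x)%:C * fourier phi x) =
        cintegral (fun xi => F xi * phi xi) &
      forall x, (f x)%:C = cintegral (fun xi => F xi * cis (dot x xi))].

Definition weighted_norm s F : \bar R :=
  (\int[mu]_xi (Normc.normc (F xi) * (1 + enorm xi) `^ s)%:E)%E.

(* The space B^s, for s >= 0: the weight is then at least 1, so that a
   transform with finite weighted norm is integrable. *)
Definition barron s f : Prop :=
  exists F, is_fourier f F /\ (weighted_norm s F < +oo)%E.

(* The Fourier transform of f, unique up to a null set. *)
Definition fhat f : 'cV[R]_d -> R[i] := xget (cst 0) [set F | is_fourier f F].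

(* Meaningful for the f that have an integrable Fourier transform. *)
Definition barron_norm s f : \bar R := weighted_norm s (fhat f).

Definition barron_mx s p q (f : 'cV[R]_d -> 'M[R]_(p, q)) : Prop :=
  forall i j, barron s (fun x => f x i j).

Definition barron_mx_norm s p q (f : 'cV[R]_d -> 'M[R]_(p, q)) : \bar R :=
  (\sum_i \sum_j barron_norm s (fun x => f x i j))%E.

End barron.

Definition posdef (R : realType) (m : nat) (Q : 'M[R]_m) : Prop :=
  Q^T = Q /\ forall v : 'cV[R]_m, v != 0 -> 0 < (v^T *m Q *m v) 0 0.

Definition is_min (R : realType) (A : set R) (a : R) : Prop :=
  A a /\ lbound A a.

Definition argmin (R : realType) (T : Type) (h : T -> R) : set T :=
  [set v | forall w, h v <= h w].

(* Q is the control cost matrix, R being taken by the field of reals. *)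
Section hjb.
Context {R : realType} {d m : nat}.
Variables (f : 'cV[R]_d -> 'cV[R]_d) (g : 'cV[R]_d -> 'M[R]_(d, m)).
Variables (ell : 'cV[R]_d -> R) (Q : 'M[R]_m) (gamma : R).

Definition hamiltonian (V : 'cV[R]_d -> R) (x : 'cV[R]_d) (v : 'cV[R]_m) : R :=
  dot (f x + g x *m v) (grad V x) + laplacian V x + ell x
  + (v^T *m Q *m v) 0 0.

Definition hjb_equation (V : 'cV[R]_d -> R) : Prop :=
  forall x, exists a,
    is_min (range (hamiltonian V x)) a /\ - gamma * V x + a = 0.

Definition optimal_solution (u : 'cV[R]_d -> 'cV[R]_m) (V : 'cV[R]_d -> R) :
    Prop :=
  [/\ Ck 2 V, hjb_equation V &
      forall x, argmin (hamiltonian V x) = [set u x]].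

End hjb.

(* Main.v *)
(** The Hamiltonian is minimal at u = - Q^-1 g^T grad V / 2, so the HJB equation
    is the semilinear equation
      gamma V - Delta V
        = ell + f . grad V - (grad V)^T g Q^-1 g^T (grad V) / 4.
    The space B^s is a Banach algebra, grad maps B^(s+1) to B^s, and
    (gamma - Delta)^-1 maps B^s to B^(s+1) with norm at most
    sup_r (1 + r) / (gamma + r^2), which tends to 0 as gamma grows.  Picard
    iteration therefore converges to a solution V in B^(s+1), which embeds in
    C^2, and the two sequences of the theorem can be taken constant.

    Real functions are written as Hartley integrals
    h(x) = int H(xi) cas(x . xi) dxi with cas = cos + sin: the density H is an
    arbitrary real function, and the Fourier transform of h is the even part of
    H minus i times its odd part.  That it is the transform of h in S' is the
    inversion theorem for Schwartz functions, proved by regularising with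
    prod_i exp(- e |x_i|), whose transform is a product of Poisson kernels. *)

Require Import Defs.
From mathcomp Require Import all_boot all_order all_algebra.
From mathcomp Require Import complex.
From mathcomp Require Import all_classical all_reals all_analysis.
From mathcomp Require Import measurable_realfun.
From mathcomp Require Import ring lra.
Set Implicit Arguments.
Unset Strict Implicit.
Unset Printing Implicit Defensive.
Import Order.TTheory GRing.Theory Num.Theory.
Import numFieldNormedType.Exports.
Local Open Scope classical_set_scope.
Local Open Scope ring_scope.

(** * Lebesgue measure on column vectors *)

(** Every estimate is carried by an explicit density with a known bound: sums, products, derivatives
    and the resolvent each come with a formula for the new density, so bounds compose as plain real
    numbers. The nonlinearity is quadratic, so contraction can only hold on a ball. The constants
    are tuned so that the iterates stay in the unit ball of B^(s+1) and each increment is at most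
    half of the previous one. Passing to the limit happens at the level of densities, by dominated
    convergence against cas and its first two derivatives; this gives pointwise convergence of V,
    grad V and Delta V, which is what the equation needs. The longest detour is the return to B^s,
    whose definition asks for the distributional identity against every Schwartz function. For
    Hartley integrals it is a Parseval formula, and the triple integral behind it does not converge
    absolutely; the damping factor repairs this. Removing the damping uses that the transform of a
    Schwartz function is integrable. *)

(** Lebesgue measure is determined by its values on the intervals ]c, e], and [|a|] times the
    pushforward under x -> a x + b has the same values there. For a < 0 the preimage is closed on
    the other side, which does not change its length. *)
Lemma lebesgue_measure_affine (R : realType) (a b : R) (A : set (measurableTypeR R)) : a != 0 ->
  measurable A ->
  (lebesgue_measure A = (`|a|)%:E * lebesgue_measure ((fun x : R => (a * x + b)%R) @^-1` A))%E.
Proof.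
move=> a0 mA.
have mphi : measurable_fun [set: measurableTypeR R] (fun x : R => (a * x + b)%R : measurableTypeR R).
  by apply: measurable_funD => //; exact: measurable_funM.
pose nu0 := measure_function_pushforward__canonical__measure_function_Measure (@lebesgue_measure R) mphi.
pose nu' : measure _ _ := mscale (NngNum (normr_ge0 a)) nu0.
rewrite (@lebesgue_measure_unique R nu')//.
move=> X [[c e] _ <-].
rewrite /nu' /nu0 /mscale /= /mscale /= /pushforward /pushforward /=.
have [a_gt0|a_lt0|] := ltgtP 0 a; last by move=> a00; rewrite -a00 eqxx in a0.
  have -> : (fun x : R => a * x + b) @^-1` [set` `]c, e]] = [set` `](c - b)/a, (e-b)/a]].
    apply/seteqP; split => x /=; rewrite !in_itv/= ltr_pdivrMr// ler_pdivlMr// [x * a]mulrC ltrBlDr lerBrDr//.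
  rewrite !lebesgue_measure_itv/= !lte_fin ltr_pM2r ?invr_gt0// ltrD2r.
  case: ifP => _; rewrite ?mule0// gtr0_norm// -!EFinB -EFinM; congr EFin.
  by field; lra.
have -> : (fun x : R => a * x + b) @^-1` [set` `]c, e]] = [set` `[(e - b)/a, (c-b)/a[].
  apply/seteqP; split => x /=; rewrite !in_itv/= ltr_ndivlMr// ler_ndivrMr// [x * a]mulrC ltrBlDr lerBrDr//; by rewrite andbC.
rewrite !lebesgue_measure_itv/= !lte_fin ltr_nM2r ?invr_lt0// ltrD2r.
case: ifP => _; rewrite ?mule0// ltr0_norm// -!EFinB -EFinM; congr EFin.
by field; lra.
Qed.

Lemma integral_affine1 (R : realType) (a b : R) (h : R -> \bar R) : a != 0 ->
  measurable_fun [set: measurableTypeR R] h -> (forall x, 0 <= h x)%E ->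
  (\int[lebesgue_measure]_x h x = (`|a|)%:E * \int[lebesgue_measure]_x h (a * x + b)%R)%E.
Proof.
move=> a0 mh h0.
have mphi : measurable_fun [set: measurableTypeR R] (fun x : R => (a * x + b)%R : measurableTypeR R).
  by apply: measurable_funD => //; exact: measurable_funM.
pose nu0 := measure_function_pushforward__canonical__measure_function_Measure (@lebesgue_measure R) mphi.
pose nu' : measure _ _ := mscale (NngNum (normr_ge0 a)) nu0.
transitivity (\int[nu']_x h x)%E.
  by apply: eq_measure_integral => A mA _; exact: lebesgue_measure_affine.
rewrite ge0_integral_mscale//=.
by rewrite ge0_integral_pushforward// preimage_setT.
Qed.

Lemma integral_cV_succ (R : realType) n (h : 'cV[R]_n.+1 -> \bar R) :
  measurable_fun setT h -> (forall x, 0 <= h x)%E ->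
  (\int[lebesgue_cV R n.+1]_x h x =
   \int[lebesgue_measure]_r \int[lebesgue_cV R n]_x h (cons_cV (r, x)))%E.
Proof.
move=> mh h0 /=.
have -> := ge0_integral_pushforward (measurable_cons_cV (R:=R)(n:=n)) (lebesgue_measure \x lebesgue_cV R n)%E measurableT mh (fun x _ => h0 x).
rewrite preimage_setT fubini_tonelli1//=.
apply: measurableT_comp => //; exact: measurable_cons_cV.
Qed.


Lemma measurable_affine_cV (R : realType) n (a : R) (b : 'cV[R]_n) :
  measurable_fun [set: 'cV[R]_n] (fun x : 'cV[R]_n => a *: x + b).
Proof.
apply: measurable_fun_cV => i; under eq_fun do rewrite !mxE.
apply: measurable_funD => //.
apply: measurable_funM => //; exact: measurable_coord.
Qed.

(** The map acts on each coordinate separately, so Tonelli and induction on the dimension reduce it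
    to the line; each coordinate contributes one factor [|a|]. *)
Lemma integral_affine_cV (R : realType) n (a : R) (b : 'cV[R]_n) (h : 'cV[R]_n -> \bar R) : a != 0 ->
  measurable_fun setT h -> (forall x, 0 <= h x)%E ->
  (\int[lebesgue_cV R n]_x h x = (`|a| ^+ n)%:E * \int[lebesgue_cV R n]_x h (a *: x + b)%R)%E.
Proof.
move=> a0; elim: n b h => [|n IH] b h mh h0.
  rewrite expr0 mul1e; apply: eq_integral => x _; congr (h _).
  by apply/matrixP => -[].
have mc := measurable_cons_cV (R:=R) (n:=n).
have mh' : measurable_fun [set: 'cV[R]_n.+1] (fun x : 'cV[R]_n.+1 => h (a *: x + b)%R).
  by apply: measurableT_comp => //; exact: measurable_affine_cV.
rewrite !integral_cV_succ//.
pose b' : 'cV[R]_n := \col_i b (lift ord0 i) 0.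
have mhc : measurable_fun [set: measurableTypeR R * 'cV[R]_n] (fun p => h (cons_cV p)) by exact: measurableT_comp.
have E r x : a *: cons_cV (r, x) + b = cons_cV (a * r + b ord0 0, a *: x + b').
  apply/matrixP => i j; rewrite ord1 !mxE; case: (unliftP ord0 i) => [k ->|->] /=.
    by rewrite !mxE.
  by [].
rewrite (integral_affine1 (b ord0 0) a0); last 2 first.
- exact: (measurable_fun_fubini_tonelli_F (m2 := lebesgue_cV R n) _ mhc (fun p => h0 _)).
- by move=> r; exact: integral_ge0.
rewrite exprS EFinM -muleA; congr (_ * _)%E.
have mk r : measurable_fun [set: 'cV[R]_n] (fun y => h (cons_cV (r, y))).
  apply: measurableT_comp => //; exact: measurableT_comp.
transitivity (\int[lebesgue_measure]_r ((`|a| ^+ n)%:E * \int[lebesgue_cV R n]_x h (a *: cons_cV (r, x) + b)%R))%E.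
  apply: eq_integral => r _.
  rewrite (IH b')//.
  by congr (_ * _)%E; apply: eq_integral => x _; rewrite E.
rewrite ge0_integralZl//.
- by apply: (measurable_fun_fubini_tonelli_F (m2 := lebesgue_cV R n) (fun p => h (a *: cons_cV p + b)%R)) => //; exact: (measurableT_comp mh' mc).
- by move=> r _; exact: integral_ge0.
Qed.
(** Extends a substitution rule from nonnegative functions to integrable ones through positive and
    negative parts. The measure space is abstract so that the line and column vectors are served
    alike. Integrability transfers because an infinite integral of |F o phi| would stay infinite
    after multiplication by c > 0. *)
Lemma Rintegral_rescale d (X : measurableType d) (R : realType) (mu : {measure set X -> \bar R})
    (phi : X -> X) (c : R) (F : X -> R) :
  measurable_fun setT phi -> 0 < c ->
  (forall h : X -> \bar R, measurable_fun setT h -> (forall x, 0 <= h x)%E ->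
    (\int[mu]_x h x = c%:E * \int[mu]_x h (phi x))%E) ->
  mu.-integrable setT (EFin \o F) ->
  mu.-integrable setT (EFin \o (fun x => F (phi x))) /\
  \int[mu]_x F x = c * \int[mu]_x F (phi x).
Proof.
move=> mT c0 H iF.
have mF : measurable_fun setT F by apply/measurable_EFinP; exact: measurable_int iF.
have iG : mu.-integrable setT (EFin \o (fun x => F (phi x))).
  apply/integrableP; split; first by apply/measurable_EFinP; apply: (measurableT_comp mF).
  have /integrableP[_] := iF.
  rewrite H//=; last by apply/measurable_EFinP; exact: measurableT_comp.
  move=> K; rewrite ltNge leye_eq; apply/negP => /eqP E; move: K.
  by rewrite E mulry gtr0_sg// mul1e ltxx.
split=> //.
rewrite /Rintegral; apply/EFin_inj; rewrite EFinM !fineK; last 2 first.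
- exact: integrable_fin_num.
- exact: integrable_fin_num.
rewrite integralE [in RHS]integralE muleBr//; last exact: integrable_add_def.
have mE : measurable_fun setT (EFin \o F) by exact/measurable_EFinP.
congr (_ - _)%E.
  rewrite (H _ (measurable_funepos mE)) => [|x]; last exact: funepos_ge0.
  by congr (_ * _)%E; apply: eq_integral => x _; rewrite !funeposE.
rewrite (H _ (measurable_funeneg mE)) => [|x]; last exact: funeneg_ge0.
by congr (_ * _)%E; apply: eq_integral => x _; rewrite !funenegE.
Qed.

Lemma Rintegral_affine_cV (R : realType) n (a : R) (b : 'cV[R]_n) (F : 'cV[R]_n -> R) : a != 0 ->
  (lebesgue_cV R n).-integrable setT (EFin \o F) ->
  (lebesgue_cV R n).-integrable setT (EFin \o (fun x => F (a *: x + b))) /\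
  \int[lebesgue_cV R n]_x F x = `|a| ^+ n * \int[lebesgue_cV R n]_x F (a *: x + b).
Proof.
move=> a0; apply: Rintegral_rescale => [||h mh h0].
- exact: measurable_affine_cV.
- by rewrite exprn_gt0// normr_gt0.
- exact: integral_affine_cV.
Qed.

Lemma Rintegral_opp1 (R : realType) (F : R -> R) :
  (@lebesgue_measure R).-integrable setT (EFin \o F) ->
  \int[@lebesgue_measure R]_x F x = \int[@lebesgue_measure R]_x F (- x).
Proof.
move=> iF.
have [||_ ->] := Rintegral_rescale (phi := (fun x : R => - x) : measurableTypeR R -> measurableTypeR R) _ ltr01 _ iF.
- exact: measurable_funN.
- move=> h mh h0; have N0 : (-1 : R) != 0 by rewrite oppr_eq0 oner_eq0.
  rewrite (integral_affine1 0 N0 mh h0) normrN1.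
  by congr (_ * _)%E; apply: eq_integral => x _; rewrite addr0 mulN1r.
- by rewrite mul1r.
Qed.

(** * Fubini for products of integrable functions with a bounded kernel *)

Section fubini_kernel.
Context d1 d2 (X : measurableType d1) (Y : measurableType d2) (R : realType).
Variables (m1 : {sigma_finite_measure set X -> \bar R}) (m2 : {sigma_finite_measure set Y -> \bar R}).

Lemma integrable_prod_kernel (a : X -> R) (b : Y -> R) (k : X * Y -> R) (C : R) :
  m1.-integrable setT (EFin \o a) -> m2.-integrable setT (EFin \o b) ->
  measurable_fun [set: X * Y] k -> (forall p, `|k p| <= C) ->
  (m1 \x m2)%E.-integrable [set: X * Y] (EFin \o (fun p => a p.1 * b p.2 * k p)).
Proof.
move=> ia ib mk kC.
have ma : measurable_fun setT a by apply/measurable_EFinP; exact: measurable_int ia.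
have mb : measurable_fun setT b by apply/measurable_EFinP; exact: measurable_int ib.
have mab : measurable_fun [set: X * Y] (fun p => a p.1 * b p.2).
  by apply: measurable_funM; exact: measurableT_comp.
have iab : (m1 \x m2)%E.-integrable [set: X * Y] (EFin \o (fun p => a p.1 * b p.2)).
  apply/integrable12ltyP => /=; first exact/measurable_EFinP.
  have /integrableP[_ /= a_lty] := ia; have /integrableP[_ /= b_lty] := ib.
  under eq_integral => x _.
    under eq_integral => y _ do rewrite normrM EFinM.
    rewrite ge0_integralZl//; last by apply/measurable_EFinP; exact: measurableT_comp.
    over.
  rewrite ge0_integralZr//; last 2 first.
  - by apply/measurable_EFinP; exact: measurableT_comp.
  - exact: integral_ge0.
  apply: lte_mul_pinfty => //; first exact: integral_ge0.
  by rewrite ge0_fin_numE//; exact: integral_ge0.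
have iC : (m1 \x m2)%E.-integrable [set: X * Y] (fun p => C%:E * (a p.1 * b p.2)%:E)%E.
  exact: (integrableZl measurableT C iab).
apply: le_integrable iC => //=; first by apply/measurable_EFinP; exact: measurable_funM.
move=> p _; rewrite lee_fin !normrM mulrC ler_wpM2r// ?mulr_ge0//.
exact: le_trans (kC p) (ler_norm C).
Qed.

(** With k(x, y) = cas(x . y) this moves a Hartley transform from one factor of an integral to the
    other. *)
Lemma Rintegral_kernel_swap (a : X -> R) (b : Y -> R) (k : X * Y -> R) (C : R) :
  m1.-integrable setT (EFin \o a) -> m2.-integrable setT (EFin \o b) ->
  measurable_fun [set: X * Y] k -> (forall p, `|k p| <= C) ->
  m1.-integrable setT (EFin \o (fun x => a x * \int[m2]_y (b y * k (x, y)))) /\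
  \int[m1]_x (a x * \int[m2]_y (b y * k (x, y))) =
  \int[m2]_y (b y * \int[m1]_x (a x * k (x, y))).
Proof.
move=> ia ib mk kC.
have ip := integrable_prod_kernel ia ib mk kC.
have mbk x : m2.-integrable setT (EFin \o (fun y => b y * k (x, y))).
  have iC : m2.-integrable setT (fun y => C%:E * (b y)%:E)%E by exact: integrableZl.
  have mb : measurable_fun setT b by apply/measurable_EFinP; exact: measurable_int ib.
  apply: le_integrable iC => //=.
    by apply/measurable_EFinP; apply: measurable_funM => //; exact: measurableT_comp.
  move=> y _; rewrite lee_fin !normrM mulrC ler_wpM2r//.
  exact: le_trans (kC _) (ler_norm C).
have mak y : m1.-integrable setT (EFin \o (fun x => a x * k (x, y))).
  have iC : m1.-integrable setT (fun y => C%:E * (a y)%:E)%E by exact: integrableZl.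
  have ma : measurable_fun setT a by apply/measurable_EFinP; exact: measurable_int ia.
  apply: le_integrable iC => //=.
    by apply/measurable_EFinP; apply: measurable_funM => //; exact: measurableT_comp.
  move=> x _; rewrite lee_fin !normrM mulrC ler_wpM2r//.
  exact: le_trans (kC _) (ler_norm C).
have EF x : fubini_F m2 (EFin \o (fun p => a p.1 * b p.2 * k p)) x =
    (a x * \int[m2]_y (b y * k (x, y)))%:E.
  rewrite /fubini_F /= -RintegralZl// /Rintegral fineK.
    by apply: eq_integral => y _; rewrite mulrA.
  apply: integrable_fin_num => //.
  have : m2.-integrable setT (fun y => (a x)%:E * (b y * k (x, y))%:E)%E by exact: (integrableZl measurableT (a x) (mbk x)).
  by apply: eq_integrable => // y _ /=; rewrite EFinM.
have EG y : fubini_G m1 (EFin \o (fun p => a p.1 * b p.2 * k p)) y =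
    (b y * \int[m1]_x (a x * k (x, y)))%:E.
  rewrite /fubini_G /= -RintegralZl// /Rintegral fineK.
    by apply: eq_integral => x _; rewrite mulrCA mulrA.
  apply: integrable_fin_num => //.
  have : m1.-integrable setT (fun x => (b y)%:E * (a x * k (x, y))%:E)%E by exact: (integrableZl measurableT (b y) (mak y)).
  by apply: eq_integrable => // x _ /=; rewrite EFinM.
split.
  by apply: eq_integrable (integrable_fubini_F ip) => // x _; rewrite EF.
rewrite /Rintegral; congr fine.
under eq_integral do rewrite -EF.
under [RHS]eq_integral do rewrite -EG.
by rewrite integral12_prod_meas1// integral21_prod_meas1.
Qed.

End fubini_kernel.

Section real_integrable.
Context d (T : measurableType d) (R : realType) (mu : {measure set T -> \bar R}).
Implicit Types f g : T -> R.

Lemma integrable_measurable f : mu.-integrable setT (EFin \o f) -> measurable_fun setT f.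
Proof. by move=> fi; apply/measurable_EFinP; exact: measurable_int fi. Qed.

Lemma RintegrableD f g : mu.-integrable setT (EFin \o f) -> mu.-integrable setT (EFin \o g) ->
  mu.-integrable setT (EFin \o (fun x => f x + g x)).
Proof. by move=> fi gi; apply: eq_integrable (integrableD measurableT fi gi) => // x _ /=; rewrite EFinD. Qed.

Lemma RintegrableB f g : mu.-integrable setT (EFin \o f) -> mu.-integrable setT (EFin \o g) ->
  mu.-integrable setT (EFin \o (fun x => f x - g x)).
Proof. by move=> fi gi; apply: eq_integrable (integrableB measurableT fi gi) => // x _ /=; rewrite EFinB. Qed.

Lemma RintegrableZ c f : mu.-integrable setT (EFin \o f) ->
  mu.-integrable setT (EFin \o (fun x => c * f x)).
Proof. by move=> fi; apply: eq_integrable (integrableZl measurableT c fi) => // x _ /=; rewrite EFinM. Qed.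

Lemma Rintegrable_le f g : measurable_fun setT f -> (forall x, `|f x| <= g x) ->
  mu.-integrable setT (EFin \o g) -> mu.-integrable setT (EFin \o f).
Proof.
move=> mf fg; apply: le_integrable => //; first exact/measurable_EFinP.
by move=> x _ /=; rewrite lee_fin (le_trans (fg x))// ler_norm.
Qed.

Lemma Rintegrable_bounded f g (C : R) : mu.-integrable setT (EFin \o f) -> measurable_fun setT g ->
  (forall x, `|g x| <= C) -> mu.-integrable setT (EFin \o (fun x => f x * g x)).
Proof.
move=> fi mg gC; have mf := integrable_measurable fi.
apply: (@Rintegrable_le _ (fun x => C * `|f x|)).
- exact: measurable_funM.
- by move=> x; rewrite normrM mulrC ler_wpM2r.
- by apply: RintegrableZ; exact: integrable_norm.
Qed.

Lemma Rintegrable_lty f : measurable_fun setT f -> (\int[mu]_x `|f x|%:E < +oo)%E ->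
  mu.-integrable setT (EFin \o f).
Proof. by move=> mf fi; apply/integrableP; split=> //; exact/measurable_EFinP. Qed.

End real_integrable.

(** * Euclidean structure and measurability *)

Section euclidean.
Context {R : realType} {d : nat}.
Implicit Types x y z : 'cV[R]_d.

Lemma dotC x y : dot x y = dot y x.
Proof. by apply: eq_bigr => i _; rewrite mulrC. Qed.

Lemma dotDl x y z : dot (x + y) z = dot x z + dot y z.
Proof. by rewrite /dot -big_split; apply: eq_bigr => i _; rewrite mxE mulrDl. Qed.

Lemma dotZl a x z : dot (a *: x) z = a * dot x z.
Proof. by rewrite /dot mulr_sumr; apply: eq_bigr => i _; rewrite mxE mulrA. Qed.

Lemma dotDr x y z : dot x (y + z) = dot x y + dot x z.
Proof. by rewrite dotC dotDl !(dotC x). Qed.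

Lemma dotZr a x z : dot x (a *: z) = a * dot x z.
Proof. by rewrite dotC dotZl dotC. Qed.

Lemma dotNl x y : dot (- x) y = - dot x y.
Proof. by rewrite -scaleN1r dotZl mulN1r. Qed.

Lemma dotNr x y : dot x (- y) = - dot x y.
Proof. by rewrite dotC dotNl dotC. Qed.

Lemma dot_delta x i : dot x (delta_mx i 0) = x i 0.
Proof.
rewrite /dot (bigD1 i)//= big1 ?addr0 => [|j ji]; rewrite mxE ?eqxx ?mulr1//.
by rewrite (negbTE ji) mulr0.
Qed.

Lemma dotxx_ge0 x : 0 <= dot x x.
Proof. by apply: sumr_ge0 => i _; rewrite -expr2 sqr_ge0. Qed.

Lemma enorm_ge0 x : 0 <= enorm x.
Proof. exact: sqrtr_ge0. Qed.

Lemma enorm_sqr x : enorm x ^+ 2 = dot x x.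
Proof. by rewrite sqr_sqrtr// dotxx_ge0. Qed.

Lemma enormN x : enorm (- x) = enorm x.
Proof. by rewrite /enorm dotNl dotNr opprK. Qed.

Lemma coord_le_enorm x i : `|x i 0| <= enorm x.
Proof.
rewrite -(@ler_pXn2r _ 2)// ?nnegrE ?enorm_ge0// enorm_sqr real_normK ?num_real//.
rewrite /dot (bigD1 i)//= -expr2 lerDl; apply: sumr_ge0 => j _.
by rewrite -expr2 sqr_ge0.
Qed.

Lemma dot_le_enorm x y : `|dot x y| <= enorm x * enorm y.
Proof.
rewrite -(@ler_pXn2r _ 2)// ?nnegrE ?mulr_ge0 ?enorm_ge0//.
rewrite exprMn !enorm_sqr real_normK ?num_real//.
(* The usual vector x - (r / q) y of the Cauchy-Schwarz argument, multiplied by q to avoid the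
   division; its square is q (p q - r^2), and q = 0 is left as a separate case. *)
have := dotxx_ge0 (dot y y *: x - dot x y *: y).
rewrite dotDl !dotDr -scaleNr !dotZl !dotZr (dotC y x).
set p := dot x x; set q := dot y y; set r := dot x y => H.
have q0 : 0 <= q by exact: dotxx_ge0.
have [q00|q1] := eqVneq q 0; last first.
  have qp : 0 < q by rewrite lt_def q1.
  have H' : 0 <= q * (p * q - r ^+ 2) by move: H; congr (_ <= _); ring.
  by rewrite -subr_ge0 -(pmulr_rge0 _ qp).
have y0 j : y j 0 = 0.
  move: q00 => /psumr_eq0P => H0; have := H0 _ j isT.
  by move=> H1; apply/eqP; rewrite -sqrf_eq0 expr2 H1// => i _; rewrite -expr2 sqr_ge0.
rewrite q00 mulr0 /r /dot big1 ?expr0n//= => j _.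
by rewrite y0 mulr0.
Qed.

Lemma enormD x y : enorm (x + y) <= enorm x + enorm y.
Proof.
rewrite -(@ler_pXn2r _ 2)// ?nnegrE ?addr_ge0 ?enorm_ge0//.
rewrite enorm_sqr dotDl !dotDr sqrrD !enorm_sqr (dotC y x).
have := dot_le_enorm x y; have := ler_norm (dot x y); nra.
Qed.

End euclidean.

Section measurability_cV.
Context {R : realType} {n : nat} d (T : measurableType d).
Implicit Types h k : T -> 'cV[R]_n.

Lemma measurable_cV_coord h : measurable_fun [set: T] h -> forall i, measurable_fun [set: T] (fun t => h t i 0).
Proof. by move=> mh i; exact: measurableT_comp (measurable_coord i) mh. Qed.

Lemma measurable_cV_add h k : measurable_fun [set: T] h -> measurable_fun [set: T] k ->
  measurable_fun [set: T] (fun t => h t + k t).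
Proof.
move=> mh mk; apply: measurable_fun_cV => i; under eq_fun do rewrite mxE.
by apply: measurable_funD; exact: measurable_cV_coord.
Qed.

Lemma measurable_cV_opp h : measurable_fun [set: T] h -> measurable_fun [set: T] (fun t => - h t).
Proof.
move=> mh; apply: measurable_fun_cV => i; under eq_fun do rewrite mxE.
by apply: measurable_funN; exact: measurable_cV_coord.
Qed.

Lemma measurable_dot h k : measurable_fun [set: T] h -> measurable_fun [set: T] k ->
  measurable_fun [set: T] (fun t => dot (h t) (k t)).
Proof.
move=> mh mk; apply: measurable_sum => i.
by apply: measurable_funM; exact: measurable_cV_coord.
Qed.

Lemma measurable_enorm h : measurable_fun [set: T] h -> measurable_fun [set: T] (fun t => enorm (h t)).
Proof.
move=> mh; rewrite (_ : (fun t => _) = (fun r => r `^ 2^-1) \o (fun t => dot (h t) (h t))).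
  by apply: measurableT_comp; [exact: measurable_powR|exact: measurable_dot].
by apply/funext => t /=; rewrite /enorm powR12_sqrt// dotxx_ge0.
Qed.

End measurability_cV.

(* f is the pointwise limit of its values at the points of the grids of mesh
   1 / k.+1, which are countable sets. *)
Lemma continuous_cV_measurable (R : realType) n (f : 'cV[R]_n -> R) :
  continuous f -> measurable_fun [set: 'cV[R]_n] f.
Proof.
move=> cf.
pose q (k : nat) (x : 'cV[R]_n) : 'cV[int]_n := \col_i Num.floor (k.+1%:R * x i 0).
pose p (k : nat) (z : 'cV[int]_n) : 'cV[R]_n := \col_i ((z i 0)%:~R / k.+1%:R).
apply: (@measurable_fun_cvg _ _ _ _ (fun k x => f (p k (q k x)))) => [k|x _].
  move=> _ Y mY; rewrite setTI.
  have -> : (fun x => f (p k (q k x))) @^-1` Y =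
      \bigcup_z (if `[< Y (f (p k z)) >] then [set x | q k x = z] else set0).
    apply/seteqP; split => [x /= Yx|x [z _ /=]].
      by exists (q k x) => //; rewrite asboolT.
    by case: asboolP => //= Yz ->.
  apply: countable_bigcupT_measurable => [|z]; first exact: countableP.
  case: ifPn => [_|_]; last exact: measurable0.
  rewrite (_ : [set x | _] = \bigcap_(i in [set: 'I_n])
      [set x : 'cV[R]_n | Num.floor (k.+1%:R * x i 0) = z i 0]); last first.
    apply/seteqP; split => [x /= <- i _|x H] /=; first by rewrite !mxE.
    by apply/matrixP => i j; rewrite ord1 mxE; exact: H.
  apply: fin_bigcap_measurable => // i _.
  rewrite (_ : [set x | _] = (fun x : 'cV[R]_n => x i 0) @^-1`
      `[(z i 0)%:~R / k.+1%:R, ((z i 0) + 1)%:~R / k.+1%:R[ ); last first.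
    apply/seteqP; split => x /=; rewrite in_itv/= ler_pdivrMr// ltr_pdivlMr// ![x i 0 * _]mulrC.
      by move=> /eqP; rewrite floor_eq.
    by rewrite -floor_eq => /eqP.
  by rewrite -[X in measurable X]setTI; apply: measurable_coord => //; exact: measurable_itv.
apply: continuous_cvg => //; first exact: cf.
apply/cvg_ballP => e e0.
near=> k; split=> // i j; rewrite ord1 !mxE /ball /=.
have k0 : 0 < k.+1%:R :> R by rewrite ltr0n.
have /andP[] := floor_itv (k.+1%:R * x i 0); set z := Num.floor _ => H1 H2.
rewrite ger0_norm; last by rewrite subr_ge0 ler_pdivrMr// mulrC.
apply: (@le_lt_trans _ _ (k.+1%:R^-1)).
  rewrite -(ler_pM2l k0) mulrBr mulfV ?gt_eqF// [_ * (_ / _)]mulrCA mulfV ?gt_eqF// mulr1.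
  by rewrite lerBlDl; apply: ltW; move: H2; rewrite intrD.
near: k.
have := @cvg_harmonic R; move/cvgrPdist_lt => /(_ _ e0); apply: filterS => k.
by rewrite sub0r normrN /harmonic ger0_norm// invr_ge0.
Unshelve. all: by end_near.
Qed.

(** * Laplace and Cauchy kernels *)

Section laplace_kernel.
Context {R : realType}.
Variables (e : R) (e0 : 0 < e).
Local Notation leb := (@lebesgue_measure R).

Definition laplace (x : R) : R := expR (- (e * `|x|)).

Lemma laplace_ge0 x : 0 <= laplace x. Proof. exact: expR_ge0. Qed.

Lemma continuous_laplace : continuous laplace.
Proof.
move=> x; apply: continuous_comp; last exact: continuous_expR.
apply: continuousN; apply: continuousM; first exact: cst_continuous.
exact: norm_continuous.
Qed.

(** Adding 1 to the cosine makes the integrand nonnegative, as the fundamental theorem of calculus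
    on a half-line requires; the contribution of the 1 is subtracted afterwards. *)
Let fe (t x : R) := laplace x * (1 + cos (t * x)).

Let fe_ge0 t x : 0 <= fe t x.
Proof. by rewrite mulr_ge0 ?laplace_ge0// addrC -lerBlDr sub0r cos_geN1. Qed.

Let cont_fe t : continuous (fe t).
Proof.
move=> x; apply: continuousM; first exact: continuous_laplace.
apply: continuousD; first exact: cst_continuous.
apply: continuous_comp; last exact: continuous_cos.
by apply: continuousM; [exact: cst_continuous|exact: cvg_id].
Qed.

(** A primitive of exp(- e x) (1 + cos(t x)), which is the integrand on x >= 0. It vanishes at
    infinity, so only its value at 0 remains. *)
Let antid (t x : R) := - expR (- (e * x)) / e
  + expR (- (e * x)) * (t * sin (t * x) - e * cos (t * x)) / (e ^+ 2 + t ^+ 2).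

Let den_gt0 t : 0 < e ^+ 2 + t ^+ 2.
Proof. by rewrite ltr_pwDl ?exprn_gt0// sqr_ge0. Qed.

Let antid_derive t (x : R) : is_derive x 1 (antid t) (expR (- (e * x)) * (1 + cos (t * x))).
Proof.
rewrite /antid; apply: is_derive_eq.
have := den_gt0 t; move=> /gt_eqF /negbT H.
rewrite /GRing.scale /=; field.
by rewrite H gt_eqF.
Qed.

Let cvg_exp : expR (- (e * x)) @[x --> +oo] --> (0 : R).
Proof.
apply: (@cvg_comp _ _ _ (fun x => e * x) (fun x => expR (- x)) _ +oo); last exact: cvgr_expR.
exact: gt0_cvgMry.
Qed.

Let cvg_antid t : antid t x @[x --> +oo] --> (0 : R).
Proof.
pose C := e^-1 + (`|t| + e) / (e ^+ 2 + t ^+ 2).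
apply/norm_cvg0P.
apply: (@squeeze_cvgr _ _ _ _ (cst 0) (fun x => expR (- (e * x)) * C)).
- near=> x => /=; rewrite normr_ge0/=.
  rewrite /antid mulNr -mulrN -mulrA -mulrDr normrM ger0_norm ?expR_ge0//.
  rewrite ler_wpM2l ?expR_ge0//; apply: (le_trans (ler_normD _ _)).
  apply: lerD; first by rewrite normrN normfV gtr0_norm.
  rewrite normrM normfV (gtr0_norm (den_gt0 t)) ler_wpM2r//.
    by rewrite invr_ge0 ltW.
  apply: (le_trans (ler_normB _ _)); rewrite !normrM (gtr0_norm e0).
  by rewrite lerD// ler_piMr// ?sin_max ?cos_max// ltW.
- exact: cvg_cst.
- rewrite -(mul0r C); apply: cvgM; [exact: cvg_exp|exact: cvg_cst].
Unshelve. all: by end_near.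
Qed.

Let int_fe t : (\int[leb]_x (fe t x)%:E = (2 * (e^-1 + e / (e ^+ 2 + t ^+ 2)))%:E)%E.
Proof.
rewrite ge0_symfun_integralT//; last first.
  by move=> x; rewrite /fe /laplace /= normrN mulrN cosN.
rewrite (_ : [set x : R | 0 <= x] = `[0, +oo[%classic); last first.
  by apply/seteqP; split => x /=; rewrite in_itv/= andbT.
under eq_integral.
  move=> x; rewrite inE /= in_itv/= andbT => x0.
  rewrite /fe /laplace ger0_norm//. over.
have cF (f : R -> R) : continuous f -> {within `[0, +oo[, continuous f}.
  by move=> cf; exact: continuous_subspaceT.
have cg : continuous (fun x : R => expR (- (e * x)) * (1 + cos (t * x))).
  move=> x; apply: (@continuousM _ _ (fun x : R => expR (- (e * x))) (fun x : R => 1 + cos (t * x))).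
    apply: continuous_comp; last exact: continuous_expR.
    by apply: continuousN; apply: continuousM; [exact: cst_continuous|exact: cvg_id].
  apply: continuousD; first exact: cst_continuous.
  apply: continuous_comp; last exact: continuous_cos.
  by apply: continuousM; [exact: cst_continuous|exact: cvg_id].
rewrite (@ge0_continuous_FTC2y _ _ (antid t) 0 0).
- rewrite -EFinB -EFinM; congr EFin.
  rewrite /antid !mulr0 oppr0 expR0 sin0 cos0.
  by have /gt_eqF /negbT H := den_gt0 t; field; rewrite H gt_eqF.
- move=> x x0; have := fe_ge0 t x; by rewrite /fe /laplace ger0_norm.
- exact: cF cg.
- exact: cvg_antid.
- by move=> x _; have [] := antid_derive t x.
- apply: cvg_at_right_filter; apply: differentiable_continuous.
  by apply/derivable1_diffP; have [] := antid_derive t 0.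
- by move=> x _; rewrite derive1E; have [_ ->] := antid_derive t x.
Qed.

Lemma integrable_laplace : leb.-integrable setT (EFin \o laplace).
Proof.
have mlap : measurable_fun [set: measurableTypeR R] laplace.
  exact: continuous_measurable_fun continuous_laplace.
have mfe : measurable_fun [set: measurableTypeR R] (fe 0).
  by apply: continuous_measurable_fun; exact: cont_fe.
apply/integrableP; split; first exact/measurable_EFinP.
apply: (@le_lt_trans _ _ (\int[leb]_x (fe 0 x)%:E)%E); last by rewrite int_fe ltry.
apply: ge0_le_integral => //=.
- by apply/measurable_EFinP; exact: measurableT_comp.
- exact/measurable_EFinP.
- move=> x _; rewrite lee_fin ger0_norm ?laplace_ge0// /fe mul0r cos0.
  by rewrite ler_peMr ?laplace_ge0// lerDl.
Qed.

Lemma integrable_laplace_mul (g : R -> R) : continuous g -> (forall x, `|g x| <= 1) ->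
  leb.-integrable setT (EFin \o (fun x => laplace x * g x)).
Proof.
move=> cg g1; apply: le_integrable integrable_laplace => //=.
  apply/measurable_EFinP; apply: measurable_funM; apply: continuous_measurable_fun => //.
  exact: continuous_laplace.
by move=> x _; rewrite lee_fin normrM ler_piMr.
Qed.

Lemma Rintegral_laplace_cos t :
  \int[leb]_x (laplace x * cos (t * x)) = 2 * e / (e ^+ 2 + t ^+ 2).
Proof.
have ccos u : continuous (fun x : R => cos (u * x)).
  move=> x; apply: continuous_comp; last exact: continuous_cos.
  by apply: continuousM; [exact: cst_continuous|exact: cvg_id].
have icos u := integrable_laplace_mul (ccos u) (fun x => cos_max _).
have E u : \int[leb]_x laplace x + \int[leb]_x (laplace x * cos (u * x)) =
    2 * (e^-1 + e / (e ^+ 2 + u ^+ 2)).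
  rewrite -RintegralD//; last exact: integrable_laplace.
  rewrite -[RHS]/(fine (2 * (e^-1 + e / (e ^+ 2 + u ^+ 2)))%:E) -int_fe /Rintegral.
  by congr fine; apply: eq_integral => x _; rewrite /fe mulrDr mulr1.
(* At t = 0 the two integrals coincide, which gives the integral of [laplace] alone; it is then
   subtracted from the formula for general t. *)
have := E 0; under [X in _ + X = _]eq_Rintegral do rewrite mul0r cos0 mulr1.
have := E t; rewrite expr0n /= addr0 => E1 E2.
have E3 : \int[leb]_x laplace x = 2 * e^-1.
  have : e / e ^+ 2 = e^-1 by field; rewrite gt_eqF.
  move: E2; lra.
by move: E1; rewrite E3 mulrDr -mulrA => /addrI.
Qed.

Lemma Rintegral_laplace_sin t : \int[leb]_x (laplace x * sin (t * x)) = 0.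
Proof.
have csin : continuous (fun x : R => sin (t * x)).
  move=> x; apply: continuous_comp; last exact: continuous_sin.
  by apply: continuousM; [exact: cst_continuous|exact: cvg_id].
have isin := integrable_laplace_mul csin (fun x => sin_max _).
have H : \int[leb]_x (laplace x * sin (t * x)) = - \int[leb]_x (laplace x * sin (t * x)).
  rewrite {1}Rintegral_opp1// -mulN1r -RintegralZl//.
  by apply: eq_Rintegral => x _; rewrite /laplace normrN mulrN sinN mulrN mulN1r.
by move: H; lra.
Qed.

End laplace_kernel.

Section cauchy_kernel.
Context {R : realType}.
Local Notation leb := (@lebesgue_measure R).

Lemma integral_cauchy : (\int[leb]_x ((1 + x ^+ 2)^-1)%:E = pi%:E)%E.
Proof.
rewrite (@ge0_symfun_integralT _ (fun x => (1 + x ^+ 2)^-1)).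
- rewrite (_ : [set x : R | 0 <= x] = `[0, +oo[%classic); last first.
    by apply/seteqP; split => x /=; rewrite in_itv/= andbT.
  by rewrite integral0y_oneDsqr -EFinM; congr EFin; field.
- by move=> x; rewrite invr_ge0 addr_ge0// sqr_ge0.
- exact: continuous_oneDsqrV.
- by move=> x /=; rewrite sqrrN.
Qed.

Lemma integrable_cauchy : leb.-integrable setT (EFin \o (fun x : R => (1 + x ^+ 2)^-1)).
Proof.
apply/integrableP; split.
  by apply/measurable_EFinP; exact: continuous_measurable_fun continuous_oneDsqrV.
under eq_integral do rewrite /= ger0_norm ?invr_ge0 ?addr_ge0 ?sqr_ge0//.
by rewrite integral_cauchy ltry.
Qed.

End cauchy_kernel.

(** * Product functions and the transform of the damping factor *)

Section tensor.
Context {R : realType}.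
Local Notation leb := (@lebesgue_measure R).

Definition tail_cV n (x : 'cV[R]_n.+1) : 'cV[R]_n := \col_i x (lift ord0 i) 0.

Lemma tail_cons_cV n (r : R) (x : 'cV[R]_n) : tail_cV (cons_cV (r, x)) = x.
Proof. by apply/matrixP => i j; rewrite ord1 mxE cons_cVS. Qed.

Lemma measurable_tail_cV n : measurable_fun [set: 'cV[R]_n.+1] (@tail_cV n).
Proof.
by apply: measurable_fun_cV => i; under eq_fun do rewrite mxE; exact: measurable_coord.
Qed.

Lemma Rintegral_tensor n (a : R -> R) (b : 'cV[R]_n -> R) :
  leb.-integrable setT (EFin \o a) -> (lebesgue_cV R n).-integrable setT (EFin \o b) ->
  (lebesgue_cV R n.+1).-integrable setT (EFin \o (fun x : 'cV[R]_n.+1 => a (x ord0 0) * b (tail_cV x))) /\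
  \int[lebesgue_cV R n.+1]_x (a (x ord0 0) * b (tail_cV x)) =
  \int[leb]_x a x * \int[lebesgue_cV R n]_x b x.
Proof.
move=> ia ib.
have ma : measurable_fun [set: measurableTypeR R] a by apply/measurable_EFinP; exact: measurable_int ia.
have mb : measurable_fun setT b by apply/measurable_EFinP; exact: measurable_int ib.
have mab : measurable_fun [set: 'cV[R]_n.+1] (EFin \o (fun x : 'cV[R]_n.+1 => a (x ord0 0) * b (tail_cV x))).
  apply/measurable_EFinP; apply: measurable_funM.
    by apply: (measurableT_comp ma); exact: measurable_coord.
  by apply: (measurableT_comp mb); exact: measurable_tail_cV.
have m1 : measurable_fun [set: measurableTypeR R * 'cV[R]_n] (cst (1 : R)) by exact: measurable_cst.
have b1 (p : measurableTypeR R * 'cV[R]_n) : `|cst (1 : R) p| <= 1 by rewrite normr1.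
have ip := integrable_prod_kernel ia ib m1 b1.
have ip' : (leb \x lebesgue_cV R n)%E.-integrable (cons_cV (n:=n) @^-1` setT)
   ((EFin \o (fun x : 'cV[R]_n.+1 => a (x ord0 0) * b (tail_cV x))) \o cons_cV (n:=n)).
  rewrite preimage_setT; apply: eq_integrable ip => // -[r x] _ /=.
  by rewrite mulr1 tail_cons_cV cons_cV0.
have mc := measurable_cons_cV (R:=R) (n:=n).
split.
  exact: (integrable_pushforward mc mab ip' measurableT).
rewrite {1}/Rintegral.
have -> := integral_pushforward mc mab ip' measurableT.
rewrite preimage_setT.
transitivity (fine (\int[(leb \x lebesgue_cV R n)%E]_p
    (a p.1 * b p.2 * cst (1 : R) p)%:E)%E).
  congr fine; apply: eq_integral => -[r x] _ /=.
  by rewrite mulr1 tail_cons_cV cons_cV0.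
rewrite -integral12_prod_meas1// /fubini_F /= mulrC -RintegralZl//.
rewrite /Rintegral; congr fine; apply: eq_integral => r _.
transitivity (\int[lebesgue_cV R n]_y ((a r)%:E * (b y)%:E))%E.
  by apply: eq_integral => y _; rewrite mulr1.
by rewrite integralZl// mulrC EFinM /Rintegral fineK//; exact: integrable_fin_num.
Qed.

Lemma Rintegral_cst_cV0 (c : R) : \int[lebesgue_cV R 0]_x (cst c x) = c.
Proof.
rewrite Rintegral_cst// -[RHS]mulr1.
have E : lebesgue_cV R 0 setT = 1%E by exact: diracT.
by congr (_ * _); rewrite -[RHS]/(fine (1 : \bar R)) -E.
Qed.

Lemma Rintegral_prod_coord n (p : 'I_n -> R -> R) :
  (forall i, leb.-integrable setT (EFin \o p i)) ->
  (lebesgue_cV R n).-integrable setT (EFin \o (fun x : 'cV[R]_n => \prod_i p i (x i 0))) /\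
  \int[lebesgue_cV R n]_x (\prod_i p i (x i 0)) = \prod_i \int[leb]_x p i x.
Proof.
elim: n p => [|n IH] p ip.
  have E : (fun x : 'cV[R]_0 => \prod_i p i (x i 0)) = cst 1.
    by apply/funext => x; rewrite big_ord0.
  rewrite E big_ord0; split.
    by apply: finite_measure_integrable_cst.
  exact: Rintegral_cst_cV0.
have [i1 E1] := IH (fun i => p (lift ord0 i)) (fun i => ip _).
have [i2 E2] := Rintegral_tensor (ip ord0) i1.
have E (x : 'cV[R]_n.+1) : p ord0 (x ord0 0) * \prod_i p (lift ord0 i) (tail_cV x i 0) = \prod_i p i (x i 0).
  rewrite big_ord_recl; congr (_ * _); apply: eq_bigr => i _; by rewrite mxE.
split.
  by apply: eq_integrable i2 => // x _ /=; rewrite E.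
rewrite big_ord_recl -E1 -E2; apply: eq_Rintegral => x _; by rewrite -E.
Qed.

Definition laplace_cV n (e : R) (x : 'cV[R]_n) : R := \prod_i laplace e (x i 0).

(** Cosine and sine have to be treated in one induction, because splitting off the first coordinate
    by the addition formulas mixes them. Every term with an odd number of sines has a vanishing
    factor, and so does the term with two. *)
Lemma Rintegral_laplace_cV n (e : R) (t : 'cV[R]_n) : 0 < e ->
  [/\ (lebesgue_cV R n).-integrable setT (EFin \o (fun x : 'cV[R]_n => laplace_cV e x * cos (dot x t))),
     (lebesgue_cV R n).-integrable setT (EFin \o (fun x : 'cV[R]_n => laplace_cV e x * sin (dot x t))),
  \int[lebesgue_cV R n]_x (laplace_cV e x * cos (dot x t)) = \prod_i (2 * e / (e ^+ 2 + t i 0 ^+ 2)) &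
  \int[lebesgue_cV R n]_x (laplace_cV e x * sin (dot x t)) = 0].
Proof.
move=> e0; elim: n t => [|n IH] t.
  have Ec : (fun x : 'cV[R]_0 => laplace_cV e x * cos (dot x t)) = cst 1.
    by apply/funext => x; rewrite /laplace_cV /dot !big_ord0 cos0 mulr1.
  have Es : (fun x : 'cV[R]_0 => laplace_cV e x * sin (dot x t)) = cst 0.
    by apply/funext => x; rewrite /laplace_cV /dot !big_ord0 sin0 mulr0.
  rewrite Ec Es big_ord0; split.
  - by apply: finite_measure_integrable_cst.
  - by apply: finite_measure_integrable_cst.
  - exact: Rintegral_cst_cV0.
  - exact: Rintegral_cst_cV0.
have [ic iS Ec Es] := IH (tail_cV t).
have ccos : continuous (fun x : R => cos (t ord0 0 * x)).
  move=> x; apply: continuous_comp; last exact: continuous_cos.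
  by apply: continuousM; [exact: cst_continuous|exact: cvg_id].
have csin : continuous (fun x : R => sin (t ord0 0 * x)).
  move=> x; apply: continuous_comp; last exact: continuous_sin.
  by apply: continuousM; [exact: cst_continuous|exact: cvg_id].
have jc := integrable_laplace_mul e0 ccos (fun x => cos_max _).
have js := integrable_laplace_mul e0 csin (fun x => sin_max _).
have [icc Ecc] := Rintegral_tensor jc ic.
have [ics Ecs] := Rintegral_tensor jc iS.
have [isc Esc] := Rintegral_tensor js ic.
have [iss Ess] := Rintegral_tensor js iS.
have dotE (x : 'cV[R]_n.+1) : dot x t = t ord0 0 * x ord0 0 + dot (tail_cV x) (tail_cV t).
  rewrite /dot big_ord_recl mulrC; congr (_ + _); apply: eq_bigr => i _; by rewrite !mxE.
have lE (x : 'cV[R]_n.+1) : laplace_cV e x = laplace e (x ord0 0) * laplace_cV e (tail_cV x).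
  rewrite /laplace_cV big_ord_recl; congr (_ * _); apply: eq_bigr => i _; by rewrite !mxE.
pose a1 := (fun x : 'cV[R]_n.+1 => (laplace e (x ord0 0) * cos (t ord0 0 * x ord0 0)) *
  (laplace_cV e (tail_cV x) * cos (dot (tail_cV x) (tail_cV t)))).
pose a2 := (fun x : 'cV[R]_n.+1 => (laplace e (x ord0 0) * sin (t ord0 0 * x ord0 0)) *
  (laplace_cV e (tail_cV x) * sin (dot (tail_cV x) (tail_cV t)))).
pose a3 := (fun x : 'cV[R]_n.+1 => (laplace e (x ord0 0) * sin (t ord0 0 * x ord0 0)) *
  (laplace_cV e (tail_cV x) * cos (dot (tail_cV x) (tail_cV t)))).
pose a4 := (fun x : 'cV[R]_n.+1 => (laplace e (x ord0 0) * cos (t ord0 0 * x ord0 0)) *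
  (laplace_cV e (tail_cV x) * sin (dot (tail_cV x) (tail_cV t)))).
have EC : (fun x : 'cV[R]_n.+1 => laplace_cV e x * cos (dot x t)) = (fun x => a1 x - a2 x).
  by apply/funext => x; rewrite dotE lE cosD /a1 /a2; ring.
have ES : (fun x : 'cV[R]_n.+1 => laplace_cV e x * sin (dot x t)) = (fun x => a3 x + a4 x).
  by apply/funext => x; rewrite dotE lE sinD /a3 /a4; ring.
rewrite EC ES; split.
- exact: RintegrableB.
- exact: RintegrableD.
- rewrite RintegralB// Ecc Ess Ec Es mulr0 subr0 Rintegral_laplace_cos// big_ord_recl.
  by congr (_ * _); apply: eq_bigr => i _; rewrite mxE.
- by rewrite RintegralD// Esc Ecs Es Rintegral_laplace_sin// mulr0 mul0r addr0.
Qed.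
End tensor.

(** * Hartley integrals with weighted densities *)

Section one_variable.
Context {R : realType}.

Lemma mean_value (f df : R -> R) (a b : R) : (forall x : R, is_derive x 1 f (df x)) ->
  exists2 c, `|c - a| <= `|b - a| & f b - f a = df c * (b - a).
Proof.
move=> fdf.
have cf x : {for x, continuous f}.
  by apply: differentiable_continuous; apply/derivable1_diffP; have [] := fdf x.
have [ab|/ltW ba] := leP a b.
  have [|c] := MVT_segment ab (fun x _ => fdf x); first exact: continuous_subspaceT.
  rewrite in_itv/= => /andP[ac cb] E; exists c => //.
  by rewrite !ger0_norm ?subr_ge0// lerB.
have [|c] := MVT_segment ba (fun x _ => fdf x); first exact: continuous_subspaceT.
rewrite in_itv/= => /andP[bc ca] E; exists c.
  by rewrite -![`|_ - a|]distrC !ger0_norm ?subr_ge0// lerB.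
by rewrite -opprB E -mulrN opprB.
Qed.

Definition cas (t : R) : R := cos t + sin t.

Lemma cas_le2 t : `|cas t| <= 2.
Proof. by rewrite (le_trans (ler_normD _ _))// (_ : 2 = 1 + 1 :> R)// lerD// ?cos_max ?sin_max. Qed.

Lemma is_derive_cas (t : R) : is_derive t 1 cas (cas (- t)).
Proof. by apply: is_derive_eq; rewrite /cas cosN sinN addrC. Qed.

Lemma measurable_cas : measurable_fun [set: R] cas.
Proof.
by apply: measurable_funD; apply: continuous_measurable_fun;
  [exact: continuous_cos|exact: continuous_sin].
Qed.

Lemma cas_lipschitz a b : `|cas b - cas a| <= 2 * `|b - a|.
Proof.
have [c _ ->] := mean_value a b is_derive_cas.
by rewrite normrM ler_wpM2r// cas_le2.
Qed.

(** The mean value theorem for u -> cas(a + u) - u cas(- a), whose derivative cas(- (a + u)) - cas(-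
    a) is at most 2 |u| by the Lipschitz bound. *)
Lemma cas_taylor2 a t : `|cas (a + t) - cas a - t * cas (- a)| <= 2 * t ^+ 2.
Proof.
pose psi u := cas (a + u) - u * cas (- a).
have dpsi (u : R) : is_derive u 1 psi (cas (- (a + u)) - cas (- a)).
  rewrite /psi /cas; apply: is_derive_eq.
  by rewrite /GRing.scale /= !cosN !sinN; ring.
have [c] := mean_value 0 t dpsi; rewrite !subr0 => ct.
rewrite /psi addr0 mul0r subr0 => E.
have -> : cas (a + t) - cas a - t * cas (- a) = (cas (- (a + c)) - cas (- a)) * t.
  by rewrite -E; ring.
have H := cas_lipschitz (- a) (- (a + c)).
have E' : `|- (a + c) - - a| = `|c| by rewrite opprD opprK addrC addrA subrr add0r normrN.
rewrite normrM; rewrite E' in H.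
apply: (@le_trans _ _ (2 * `|t| * `|t|)); last first.
  by rewrite -mulrA -normrM -expr2 ger0_norm ?sqr_ge0.
by rewrite ler_wpM2r// (le_trans H)// ler_wpM2l.
Qed.

(** A global quadratic remainder replaces differentiation under the integral sign: the remainder of
    an integral is estimated by integrating the remainder of cas. *)
Lemma derivable_quadratic (d : nat) (f : 'cV[R]_d -> R) (x v : 'cV[R]_d) (D C : R) :
  (forall t, `|f (x + t *: v) - f x - t * D| <= C * t ^+ 2) ->
  derivable f x v /\ 'D_v f x = D.
Proof.
move=> H.
have C0 : 0 <= C by have := le_trans (normr_ge0 _) (H 1); rewrite expr1n mulr1.
suff F : (fun h : R => h^-1 *: (f (h *: v + x) - f x)) @ 0^' --> D.
  by split; [apply/cvg_ex; exists D|exact: cvg_lim].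
apply/cvgrPdist_le => e e0; near=> h.
have h0 : h != 0 by near: h; exact: nbhs_dnbhs_neq.
have -> : D - h^-1 *: (f (h *: v + x) - f x) = - (h^-1 * (f (x + h *: v) - f x - h * D)).
  by rewrite /GRing.scale /= [x + _]addrC; field.
rewrite normrN normrM normfV ler_pdivrMl ?normr_gt0//.
apply: (le_trans (H h)).
apply: (@le_trans _ _ (C * `|h| * `|h|)).
  by rewrite -mulrA -expr2 -normrX ger0_norm ?sqr_ge0.
rewrite [leRHS]mulrC ler_wpM2r//.
(* The 1 is added because C may be 0. *)
have : `|h| <= e / (C + 1).
  near: h; apply: dnbhs0_le; by rewrite divr_gt0// ltr_wpDl.
rewrite ler_pdivlMr ?ltr_wpDl// => /(le_trans _); apply.
by rewrite mulrC ler_wpM2l// lerDl.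
Unshelve. all: by end_near.
Qed.

End one_variable.

(** * Weighted densities, their Hartley integrals and derivatives *)

Section weights.
Context {R : realType} {d : nat}.
Local Notation mu := (lebesgue_cV R d).
Implicit Types (x y xi : 'cV[R]_d) (H : 'cV[R]_d -> R) (w : R).

Definition wt w xi : R := (1 + enorm xi) `^ w.

Lemma wt_ge0 w xi : 0 <= wt w xi. Proof. exact: powR_ge0. Qed.

Lemma le_wt v w xi : v <= w -> wt v xi <= wt w xi.
Proof. by move=> vw; apply: ler_powR => //; rewrite lerDl enorm_ge0. Qed.

Lemma wt0 xi : wt 0 xi = 1. Proof. exact: powRr0. Qed.

Lemma wt_ge1 w xi : 0 <= w -> 1 <= wt w xi.
Proof. by move=> w0; rewrite -(wt0 xi) le_wt. Qed.

Lemma wtN w xi : wt w (- xi) = wt w xi.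
Proof. by rewrite /wt enormN. Qed.

Lemma wtD v w xi : wt (v + w) xi = wt v xi * wt w xi.
Proof. rewrite /wt powRD//; apply/implyP => _.
by rewrite gt_eqF// ltr_pwDl// enorm_ge0. Qed.

Lemma wt1 xi : wt 1 xi = 1 + enorm xi.
Proof. by rewrite /wt powRr1// addr_ge0// enorm_ge0. Qed.

(** From 1 + |x + y| <= (1 + |x|) (1 + |y|). This inequality is the source of the algebra property
    of the weighted spaces. *)
Lemma wt_submult w x y : 0 <= w -> wt w (x + y) <= wt w x * wt w y.
Proof.
move=> w0; rewrite /wt -powRM ?addr_ge0 ?enorm_ge0//.
apply: ge0_ler_powR; rewrite ?nnegrE ?mulr_ge0 ?addr_ge0 ?enorm_ge0//.
by have := enormD x y; have := enorm_ge0 x; have := enorm_ge0 y; nra.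
Qed.

Lemma measurable_wt w : measurable_fun [set: 'cV[R]_d] (wt w).
Proof.
rewrite (_ : wt w = (fun r => r `^ w) \o (fun xi => 1 + enorm xi))//.
apply: measurableT_comp; first exact: measurable_powR.
by apply: measurable_funD => //; exact: measurable_enorm.
Qed.

Definition bnorm w H : \bar R := (\int[mu]_xi (`|H xi| * wt w xi)%:E)%E.

(** An upper bound in place of the norm itself: bounds are real numbers and add and multiply without
    side conditions on infinity. Measurability of the density travels along. *)
Definition bfin w H (c : R) : Prop := measurable_fun [set: 'cV[R]_d] H /\ (bnorm w H <= c%:E)%E.

Definition hartley H x : R := \int[mu]_xi (H xi * cas (dot x xi)).

Lemma bfin_integrable w H c : bfin w H c ->
  mu.-integrable setT (EFin \o (fun xi => `|H xi| * wt w xi)).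
Proof.
move=> [mH Hc]; apply: Rintegrable_lty.
  by apply: measurable_funM; [exact: measurableT_comp|exact: measurable_wt].
under eq_integral do rewrite ger0_norm ?mulr_ge0 ?wt_ge0//.
by rewrite (le_lt_trans Hc) ?ltry.
Qed.

Lemma bfin_Rintegral w H c : bfin w H c -> \int[mu]_xi (`|H xi| * wt w xi) <= c.
Proof.
move=> Hc; have Hi := bfin_integrable Hc; case: Hc => _ Hc.
by rewrite -lee_fin /Rintegral fineK//; exact: integrable_fin_num.
Qed.

Lemma bfin_ge0 w H c : bfin w H c -> 0 <= c.
Proof.
move/bfin_Rintegral; apply: le_trans; apply: Rintegral_ge0 => xi _.
by rewrite mulr_ge0// wt_ge0.
Qed.

Lemma bfin_le v w H c e : v <= w -> c <= e -> bfin w H c -> bfin v H e.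
Proof.
move=> vw ce [mH Hc]; split=> //.
apply: le_trans (le_trans Hc _); last by rewrite lee_fin.
have m u : measurable_fun setT (fun xi : 'cV[R]_d => (`|H xi| * wt u xi)%:E).
  by apply/measurable_EFinP; apply: measurable_funM; [exact: measurableT_comp|exact: measurable_wt].
apply: ge0_le_integral => //=.
- by move=> x _; rewrite lee_fin mulr_ge0// wt_ge0.
- by move=> x _; rewrite lee_fin ler_wpM2l// le_wt.
Qed.

Lemma bfin_dominated v w H (G : 'cV[R]_d -> R) (a c : R) : bfin w H c -> measurable_fun setT G -> 0 <= a ->
  (forall xi, `|G xi| * wt v xi <= a * (`|H xi| * wt w xi)) -> bfin v G (a * c).
Proof.
move=> Hc mG a0 GH; split=> //; case: (Hc) => mH Hn.
have mHw : measurable_fun setT (fun xi : 'cV[R]_d => (`|H xi| * wt w xi)%:E).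
  by apply/measurable_EFinP; apply: measurable_funM; [exact: measurableT_comp|exact: measurable_wt].
apply: (@le_trans _ _ (\int[mu]_xi (a%:E * (`|H xi| * wt w xi)%:E))%E).
  apply: ge0_le_integral => //=.
  - by move=> x _; rewrite lee_fin mulr_ge0// wt_ge0.
  - by apply/measurable_EFinP; apply: measurable_funM; [exact: measurableT_comp|exact: measurable_wt].
  - exact: measurable_funeM.
  - by move=> x _; rewrite -EFinM lee_fin.
rewrite ge0_integralZl//.
- by rewrite EFinM lee_wpmul2l.
- by move=> x _; rewrite lee_fin mulr_ge0// wt_ge0.
Qed.

Lemma bfin_integrable0 w H c : 0 <= w -> bfin w H c -> mu.-integrable setT (EFin \o H).
Proof.
move=> w0 Hc; have [mH _] := Hc; apply: Rintegrable_le (bfin_integrable Hc) => // xi.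
by rewrite ler_peMr// wt_ge1.
Qed.

Lemma measurable_cas_dot x : measurable_fun [set: 'cV[R]_d] (fun xi => cas (dot x xi)).
Proof. by apply: measurableT_comp; [exact: measurable_cas|exact: measurable_dot]. Qed.

Lemma integrable_cas H x : mu.-integrable setT (EFin \o H) ->
  mu.-integrable setT (EFin \o (fun xi => H xi * cas (dot x xi))).
Proof.
by move=> iH; apply: Rintegrable_bounded => //; [exact: measurable_cas_dot|move=> xi; exact: cas_le2].
Qed.

Lemma Rintegral_oppV H : mu.-integrable setT (EFin \o H) ->
  mu.-integrable setT (EFin \o (fun xi => H (- xi))) /\
  \int[mu]_xi H xi = \int[mu]_xi H (- xi).
Proof.
move=> iH; have N0 : (-1 : R) != 0 by rewrite oppr_eq0 oner_eq0.
have E xi : -1 *: xi + 0 = - xi :> 'cV[R]_d by rewrite addr0 scaleN1r.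
have [] := Rintegral_affine_cV 0 N0 iH.
rewrite normrN1 expr1n mul1r => iH' ->; split.
  by apply: eq_integrable iH' => // xi _ /=; rewrite E.
by apply: eq_Rintegral => xi _; rewrite E.
Qed.


Lemma bfin_opp w H c : bfin w H c -> bfin w (fun xi => H (- xi)) c.
Proof.
move=> [mH Hc]; have mN := measurable_cV_opp (@measurable_id _ 'cV[R]_d setT).
split; first exact: measurableT_comp.
apply: le_trans Hc; rewrite /bnorm.
have N0 : (-1 : R) != 0 by rewrite oppr_eq0 oner_eq0.
have mHw : measurable_fun setT (fun xi : 'cV[R]_d => (`|H xi| * wt w xi)%:E).
  by apply/measurable_EFinP; apply: measurable_funM; [exact: measurableT_comp|exact: measurable_wt].
rewrite [leRHS](integral_affine_cV 0 N0)//; last by move=> x; rewrite lee_fin mulr_ge0// wt_ge0.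
rewrite normrN1 expr1n mul1e.
rewrite le_eqVlt; apply/orP; left; apply/eqP; apply: eq_integral => xi _.
by rewrite addr0 scaleN1r wtN.
Qed.

Lemma bfin_add w H G a c : bfin w H a -> bfin w G c -> bfin w (fun xi => H xi + G xi) (a + c).
Proof.
move=> [mH Ha] [mG Gc]; split; first exact: measurable_funD.
have mm (F : 'cV[R]_d -> R) : measurable_fun setT F -> measurable_fun setT (fun xi : 'cV[R]_d => (`|F xi| * wt w xi)%:E).
  by move=> mF; apply/measurable_EFinP; apply: measurable_funM; [exact: measurableT_comp|exact: measurable_wt].
apply: (@le_trans _ _ (bnorm w H + bnorm w G)%E); last by rewrite EFinD leeD.
rewrite /bnorm -ge0_integralD//=.
- apply: ge0_le_integral => //=.
  + by move=> x _; rewrite lee_fin mulr_ge0// wt_ge0.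
  + by apply: mm; exact: measurable_funD.
  + by apply: emeasurable_funD; exact: mm.
  + by move=> x _; rewrite -EFinD lee_fin -mulrDl ler_wpM2r ?wt_ge0// ler_normD.
- by move=> x _; rewrite lee_fin mulr_ge0// wt_ge0.
- exact: mm.
- by move=> x _; rewrite lee_fin mulr_ge0// wt_ge0.
- exact: mm.
Qed.

Lemma bfin_scale w H a c : bfin w H c -> bfin w (fun xi => a * H xi) (`|a| * c).
Proof.
move=> Hc; have [mH _] := Hc; apply: (bfin_dominated Hc) => //; first exact: measurable_funM.
by move=> xi; rewrite normrM mulrA.
Qed.

Lemma coord_le_wt1 xi i : `|xi i 0| <= wt 1 xi.
Proof. by rewrite wt1 (le_trans (coord_le_enorm _ _))// lerDr. Qed.

(* The density of the j-th partial derivative, because cas' t = cas (- t). *)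
Definition dhartley (j : 'I_d) H xi := - xi j 0 * H (- xi).

Lemma bfin_dhartley j w H c : bfin (w + 1) H c -> bfin w (dhartley j H) c.
Proof.
move=> Hc; have [mH _] := Hc; have := bfin_opp Hc => Hc'; rewrite -(mul1r c).
apply: (bfin_dominated Hc') => //.
  apply: measurable_funM; first by apply: measurable_funN; exact: measurable_coord.
  by have [] := Hc'.
move=> xi; rewrite mul1r addrC wtD /dhartley normrM normrN [`|xi j 0| * _]mulrC -mulrA.
by rewrite ler_wpM2l// ler_wpM2r ?wt_ge0 ?coord_le_wt1.
Qed.

Lemma hartley_bound w H c x : 0 <= w -> bfin w H c -> `|hartley H x| <= 2 * c.
Proof.
move=> w0 Hc; have iH := bfin_integrable0 w0 Hc; have [mH _] := Hc.
apply: (le_trans (le_normr_Rintegral measurableT (integrable_cas x iH))).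
apply: (@le_trans _ _ (\int[mu]_xi (2 * (`|H xi| * wt w xi)))); last first.
  rewrite RintegralZl//; last exact: bfin_integrable Hc.
  by rewrite ler_wpM2l// (bfin_Rintegral Hc).
apply: le_Rintegral => //.
- exact/integrable_norm/integrable_cas.
- by apply: RintegrableZ; exact: bfin_integrable Hc.
- move=> xi _; rewrite normrM mulrC ler_pM// ?cas_le2// ler_peMr// wt_ge1//.
Qed.

Lemma hartley_dhartley w j H c x : 0 <= w -> bfin (w + 1) H c ->
  hartley (dhartley j H) x = \int[mu]_xi (xi j 0 * H xi * cas (- dot x xi)).
Proof.
move=> w0 Hc; rewrite /hartley.
have iD := integrable_cas x (bfin_integrable0 w0 (bfin_dhartley j Hc)).
have [_ ->] := Rintegral_oppV iD.
by apply: eq_Rintegral => xi _; rewrite /dhartley mxE !opprK dotNr.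
Qed.

(** The Taylor bound for cas is integrated against [H]. Its remainder 2 t^2 xi_j^2 costs two powers
    of the weight, and [1 <= w] ensures that the weight w + 1 provides them; the constant 2 c of the
    quadratic remainder arises in this way. *)
Lemma hartley_derive w j H c x : 1 <= w -> bfin (w + 1) H c ->
  derivable (hartley H) x (delta_mx j 0) /\
  'D_(delta_mx j 0) (hartley H) x = hartley (dhartley j H) x.
Proof.
move=> w1 Hc; have w0 : 0 <= w := le_trans ler01 w1.
have w10 : 0 <= w + 1 by rewrite addr_ge0.
have [mH _] := Hc.
have iH := bfin_integrable0 w10 Hc.
apply: (@derivable_quadratic _ _ _ _ _ _ (2 * c)) => t.
rewrite (hartley_dhartley j x w0 Hc) /hartley.
have iD : mu.-integrable setT (EFin \o (fun xi => xi j 0 * H xi * cas (- dot x xi))).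
  have [iD _] := Rintegral_oppV (integrable_cas x (bfin_integrable0 w0 (bfin_dhartley j Hc))).
  by apply: eq_integrable iD => // xi _ /=; rewrite /dhartley mxE !opprK dotNr.
have i1 := integrable_cas (x + t *: delta_mx j 0) iH.
have i2 := integrable_cas x iH.
rewrite -RintegralB// -RintegralZl// -RintegralB//; last 2 first.
- exact: RintegrableB.
- exact: RintegrableZ.
apply: (le_trans (le_normr_Rintegral measurableT _)).
  by apply: RintegrableB; [exact: RintegrableB|exact: RintegrableZ].
apply: (@le_trans _ _ (\int[mu]_xi (2 * t ^+ 2 * (`|H xi| * wt (w + 1) xi)))); last first.
  rewrite RintegralZl//; last exact: bfin_integrable Hc.
  rewrite [2 * c * _]mulrAC ler_wpM2l//; first by rewrite mulr_ge0// sqr_ge0.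
  exact: bfin_Rintegral Hc.
apply: le_Rintegral => //.
- by apply: integrable_norm => //; apply: RintegrableB; [exact: RintegrableB|exact: RintegrableZ].
- by apply: RintegrableZ; exact: bfin_integrable Hc.
- move=> xi _.
  have -> : H xi * cas (dot (x + t *: delta_mx j 0) xi) - H xi * cas (dot x xi) -
      t * (xi j 0 * H xi * cas (- dot x xi)) =
      H xi * (cas (dot x xi + t * xi j 0) - cas (dot x xi) - (t * xi j 0) * cas (- dot x xi)).
    by rewrite dotDl dotZl [dot (delta_mx _ _) _]dotC dot_delta; ring.
  rewrite normrM.
  apply: (@le_trans _ _ (`|H xi| * (2 * (t * xi j 0) ^+ 2))).
    by rewrite ler_wpM2l// cas_taylor2.
  rewrite exprMn [2 * (_ * _)]mulrA mulrCA ler_wpM2l//; first by rewrite mulr_ge0// sqr_ge0.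
  rewrite ler_wpM2l// -[_ ^+ 2]ger0_norm ?sqr_ge0// normrX expr2.
  apply: (@le_trans _ _ (wt 1 xi * wt 1 xi)).
    by rewrite ler_pM// coord_le_wt1.
  by rewrite -wtD le_wt// lerD2r.
Qed.

Lemma hartley_lipschitz w H c x y : 1 <= w -> bfin w H c ->
  `|hartley H y - hartley H x| <= 2 * c * enorm (y - x).
Proof.
move=> w1 Hc; have w0 : 0 <= w := le_trans ler01 w1.
have iH := bfin_integrable0 w0 Hc.
have ix := integrable_cas x iH; have iy := integrable_cas y iH.
rewrite /hartley -RintegralB//.
apply: (le_trans (le_normr_Rintegral measurableT _)); first exact: RintegrableB.
apply: (@le_trans _ _ (\int[mu]_xi (2 * enorm (y - x) * (`|H xi| * wt w xi)))); last first.
  rewrite RintegralZl//; last exact: bfin_integrable Hc.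
  rewrite [leRHS]mulrAC ler_wpM2l ?mulr_ge0 ?enorm_ge0//.
  exact: bfin_Rintegral Hc.
apply: le_Rintegral => //.
- by apply: integrable_norm => //; exact: RintegrableB.
- by apply: RintegrableZ; exact: bfin_integrable Hc.
- move=> xi _; rewrite -mulrBr normrM mulrCA ler_wpM2l//.
  apply: (le_trans (cas_lipschitz _ _)); rewrite -mulrA ler_wpM2l//.
  rewrite -dotNl -dotDl (le_trans (dot_le_enorm _ _))// ler_wpM2l ?enorm_ge0//.
  by apply: le_trans (le_wt _ w1); rewrite wt1 lerDr.
Qed.

End weights.

(** Links the Euclidean norm to the sup norm that defines the topology. The factor [d] is cruder
    than its square root but enough to deduce continuity. *)
Lemma enorm_le_coord (R : realType) d (x : 'cV[R]_d) (b : R) : 0 <= b ->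
  (forall i, `|x i 0| <= b) -> enorm x <= d%:R * b.
Proof.
move=> b0 H; rewrite -(@ler_pXn2r _ 2)// ?nnegrE ?mulr_ge0 ?enorm_ge0//.
rewrite enorm_sqr /dot exprMn.
apply: (@le_trans _ _ (\sum_(i < d) b ^+ 2)).
  apply: ler_sum => i _; rewrite -expr2 -[_ ^+ 2]ger0_norm ?sqr_ge0// normrX.
  by rewrite lerXn2r ?nnegrE.
rewrite sumr_const card_ord -[leLHS]mulr_natl ler_wpM2r ?sqr_ge0//.
rewrite -natrX ler_nat; case: d {x H} => // n; by rewrite expnS leq_pmulr.
Qed.

Lemma lipschitz_continuous_cV (R : realType) d (f : 'cV[R]_d -> R) (C : R) :
  0 <= C -> (forall x y, `|f y - f x| <= C * enorm (y - x)) -> continuous f.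
Proof.
move=> C0 H x; apply/(@cvgrPdist_le _ _ _ (nbhs x) (nbhs_filter x)) => e e0.
have c0 : 0 <= C * d%:R by rewrite mulr_ge0.
have c1 : 0 < C * d%:R + 1 by rewrite ltr_wpDl.
apply/nbhs_ballP; exists (e / (C * d%:R + 1)); first by rewrite /= divr_gt0.
move=> y [_ xy].
apply: (le_trans (H _ _)).
apply: (@le_trans _ _ (C * d%:R * (e / (C * d%:R + 1)))).
  rewrite -mulrA ler_wpM2l//; apply: enorm_le_coord; first by rewrite ltW// divr_gt0.
  by move=> i; rewrite !mxE ltW//; exact: xy.
by rewrite mulrA ler_pdivrMr// mulrC ler_wpM2l ?lerDl// ltW.
Qed.

Lemma hartley_continuous (R : realType) d (w : R) (H : 'cV[R]_d -> R) c : 1 <= w -> bfin w H c -> continuous (hartley H).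
Proof.
move=> w1 Hc; apply: (@lipschitz_continuous_cV _ _ _ (2 * c)).
  by rewrite mulr_ge0// (bfin_ge0 Hc).
by move=> x y; exact: hartley_lipschitz Hc.
Qed.

(** * Convolution and products *)

Section convolution.
Context {R : realType} {d : nat}.
Local Notation mu := (lebesgue_cV R d).
Implicit Types (x y xi : 'cV[R]_d) (H G : 'cV[R]_d -> R) (w : R).

(* Where the integral diverges, on a null set, its value is junk. *)
Definition conv H G (z : 'cV[R]_d) : R := \int[mu]_y (H (z - y) * G y).

Let mdiff : measurable_fun [set: 'cV[R]_d * 'cV[R]_d] (fun p : 'cV[R]_d * 'cV[R]_d => p.1 - p.2).
Proof.
apply: measurable_cV_add; first exact: measurable_fst.
apply: measurable_cV_opp; exact: measurable_snd.
Qed.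

Let mconv H G : measurable_fun [set: 'cV[R]_d] H -> measurable_fun [set: 'cV[R]_d] G ->
  measurable_fun [set: 'cV[R]_d * 'cV[R]_d] (fun p : 'cV[R]_d * 'cV[R]_d => H (p.1 - p.2) * G p.2).
Proof.
move=> mH mG; apply: measurable_funM; first exact: measurableT_comp.
by apply: measurableT_comp => //; exact: measurable_snd.
Qed.

Lemma integral_shift (h : 'cV[R]_d -> \bar R) y : measurable_fun [set: 'cV[R]_d] h ->
  (forall x, 0 <= h x)%E -> (\int[mu]_x h (x - y)%R = \int[mu]_x h x)%E.
Proof.
move=> mh h0; rewrite (integral_affine_cV (- y) (oner_neq0 R) mh h0).
by rewrite normr1 expr1n mul1e; apply: eq_integral => x _; rewrite scale1r.
Qed.

Lemma Rintegral_shift H y : mu.-integrable setT (EFin \o H) ->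
  mu.-integrable setT (EFin \o (fun x => H (x + y))) /\
  \int[mu]_x H x = \int[mu]_x H (x + y).
Proof.
move=> iH; have [] := Rintegral_affine_cV y (oner_neq0 R) iH.
rewrite normr1 expr1n mul1r => iH' ->; split.
  by apply: eq_integrable iH' => // x _ /=; rewrite scale1r.
by apply: eq_Rintegral => x _; rewrite scale1r.
Qed.

(** After exchanging the integrals, the inner one runs over z and is translation invariant. *)
Lemma tonelli_conv (h g : 'cV[R]_d -> R) : measurable_fun [set: 'cV[R]_d] h -> measurable_fun [set: 'cV[R]_d] g ->
  (forall x, 0 <= h x) -> (forall x, 0 <= g x) ->
  (\int[mu]_z \int[mu]_y (h (z - y)%R * g y)%:E = (\int[mu]_x (h x)%:E) * (\int[mu]_x (g x)%:E))%E.
Proof.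
move=> mh mg h0 g0.
rewrite (fubini_tonelli (fun p : 'cV[R]_d * 'cV[R]_d => (h (p.1 - p.2) * g p.2)%:E))/=; last 2 first.
- by apply/measurable_EFinP; exact: mconv.
- by move=> p; rewrite lee_fin mulr_ge0.
have mh' : measurable_fun [set: 'cV[R]_d] (fun x : 'cV[R]_d => (h x)%:E) by exact/measurable_EFinP.
transitivity (\int[mu]_y ((\int[mu]_x (h x)%:E) * (g y)%:E))%E.
  apply: eq_integral => y _.
  under eq_integral do rewrite EFinM.
  rewrite ge0_integralZr//.
  - by congr (_ * _)%E; rewrite (integral_shift y mh').
  - apply/measurable_EFinP; apply: measurableT_comp => //.
    by apply: measurable_cV_add; [exact: measurable_id|exact: measurable_cst].
  - by move=> x _; rewrite lee_fin.
  - by rewrite lee_fin.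
rewrite ge0_integralZl//.
- exact/measurable_EFinP.
- by move=> x _; rewrite lee_fin.
- by apply: integral_ge0 => x _; rewrite lee_fin.
Qed.

Lemma integrable_conv H G : mu.-integrable setT (EFin \o H) -> mu.-integrable setT (EFin \o G) ->
  (mu \x mu)%E.-integrable [set: 'cV[R]_d * 'cV[R]_d] (EFin \o (fun p : 'cV[R]_d * 'cV[R]_d => H (p.1 - p.2) * G p.2)).
Proof.
move=> iH iG; have mH := integrable_measurable iH; have mG := integrable_measurable iG.
apply/integrable12ltyP => /=; first by apply/measurable_EFinP; exact: mconv.
under eq_integral => z _ do under eq_integral => y _ do rewrite normrM.
rewrite (tonelli_conv (h := fun z => `|H z|) (g := fun z => `|G z|))//; last 2 first.
- exact: measurableT_comp.
- exact: measurableT_comp.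
have /integrableP[_ /= H_lty] := iH; have /integrableP[_ /= G_lty] := iG.
apply: lte_mul_pinfty => //; first exact: integral_ge0.
by rewrite ge0_fin_numE//; exact: integral_ge0.
Qed.

Lemma measurable_conv H G : mu.-integrable setT (EFin \o H) -> mu.-integrable setT (EFin \o G) ->
  measurable_fun [set: 'cV[R]_d] (conv H G).
Proof.
move=> iH iG; have := measurable_fubini_F (integrable_conv iH iG) => mF.
rewrite (_ : conv H G = fine \o (fubini_F mu (EFin \o (fun p : 'cV[R]_d * 'cV[R]_d => H (p.1 - p.2) * G p.2))))//.
by apply: measurableT_comp => //; exact: fine_measurable.
Qed.

(** [fine] sends both infinities to 0, so the estimate of a convolution also covers the points where
    its integral diverges. *)
Lemma abs_fine_le (u : \bar R) : (`|fine u|%:E <= `|u|)%E.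
Proof. by case: u => [r| |] //=; rewrite normr0 leey. Qed.

(** Weighted Young inequality: w(z) <= w(z - y) w(y) distributes the weight over the two factors
    under the integral, and Tonelli then separates them. *)
Lemma bfin_conv w H G a c : 0 <= w -> bfin w H a -> bfin w G c -> bfin w (conv H G) (a * c).
Proof.
move=> w0 Ha Gc; have iH := bfin_integrable0 w0 Ha; have iG := bfin_integrable0 w0 Gc.
have [mH nH] := Ha; have [mG nG] := Gc.
split; first exact: measurable_conv.
pose h := fun xi => `|H xi| * wt w xi; pose g := fun xi => `|G xi| * wt w xi.
have mh : measurable_fun [set: 'cV[R]_d] h by apply: measurable_funM; [exact: measurableT_comp|exact: measurable_wt].
have mg : measurable_fun [set: 'cV[R]_d] g by apply: measurable_funM; [exact: measurableT_comp|exact: measurable_wt].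
have h0 xi : 0 <= h xi by rewrite mulr_ge0// wt_ge0.
have g0 xi : 0 <= g xi by rewrite mulr_ge0// wt_ge0.
have mz z : measurable_fun [set: 'cV[R]_d] (fun y => H (z - y) * G y).
  exact: (measurableT_comp (mconv mH mG) (pair1_measurable z)).
have mz' z : measurable_fun [set: 'cV[R]_d] (fun y => h (z - y) * g y).
  exact: (measurableT_comp (mconv mh mg) (pair1_measurable z)).
apply: (@le_trans _ _ (\int[mu]_z \int[mu]_y (h (z - y)%R * g y)%:E)%E); last first.
  rewrite tonelli_conv// EFinM; apply: lee_pmul => //; apply: integral_ge0 => xi _; by rewrite lee_fin.
apply: ge0_le_integral => //=.
- by move=> x _; rewrite lee_fin mulr_ge0// wt_ge0.
- apply/measurable_EFinP; apply: measurable_funM; last exact: measurable_wt.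
  by apply: measurableT_comp => //; exact: measurable_conv.
- apply: (measurable_fun_fubini_tonelli_F (m2 := mu) (fun p : 'cV[R]_d * 'cV[R]_d => (h (p.1 - p.2) * g p.2)%:E)).
    by apply/measurable_EFinP; exact: mconv.
  by move=> p; rewrite lee_fin mulr_ge0.
- move=> z _; rewrite EFinM.
  apply: (@le_trans _ _ ((\int[mu]_y `|H (z - y)%R * G y|%:E) * (wt w z)%:E)%E).
    rewrite lee_wpmul2r ?lee_fin ?wt_ge0// (le_trans (abs_fine_le _))//.
    by apply: le_abse_integral => //; exact/measurable_EFinP.
  rewrite -ge0_integralZr//; last 2 first.
  + by apply/measurable_EFinP; exact: measurableT_comp.
  + by rewrite lee_fin wt_ge0.
  apply: ge0_le_integral => //=.
  + by move=> y _; rewrite -EFinM lee_fin mulr_ge0// wt_ge0.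
  + by apply: emeasurable_funM => //; apply/measurable_EFinP; exact: measurableT_comp.
  + exact/measurable_EFinP.
  + move=> y _; rewrite -EFinM lee_fin normrM /h /g mulrACA ler_wpM2l ?mulr_ge0//.
    by rewrite -[in leLHS](subrK y z) wt_submult.
Qed.

Lemma hartley_conv H G x : mu.-integrable setT (EFin \o H) -> mu.-integrable setT (EFin \o G) ->
  hartley (conv H G) x = \int[mu]_y (G y * \int[mu]_xi (H xi * cas (dot x (xi + y)))).
Proof.
move=> iH iG; have mH := integrable_measurable iH; have mG := integrable_measurable iG.
pose k (p : 'cV[R]_d * 'cV[R]_d) := H (p.1 - p.2) * G p.2 * cas (dot x p.1).
have ik : (mu \x mu)%E.-integrable [set: 'cV[R]_d * 'cV[R]_d] (EFin \o k).
  apply: (Rintegrable_bounded (C := 2)) => //; first exact: integrable_conv.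
  by apply: (measurableT_comp (measurable_cas_dot x)); exact: measurable_fst.
  by move=> p; exact: cas_le2.
have E := integral12_prod_meas1 ik; rewrite -(integral21_prod_meas1 ik) in E.
rewrite /fubini_F /fubini_G in E.
transitivity (fine (\int[mu]_z \int[mu]_y (k (z, y))%:E)%E).
  rewrite /hartley /Rintegral; congr fine.
  (* The integrands agree only where y -> H(z - y) G(y) is integrable; elsewhere, on a null set,
     [conv] has a default value. *)
  clear E; apply: ae_eq_integral.
  - exact: measurableT.
  - apply/measurable_EFinP; apply: measurable_funM; first exact: measurable_conv.
    exact: measurable_cas_dot.
  - exact: (measurable_fubini_F ik).
  - have := ae_integrable1 (integrable_conv iH iG); apply: filterS => z /= iz _.
    have iz' : mu.-integrable setT (EFin \o (fun y => H (z - y) * G y)) by exact: iz.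
    clear ik; rewrite /conv mulrC -(RintegralZl _ measurableT iz') /Rintegral fineK.
      by apply: eq_integral => y _; rewrite mulrC.
    exact: integrable_fin_num (RintegrableZ _ iz').
rewrite E; clear E; rewrite /Rintegral; congr fine; apply: eq_integral => y _; clear ik.
have [iHy _] := Rintegral_shift (- y) iH.
have iHc : mu.-integrable setT (EFin \o (fun z => H (z - y) * cas (dot x z))).
  exact: integrable_cas.
transitivity (\int[mu]_z (G y * (H (z - y) * cas (dot x z)))%:E)%E.
  by apply: eq_integral => z _; rewrite /= /k /= -mulrA mulrCA.
rewrite -[LHS]fineK; last exact: integrable_fin_num (RintegrableZ _ iHc).
congr EFin; rewrite -[LHS]/(\int[mu]_z (G y * (H (z - y) * cas (dot x z)))).
rewrite (RintegralZl _ measurableT iHc) [in LHS](proj2 (Rintegral_shift y iHc)) /Rintegral.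
by congr (_ * fine _); apply: eq_integral => z _; rewrite addrK.
Qed.

Definition hcos H x := \int[mu]_xi (H xi * cos (dot x xi)).
Definition hsin H x := \int[mu]_xi (H xi * sin (dot x xi)).

Let mcos x : measurable_fun [set: 'cV[R]_d] (fun xi => cos (dot x xi)).
Proof.
apply: measurableT_comp; last exact: measurable_dot.
by apply: continuous_measurable_fun; exact: continuous_cos.
Qed.

Let msin x : measurable_fun [set: 'cV[R]_d] (fun xi => sin (dot x xi)).
Proof.
apply: measurableT_comp; last exact: measurable_dot.
by apply: continuous_measurable_fun; exact: continuous_sin.
Qed.

Lemma integrable_cos H x : mu.-integrable setT (EFin \o H) ->
  mu.-integrable setT (EFin \o (fun xi => H xi * cos (dot x xi))).
Proof. by move=> iH; apply: (Rintegrable_bounded (C := 1)) => // xi; exact: cos_max. Qed.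

Lemma integrable_sin H x : mu.-integrable setT (EFin \o H) ->
  mu.-integrable setT (EFin \o (fun xi => H xi * sin (dot x xi))).
Proof. by move=> iH; apply: (Rintegrable_bounded (C := 1)) => // xi; exact: sin_max. Qed.

Lemma hartleyE H x : mu.-integrable setT (EFin \o H) -> hartley H x = hcos H x + hsin H x.
Proof.
move=> iH; rewrite /hcos /hsin -RintegralD//; [|exact: integrable_cos|exact: integrable_sin].
by apply: eq_Rintegral => xi _; rewrite -mulrDr.
Qed.

Lemma hartley_convE H G x : mu.-integrable setT (EFin \o H) -> mu.-integrable setT (EFin \o G) ->
  hartley (conv H G) x = (hcos H x + hsin H x) * hcos G x + (hcos H x - hsin H x) * hsin G x.
Proof.
move=> iH iG; rewrite hartley_conv//.
have iHc := integrable_cos x iH; have iHs := integrable_sin x iH.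
have iGc := integrable_cos x iG; have iGs := integrable_sin x iG.
rewrite /hcos /hsin -!/(hcos _ _) -!/(hsin _ _) -!RintegralZl// -RintegralD//; last 2 first.
- exact: RintegrableZ.
- exact: RintegrableZ.
apply: eq_Rintegral => y _.
have -> : \int[mu]_xi (H xi * cas (dot x (xi + y))) =
    (cos (dot x y) + sin (dot x y)) * hcos H x + (cos (dot x y) - sin (dot x y)) * hsin H x.
  rewrite /hcos /hsin -!RintegralZl// -RintegralD//; last 2 first.
  - exact: RintegrableZ.
  - exact: RintegrableZ.
  apply: eq_Rintegral => xi _; rewrite dotDr /cas cosD sinD; ring.
ring.
Qed.

Lemma hcos_opp H x : mu.-integrable setT (EFin \o H) -> hcos (fun xi => H (- xi)) x = hcos H x.
Proof.
move=> iH; rewrite /hcos; have [_ ->] := Rintegral_oppV (integrable_cos x iH).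
by apply: eq_Rintegral => xi _; rewrite dotNr cosN.
Qed.

Lemma hsin_opp H x : mu.-integrable setT (EFin \o H) -> hsin (fun xi => H (- xi)) x = - hsin H x.
Proof.
move=> iH; rewrite /hsin; have iS := integrable_sin x iH; have [iS' ->] := Rintegral_oppV iS.
rewrite -mulN1r -RintegralZl//.
by apply: eq_Rintegral => xi _; rewrite dotNr sinN; ring.
Qed.

(* cas a cas b = cos (a - b) + sin (a + b)
     = (cas (a + b) + cas (a - b) + cas (b - a) - cas (- a - b)) / 2 *)
Definition hprod H G : 'cV[R]_d -> R := fun z =>
  2^-1 * (conv H G z + conv H (fun xi => G (- xi)) z +
    (conv (fun xi => H (- xi)) G z + (- 1) * conv (fun xi => H (- xi)) (fun xi => G (- xi)) z)).

(** Four convolutions, each bounded by a c, and the prefactor 1/2 give the factor 2. Reflection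
    leaves the weighted norm unchanged. *)
Lemma bfin_hprod w H G a c : 0 <= w -> bfin w H a -> bfin w G c -> bfin w (hprod H G) (2 * (a * c)).
Proof.
move=> w0 Ha Gc; have Ha' := bfin_opp Ha; have Gc' := bfin_opp Gc.
have := bfin_scale 2^-1 (bfin_add (bfin_add (bfin_conv w0 Ha Gc) (bfin_conv w0 Ha Gc'))
  (bfin_add (bfin_conv w0 Ha' Gc) (bfin_scale (-1) (bfin_conv w0 Ha' Gc')))).
by apply: bfin_le => //; rewrite normrN1 mul1r ger0_norm ?invr_ge0//; lra.
Qed.

Lemma integrable_conv1 H G : mu.-integrable setT (EFin \o H) -> mu.-integrable setT (EFin \o G) ->
  mu.-integrable setT (EFin \o conv H G).
Proof.
have L F : mu.-integrable setT (EFin \o F) -> bfin 0 F (\int[mu]_x `|F x|).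
  move=> iF; split; first exact: integrable_measurable iF.
  rewrite /bnorm; under eq_integral do rewrite wt0 mulr1.
  rewrite /Rintegral fineK//; apply: integrable_fin_num => //; exact: integrable_norm.
by move=> /L iH /L iG; exact: (bfin_integrable0 (lexx 0) (bfin_conv (lexx 0) iH iG)).
Qed.

(** Reflecting a density keeps its cosine transform and changes the sign of its sine transform. In
    these terms the four convolutions combine to (hcos H + hsin H) (hcos G + hsin G). *)
Lemma hartley_hprod H G x : mu.-integrable setT (EFin \o H) -> mu.-integrable setT (EFin \o G) ->
  hartley (hprod H G) x = hartley H x * hartley G x.
Proof.
move=> iH iG; have [iH' _] := Rintegral_oppV iH; have [iG' _] := Rintegral_oppV iG.
have c1 := integrable_cas x (integrable_conv1 iH iG).
have c2 := integrable_cas x (integrable_conv1 iH iG').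
have c3 := integrable_cas x (integrable_conv1 iH' iG).
have c4 := integrable_cas x (integrable_conv1 iH' iG').
transitivity (2^-1 * (hartley (conv H G) x + hartley (conv H (fun xi => G (- xi))) x +
   (hartley (conv (fun xi => H (- xi)) G) x + (- 1) * hartley (conv (fun xi => H (- xi)) (fun xi => G (- xi))) x))).
  have c4' := RintegrableZ (-1) c4; have c12 := RintegrableD c1 c2; have c34 := RintegrableD c3 c4'.
  rewrite /hartley -(RintegralZl (-1) measurableT c4) -(RintegralD measurableT c1 c2).
  rewrite -(RintegralD measurableT c3 c4') -(RintegralD measurableT c12 c34).
  rewrite -(RintegralZl 2^-1 measurableT (RintegrableD c12 c34)).
  by apply: eq_Rintegral => z _; rewrite /hprod; ring.
rewrite !hartley_convE// !hartleyE// !hcos_opp// !hsin_opp//.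
by field.
Qed.

End convolution.

(** * Series, derivatives and the resolvent *)

Section hartley_series.
Context {R : realType} {d : nat}.
Implicit Types (w : R).
Local Notation mu := (lebesgue_cV R d).

Lemma Rintegral_zero : \int[mu]_x (0 : R) = 0.
Proof. by rewrite /Rintegral integral0. Qed.

Lemma Rintegral_bigsum (F : nat -> 'cV[R]_d -> R) n :
  (forall k, mu.-integrable setT (EFin \o F k)) ->
  mu.-integrable setT (EFin \o (fun x => \sum_(0 <= k < n) F k x)) /\
  \int[mu]_x (\sum_(0 <= k < n) F k x) = \sum_(0 <= k < n) \int[mu]_x F k x.
Proof.
move=> iF; elim: n => [|n [IH1 IH2]].
  rewrite big_geq//; split.
    by apply: eq_integrable (integrable0 mu setT) => // x _ /=; rewrite big_geq.
  by rewrite -[RHS]Rintegral_zero; apply: eq_Rintegral => x _; rewrite big_geq.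
split.
  by apply: eq_integrable (RintegrableD IH1 (iF n)) => // x _ /=; rewrite big_nat_recr.
rewrite big_nat_recr//= -IH2 -RintegralD//.
by apply: eq_Rintegral => x _; rewrite big_nat_recr.
Qed.

(** Completeness of the weighted L^1 space, for absolutely convergent series. [G], the sum of the
    weighted absolute values, is integrable by monotone convergence and dominates everything. The
    multipliers [m] stand for cas(x . xi) and its first and second derivatives in x. *)
Lemma bfin_series w (Hk : nat -> 'cV[R]_d -> R) (c : nat -> R) (C : R) : 0 <= w ->
  (forall k, bfin w (Hk k) (c k)) -> (forall n, \sum_(0 <= k < n) c k <= C) ->
  exists H, bfin w H C /\
    forall m : 'cV[R]_d -> R, measurable_fun setT m -> (forall xi, `|m xi| <= 2 * wt w xi) ->
      (fun n => \sum_(0 <= k < n) \int[mu]_xi (Hk k xi * m xi)) @ \oo --> \int[mu]_xi (H xi * m xi).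
Proof.
move=> w0 Hc cC.
have mH k : measurable_fun setT (Hk k) by have [] := Hc k.
pose a k xi := `|Hk k xi| * wt w xi.
have a0 k xi : 0 <= a k xi by rewrite mulr_ge0// wt_ge0.
have ma k : measurable_fun setT (fun xi => (a k xi)%:E).
  by apply/measurable_EFinP; apply: measurable_funM; [exact: measurableT_comp|exact: measurable_wt].
pose G xi := (\sum_(0 <= k <oo) (a k xi)%:E)%E.
have mG : measurable_fun setT G.
  by apply: (ge0_emeasurable_sum (P := xpredT)) => // k x _ _; rewrite lee_fin.
have G0 xi : (0 <= G xi)%E by apply: nneseries_ge0 => k _ _; rewrite lee_fin.
have leG n xi : ((\sum_(0 <= k < n) a k xi)%:E <= G xi)%E.
  rewrite -sumEFin; apply: nneseries_lim_ge => k _ _; by rewrite lee_fin.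
have intG : (\int[mu]_xi G xi <= C%:E)%E.
  rewrite /G integral_nneseries//; last by move=> k x _; rewrite lee_fin.
  apply: lime_le.
    by apply: is_cvg_nneseries => k _ _; apply: integral_ge0 => x _; rewrite lee_fin.
  apply: nearW => n.
  apply: (@le_trans _ _ (\sum_(0 <= k < n) (c k)%:E)%E).
    by apply: lee_sum => k _; have [_] := Hc k.
  by rewrite sumEFin lee_fin.
have iG : mu.-integrable setT G.
  apply/integrableP; split=> //; under eq_integral do rewrite gee0_abs//.
  by rewrite (le_lt_trans intG)// ltry.
pose S n xi := \sum_(0 <= k < n) Hk k xi.
have mS n : measurable_fun setT (S n).
  by apply: measurable_sum => k.
(* The upper limit is measurable without any convergence; it is the sum of the
   series wherever G is finite, that is almost everywhere. *)
pose H xi := fine (limn_esup (fun n => (S n xi)%:E)).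
have mHH : measurable_fun setT H.
  apply: measurableT_comp => //.
  by apply: measurable_fun_limn_esup => n; exact/measurable_EFinP.
have S_le n xi : `|S n xi| * wt w xi <= \sum_(0 <= k < n) a k xi.
  rewrite /S /a -mulr_suml ler_wpM2r ?wt_ge0//; exact: ler_norm_sum.
(* The weight is at least 1, so finiteness of [G] makes the unweighted series converge absolutely at
   this point. *)
have key xi : (G xi < +oo)%E -> (S n xi @[n --> \oo] --> H xi) /\ ((`|H xi| * wt w xi)%:E <= G xi)%E.
  move=> Gfin.
  have GE : G xi = (fine (G xi))%:E by rewrite fineK// ge0_fin_numE.
  have cS : cvgn (S ^~ xi).
    apply: (@normed_cvg R R (fun k => Hk k xi)).
    apply: nondecreasing_is_cvgn.
      apply/nondecreasing_seqP => n; rewrite /= !seriesEnat /= big_nat_recr//= lerDl//.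
    exists (fine (G xi)) => _ [n _ <-].
    rewrite -lee_fin -GE; apply: le_trans (leG n xi); rewrite lee_fin /= seriesEnat.
    apply: ler_sum => k _; by rewrite /a ler_peMr// wt_ge1.
  have HE : H xi = limn (S ^~ xi).
    have : (fun n => (S n xi)%:E) @ \oo --> (limn (S ^~ xi))%:E.
      by apply/fine_cvgP; split; [exact: nearW|exact: cS].
    by move=> /cvg_limn_einf_sup[_ E]; rewrite /H E.
  split; first by rewrite HE.
  rewrite GE lee_fin.
  have cN : `|S n xi| * wt w xi @[n --> \oo] --> `|H xi| * wt w xi.
    by apply: cvgM; [apply: cvg_norm; rewrite HE|exact: cvg_cst].
  rewrite -(cvg_lim _ cN)//; apply: limr_le; first by apply/cvg_ex; exists (`|H xi| * wt w xi).
  apply: nearW => n; rewrite -lee_fin -GE; apply: le_trans (leG n xi).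
  by rewrite lee_fin.
exists H; split.
  split=> //; apply: le_trans intG; apply: ge0_le_integral => //=.
  - by move=> x _; rewrite lee_fin mulr_ge0// wt_ge0.
  - by apply/measurable_EFinP; apply: measurable_funM; [exact: measurableT_comp|exact: measurable_wt].
  - move=> x _; have [/key[]//|] := ltP (G x) +oo%E; by rewrite leye_eq => /eqP ->; rewrite leey.
move=> m mm mw.
have imk k : mu.-integrable setT (EFin \o (fun xi => Hk k xi * m xi)).
  apply: (Rintegrable_le _ _ (RintegrableZ 2 (bfin_integrable (Hc k)))).
    exact: measurable_funM.
  by move=> x; rewrite normrM mulrCA ler_wpM2l.
have [] := @dominated_convergence _ _ _ mu setT measurableT (fun n xi => (S n xi * m xi)%:E)
  (fun xi => (H xi * m xi)%:E) (fun xi => 2%:E * G xi)%E.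
- by move=> n; apply/measurable_EFinP; exact: measurable_funM.
- by apply/measurable_EFinP; exact: measurable_funM.
- have := integrable_ae measurableT iG; apply: filterS => x /(_ Logic.I).
  rewrite ge0_fin_numE// => /key[cS _] _.
  by apply/fine_cvgP; split; [exact: nearW|apply: cvgM; [exact: cS|exact: cvg_cst]].
- exact: integrableZl.
- apply: aeW => x n _.
  apply: (@le_trans _ _ (2 * \sum_(0 <= k < n) a k x)%:E); last by rewrite EFinM lee_wpmul2l.
  rewrite lee_fin normrM; apply: (@le_trans _ _ (2 * (`|S n x| * wt w x))).
    by rewrite mulrCA ler_wpM2l.
  by rewrite ler_wpM2l.
move=> iHm _ cI.
have E : (\int[mu]_xi (H xi * m xi)%:E)%E = (\int[mu]_xi (H xi * m xi))%:E.
  by rewrite /Rintegral fineK//; exact: integrable_fin_num.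
rewrite /= E in cI; move/fine_cvg : cI.
apply: cvg_trans; apply: near_eq_cvg; apply: nearW => n /=.
have [_ <-] := Rintegral_bigsum n imk.
by rewrite /Rintegral; congr fine; apply: eq_integral => x _; rewrite /S mulr_suml.
Qed.

End hartley_series.

(** * Barron functions: algebra, derivatives, resolvent and series *)

Section barron_algebra.
Context {R : realType} {d : nat}.
Local Notation mu := (lebesgue_cV R d).
Implicit Types (h V : 'cV[R]_d -> R) (w : R).

(* The norm of h in B^w is at most c, up to an absolute constant. *)
Definition bn w (c : R) h := exists H, bfin w H c /\ h = hartley H.

Lemma bn_le v w c e h : v <= w -> c <= e -> bn w c h -> bn v e h.
Proof. by move=> vw ce [H [Hc ->]]; exists H; split=> //; exact: bfin_le Hc. Qed.

Lemma bn_add w c e h k : 0 <= w -> bn w c h -> bn w e k -> bn w (c + e) (fun x => h x + k x).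
Proof.
move=> w0 [H [Hc ->]] [K [Ke ->]]; exists (fun xi => H xi + K xi); split; first exact: bfin_add.
apply/funext => x; rewrite /hartley -RintegralD//; first last.
- exact: integrable_cas (bfin_integrable0 w0 Ke).
- exact: integrable_cas (bfin_integrable0 w0 Hc).
by apply: eq_Rintegral => xi _; rewrite mulrDl.
Qed.

Lemma bn_scale w a c h : 0 <= w -> bn w c h -> bn w (`|a| * c) (fun x => a * h x).
Proof.
move=> w0 [H [Hc ->]]; exists (fun xi => a * H xi); split; first exact: bfin_scale.
apply/funext => x; rewrite /hartley -RintegralZl//; last exact: integrable_cas (bfin_integrable0 w0 Hc).
by apply: eq_Rintegral => xi _; rewrite mulrA.
Qed.

Lemma bn_mul w c e h k : 0 <= w -> bn w c h -> bn w e k -> bn w (2 * (c * e)) (fun x => h x * k x).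
Proof.
move=> w0 [H [Hc ->]] [K [Ke ->]]; exists (hprod H K); split; first exact: bfin_hprod.
by apply/funext => x; rewrite hartley_hprod//; [exact: bfin_integrable0 Hc|exact: bfin_integrable0 Ke].
Qed.

Lemma bn0 w : bn w 0 (fun=> 0).
Proof.
exists (fun=> 0); split.
  by split=> //; rewrite /bnorm; under eq_integral do rewrite normr0 mul0r; rewrite integral0.
apply/funext => x; rewrite /hartley -[LHS](@Rintegral_zero R d).
by apply: eq_Rintegral => xi _; rewrite mul0r.
Qed.

Lemma bn_sum (I : Type) (r : seq I) w (c : I -> R) (h : I -> 'cV[R]_d -> R) : 0 <= w ->
  (forall i, bn w (c i) (h i)) -> bn w (\sum_(i <- r) c i) (fun x => \sum_(i <- r) h i x).
Proof.
move=> w0 H; elim: r => [|i r IH].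
  rewrite big_nil (_ : (fun x => _) = fun=> 0); first exact: bn0.
  by apply/funext => x; rewrite big_nil.
rewrite big_cons (_ : (fun x => _) = fun x => h i x + \sum_(i <- r) h i x); first exact: bn_add.
by apply/funext => x; rewrite big_cons.
Qed.

Lemma bn_ge0 w c h : bn w c h -> 0 <= c.
Proof. by move=> [H [Hc _]]; exact: bfin_ge0 Hc. Qed.

Lemma partial_hartley w j c (H : 'cV[R]_d -> R) : 1 <= w -> bfin (w + 1) H c ->
  partial j (hartley H) = hartley (dhartley j H).
Proof. by move=> w1 Hc; apply/funext => x; have [] := hartley_derive j x w1 Hc. Qed.

Lemma bn_partial w j c h : 1 <= w -> bn (w + 1) c h ->
  bn w c (partial j h) /\ forall x, derivable h x (delta_mx j 0).
Proof.
move=> w1 [H [Hc ->]]; rewrite (partial_hartley j w1 Hc); split.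
  by exists (dhartley j H); split; [exact: bfin_dhartley|].
by move=> x; have [] := hartley_derive j x w1 Hc.
Qed.

Lemma bn_continuous w c h : 1 <= w -> bn w c h -> continuous h.
Proof. by move=> w1 [H [Hc ->]]; exact: hartley_continuous Hc. Qed.

Lemma bn_partials w k c h l : k%:R + 1 <= w -> bn w c h -> (size l <= k)%N ->
  bn (w - (size l)%:R) c (partials l h).
Proof.
move=> kw hc; elim: l => [|i l IH] /= lk; first by rewrite subr0.
have w1 : 1 <= w - (size l).+1%:R.
  rewrite lerBrDl (le_trans _ kw)// lerD2r ler_nat//.
have E : w - (size l).+1%:R + 1 = w - (size l)%:R by rewrite -natr1; ring.
have hl : bn (w - (size l).+1%:R + 1) c (partials l h) by rewrite E; apply: IH; exact: ltnW.
by have [] := bn_partial i w1 hl.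
Qed.

(** Each derivative consumes one unit of weight; the last unit pays for the Lipschitz bound from
    which continuity is deduced. *)
Lemma bn_Ck w k c h : k%:R + 1 <= w -> bn w c h -> Ck k h.
Proof.
move=> kw hc l lk; have hl := bn_partials kw hc lk; split.
  apply: bn_continuous hl.
  by rewrite lerBrDl (le_trans _ kw)// lerD2r ler_nat.
move=> lk' i x.
have w1 : 1 <= w - (size l).+1%:R.
  by rewrite lerBrDl (le_trans _ kw)// lerD2r ler_nat.
have E : w - (size l).+1%:R + 1 = w - (size l)%:R by rewrite -natr1; ring.
by have [|_] := @bn_partial (w - (size l).+1%:R) i c (partials l h) w1; rewrite ?E.
Qed.


Lemma partials2_hartley w j c (H : 'cV[R]_d -> R) : 2 <= w -> bfin (w + 1) H c ->
  partials [:: j; j] (hartley H) = hartley (fun xi => - xi j 0 ^+ 2 * H xi).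
Proof.
move=> w2 Hc; have w1 : 1 <= w by rewrite (le_trans _ w2)// ler1n.
rewrite /partials /= (partial_hartley j w1 Hc).
have Hc' : bfin (w - 1 + 1) (dhartley j H) c by rewrite subrK; exact: bfin_dhartley.
rewrite (partial_hartley j _ Hc'); last by rewrite lerBrDr (_ : 1 + 1 = 2).
by congr hartley; apply/funext => xi; rewrite /dhartley opprK mxE; ring.
Qed.

Lemma bfin_mul_coord2 w j c (H : 'cV[R]_d -> R) : bfin (w + 2) H c ->
  bfin w (fun xi => - xi j 0 ^+ 2 * H xi) c.
Proof.
move=> Hc; have E : w + 2 = w + 1 + 1 by ring.
rewrite E in Hc; have := bfin_dhartley j (bfin_dhartley j Hc).
rewrite (_ : dhartley j _ = fun xi => - xi j 0 ^+ 2 * H xi)//.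
by apply/funext => xi; rewrite /dhartley opprK mxE; ring.
Qed.

(** The density is divided by gamma + |xi|^2. The condition on gamma ensures 1 + r <= kappa (gamma +
    r^2) for all r: one has kappa r^2 - r + 1 / (4 kappa) = kappa (r - 1 / (2 kappa))^2 >= 0, so it
    remains that kappa gamma >= 1 + 1 / (4 kappa). *)
Lemma bn_resolvent w c h (kappa gamma : R) : 2 <= w -> 0 < kappa ->
  kappa^-1 + kappa ^- 2 / 4 <= gamma -> bn w c h ->
  exists W, bn (w + 1) (kappa * c) W /\ forall x, gamma * W x - laplacian W x = h x.
Proof.
move=> w2 k0 kg [H [Hc ->]]; have [mH _] := Hc.
have w0 : 0 <= w by rewrite (le_trans _ w2).
have w10 : 0 <= w + 1 by rewrite addr_ge0.
have ki0 : 0 < kappa^-1 by rewrite invr_gt0.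
have g0 : 0 < gamma by apply: lt_le_trans kg; rewrite ltr_pwDl// mulr_ge0// invr_ge0 exprn_ge0// ltW.
have den0 (xi : 'cV[R]_d) : 0 < gamma + enorm xi ^+ 2 by rewrite ltr_pwDl// sqr_ge0.
pose K (xi : 'cV[R]_d) := (gamma + enorm xi ^+ 2)^-1 * H xi.
have mK : measurable_fun [set: 'cV[R]_d] K.
  apply: measurable_funM => //.
  rewrite (_ : (fun xi => _) = (fun r : R => r `^ (-1)) \o (fun xi : 'cV[R]_d => gamma + enorm xi ^+ 2)).
    apply: measurableT_comp; first exact: measurable_powR.
    by apply: measurable_funD => //; apply: measurable_funX; exact: measurable_enorm.
  by apply/funext => xi /=; rewrite powR_inv1// ltW.
have Kc : bfin (w + 1) K (kappa * c).
  apply: (bfin_dominated Hc) => //; first exact: ltW.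
  move=> xi; rewrite /K normrM normfV (gtr0_norm (den0 xi)) wtD wt1 -mulrA ler_pdivrMl//.
  have r0 := enorm_ge0 xi; set r := enorm xi in r0 *.
  have kr : 1 + r <= kappa * (gamma + r ^+ 2).
    have H1 : 1 + kappa^-1 / 4 <= kappa * gamma.
      have -> : 1 + kappa^-1 / 4 = kappa * (kappa^-1 + kappa ^- 2 / 4) by field; rewrite gt_eqF.
      by rewrite ler_wpM2l// ltW.
    have H2 : r <= kappa * r ^+ 2 + kappa^-1 / 4.
      rewrite -subr_ge0 (_ : _ - r = kappa * (r - kappa^-1 / 2) ^+ 2); last by field; rewrite gt_eqF.
      by rewrite mulr_ge0 ?sqr_ge0// ltW.
    by rewrite mulrDr; lra.
  rewrite mulrA [leRHS](_ : _ = `|H xi| * wt w xi * (kappa * (gamma + r ^+ 2))); last by ring.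
  by rewrite ler_wpM2l// mulr_ge0// wt_ge0.
exists (hartley K); split; first by exists K.
move=> x; rewrite /laplacian.
pose L (j : 'I_d) (xi : 'cV[R]_d) := - xi j 0 ^+ 2 * K xi.
have Lc j : bfin (w - 1) (L j) (kappa * c).
  by apply: bfin_mul_coord2; rewrite (_ : w - 1 + 2 = w + 1)//; ring.
have w11 : 0 <= w - 1 by rewrite subr_ge0 (le_trans _ w2)// ler1n.
have iL j := integrable_cas x (bfin_integrable0 w11 (Lc j)).
have iK := integrable_cas x (bfin_integrable0 w10 Kc).
have S (r : seq 'I_d) : mu.-integrable setT (EFin \o (fun xi => \sum_(j <- r) L j xi * cas (dot x xi))) /\
    \sum_(j <- r) partials [:: j; j] (hartley K) x = \int[mu]_xi (\sum_(j <- r) L j xi * cas (dot x xi)).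
  elim: r => [|j r [IH1 IH2]].
    rewrite big_nil; split.
      by apply: eq_integrable (integrable0 mu setT) => // xi _ /=; rewrite big_nil.
    by rewrite -[LHS](@Rintegral_zero R d); apply: eq_Rintegral => xi _; rewrite big_nil.
  split.
    by apply: eq_integrable (RintegrableD (iL j) IH1) => // xi _ /=; rewrite big_cons.
  rewrite big_cons IH2 (partials2_hartley j w2 Kc) -RintegralD//; last exact: iL.
  by apply: eq_Rintegral => xi _; rewrite big_cons.
have [S1 ->] := S (index_enum ('I_d : finType)).
rewrite /hartley -RintegralZl// -RintegralB//; last exact: RintegrableZ.
apply: eq_Rintegral => xi _; rewrite -mulr_suml mulrA -mulrBl; congr (_ * _).
rewrite /L -mulr_suml -mulrBl sumrN opprK /K mulrA.
rewrite (_ : \sum_i xi i 0 ^+ 2 = enorm xi ^+ 2); last first.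
  by rewrite enorm_sqr; apply: eq_bigr => i _; rewrite expr2.
by rewrite mulfV ?mul1r// gt_eqF.
Qed.

(** One limiting density serves for the function and its derivatives, which are integrals of that
    density against three multipliers. The second derivatives have multipliers of size 2 (1 +
    |xi|)^2, controlled since [2 <= w]. *)
Lemma bn_series w (W : nat -> 'cV[R]_d -> R) (c : nat -> R) (C : R) : 2 <= w ->
  (forall k, bn (w + 1) (c k) (W k)) -> (forall n, \sum_(0 <= k < n) c k <= C) ->
  exists V, [/\ bn (w + 1) C V,
    forall x, (fun n => \sum_(0 <= k < n) W k x) @ \oo --> V x,
    forall j x, (fun n => \sum_(0 <= k < n) partial j (W k) x) @ \oo --> partial j V x &
    forall j x, (fun n => \sum_(0 <= k < n) partials [:: j; j] (W k) x) @ \oo --> partials [:: j; j] V x].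
Proof.
move=> w2 Wc cC; have w0 : 0 <= w by rewrite (le_trans _ w2).
have w1 : 1 <= w by rewrite (le_trans _ w2)// ler1n.
have w10 : 0 <= w + 1 by rewrite addr_ge0.
have /choice[Hk HkE] := Wc.
have Hc k : bfin (w + 1) (Hk k) (c k) by have [] := HkE k.
have WE k : W k = hartley (Hk k) by have [] := HkE k.
have [H [HC Hcv]] := bfin_series w10 Hc cC.
exists (hartley H); split; first by exists H.
- move=> x.
  have := Hcv _ (measurable_cas_dot x); rewrite -/(hartley H x).
  under eq_cvg do under eq_bigr do rewrite -/(hartley _ _) -WE; apply => xi.
  by rewrite (le_trans (cas_le2 _))// ler_peMr// wt_ge1.
- move=> j x; pose m (xi : 'cV[R]_d) := xi j 0 * cas (- dot x xi).
  have mm : measurable_fun [set: 'cV[R]_d] m.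
    apply: measurable_funM; first exact: measurable_coord.
    apply: measurableT_comp; first exact: measurable_cas.
    by apply: measurable_funN; exact: measurable_dot.
  have E c' (K : 'cV[R]_d -> R) : bfin (w + 1) K c' -> partial j (hartley K) x = \int[mu]_xi (K xi * m xi).
    move=> Kc; rewrite (partial_hartley j w1 Kc) (hartley_dhartley j x w0 Kc).
    by apply: eq_Rintegral => xi _; rewrite /m; ring.
  have := Hcv _ mm; rewrite -(E _ _ HC).
  under eq_cvg do under eq_bigr do rewrite -(E _ _ (Hc _)) -WE; apply => xi.
  rewrite /m normrM mulrC ler_pM// ?cas_le2// (le_trans (coord_le_wt1 _ _))//.
  by rewrite le_wt// lerDr.
- move=> j x; pose m (xi : 'cV[R]_d) := - xi j 0 ^+ 2 * cas (dot x xi).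
  have mm : measurable_fun [set: 'cV[R]_d] m.
    apply: measurable_funM; last exact: measurable_cas_dot.
    by apply: measurable_funN; apply: measurable_funX; exact: measurable_coord.
  have E c' (K : 'cV[R]_d -> R) : bfin (w + 1) K c' -> partials [:: j; j] (hartley K) x = \int[mu]_xi (K xi * m xi).
    move=> Kc; rewrite (partials2_hartley j w2 Kc).
    by apply: eq_Rintegral => xi _; rewrite /m; ring.
  have := Hcv _ mm; rewrite -(E _ _ HC).
  under eq_cvg do under eq_bigr do rewrite -(E _ _ (Hc _)) -WE; apply => xi.
  rewrite /m normrM normrN mulrC ler_pM// ?cas_le2// normrX expr2.
  apply: (@le_trans _ _ (wt 1 xi * wt 1 xi)); first by rewrite ler_pM// coord_le_wt1.
  by rewrite -wtD le_wt// lerD2r.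
Qed.

End barron_algebra.

(** * Picard iteration and the HJB equation *)

Section picard.
Context {R : realType} {d : nat}.
Variables (s : R) (hs : 2 <= s).
(** Coefficients are given by components; [h] will be the matrix g Q^-1 g^T of the quadratic
    term. *)
Variables (f : 'I_d -> 'cV[R]_d -> R) (h : 'I_d -> 'I_d -> 'cV[R]_d -> R) (ell : 'cV[R]_d -> R).
Variables (cf : 'I_d -> R) (ch : 'I_d -> 'I_d -> R) (cl : R).
Hypothesis bf : forall j, bn s (cf j) (f j).
Hypothesis bh : forall j k, bn s (ch j k) (h j k).
Hypothesis bl : bn s cl ell.
Variables (kappa gamma : R).
Hypothesis k0 : 0 < kappa.
Hypothesis kg : kappa^-1 + kappa ^- 2 / 4 <= gamma.
Let cF := \sum_j cf j.
Let cH := \sum_j \sum_k ch j k.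
(** The smallness conditions: [kl] bounds the first increment by 1/2, and [kc] makes every later
    increment at most half of its predecessor as long as the iterates stay in the unit ball. *)
Hypothesis kl : kappa * cl <= 2^-1.
Hypothesis kc : kappa * (2 * cF + 2 * cH) <= 2^-1.
Implicit Types V W : 'cV[R]_d -> R.

Let s0 : 0 <= s. Proof. by rewrite (le_trans _ hs). Qed.
Let s1 : 1 <= s. Proof. by rewrite (le_trans _ hs)// ler1n. Qed.
Let s10 : 0 <= s + 1. Proof. by rewrite addr_ge0. Qed.

Definition drift W x := \sum_j f j x * partial j W x.
Definition quad V W x := \sum_j \sum_k h j k x * (partial j V x * partial k W x).
Definition picard_rhs V x := ell x + drift V x - 4^-1 * quad V V x.

Lemma bn_drift w W : bn (s + 1) w W -> bn s (2 * cF * w) (drift W).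
Proof.
move=> bW; have -> : 2 * cF * w = \sum_j 2 * (cf j * w).
  by rewrite /cF -mulrA mulr_suml mulr_sumr.
apply: bn_sum => // j; apply: bn_mul => //; by have [] := bn_partial j s1 bW.
Qed.

(** The 4 comes from two nested products, each costing a factor 2. It cancels the 1/4 in front of
    the quadratic term. *)
Lemma bn_quad v w V W : bn (s + 1) v V -> bn (s + 1) w W -> bn s (4 * cH * (v * w)) (quad V W).
Proof.
move=> bV bW; have -> : 4 * cH * (v * w) = \sum_j \sum_k 2 * (ch j k * (2 * (v * w))).
  rewrite /cH -mulrA mulr_suml mulr_sumr; apply: eq_bigr => j _.
  by rewrite mulr_suml mulr_sumr; apply: eq_bigr => k _; ring.
apply: bn_sum => // j; apply: bn_sum => // k; apply: bn_mul => //; apply: bn_mul => //.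
  by have [] := bn_partial j s1 bV.
by have [] := bn_partial k s1 bW.
Qed.

Lemma partialD v w V W j : bn (s + 1) v V -> bn (s + 1) w W ->
  partial j (fun x => V x + W x) = (fun x => partial j V x + partial j W x).
Proof.
move=> bV bW; apply/funext => x.
have [_ dV] := bn_partial j s1 bV; have [_ dW] := bn_partial j s1 bW.
exact: deriveD.
Qed.

Lemma partials2D v w V W j : bn (s + 1) v V -> bn (s + 1) w W ->
  partials [:: j; j] (fun x => V x + W x) = (fun x => partials [:: j; j] V x + partials [:: j; j] W x).
Proof.
move=> bV bW; rewrite /partials /= (partialD j bV bW); apply/funext => x.
have s11 : 1 <= s - 1 by rewrite lerBrDr.
have E : s - 1 + 1 = s by rewrite subrK.
have [bV' _] := bn_partial j s1 bV; have [bW' _] := bn_partial j s1 bW.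
rewrite -E in bV' bW'.
have [_ dV] := bn_partial j s11 bV'; have [_ dW] := bn_partial j s11 bW'.
exact: deriveD.
Qed.

Lemma laplacianD v w V W x : bn (s + 1) v V -> bn (s + 1) w W ->
  laplacian (fun x => V x + W x) x = laplacian V x + laplacian W x.
Proof.
move=> bV bW; rewrite /laplacian -big_split; apply: eq_bigr => j _.
by rewrite (partials2D j bV bW).
Qed.

(** With B the bilinear form [quad], B(V + W, V + W) - B(V, V) = B(W, V + W) + B(V, W): each term
    has the increment in one slot and an iterate in the other. *)
Lemma picard_rhsD v w V W x : bn (s + 1) v V -> bn (s + 1) w W ->
  picard_rhs (fun y => V y + W y) x = picard_rhs V x +
   (drift W x + (- 4^-1) * (quad W (fun y => V y + W y) x + quad V W x)).
Proof.
move=> bV bW; rewrite /picard_rhs.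
have -> : drift (fun y => V y + W y) x = drift V x + drift W x.
  by rewrite /drift -big_split; apply: eq_bigr => j _; rewrite (partialD j bV bW) mulrDr.
have E : quad (fun y => V y + W y) (fun y => V y + W y) x = quad V V x +
    (quad W (fun y => V y + W y) x + quad V W x).
  rewrite /quad -!big_split; apply: eq_bigr => j _; rewrite -!big_split; apply: eq_bigr => k _.
  rewrite !(partialD _ bV bW) /=.
  by move: (h j k x) (partial j V x) (partial k V x) (partial j W x) (partial k W x) => ? ? ? ? ?; ring.
by rewrite E; ring.
Qed.

(* V is the n-th iterate and W the next increment.  The increments carry their
   own densities, so that densities of iterates need not be compared. *)
Let inv (n : nat) V W := [/\ bn (s + 1) (1 - 2^-1 ^+ n) V, bn (s + 1) (2^-1 ^+ n.+1) W &
  forall x, gamma * (V x + W x) - laplacian (fun y => V y + W y) x = picard_rhs V x].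

Let half_le1 n : 0 <= (2^-1 : R) ^+ n <= 1.
Proof. by rewrite exprn_ge0 ?invr_ge0//= exprn_ile1// ?invr_ge0// invf_le1// ler1n. Qed.

(** The next increment is the resolvent applied to the difference of the right-hand sides at V + W
    and V, so adding the two equations gives the equation of the next stage. *)
Let step n V W : inv n V W -> exists W', inv n.+1 (fun x => V x + W x) W'.
Proof.
move=> [bV bW E].
have bVW : bn (s + 1) (1 - 2^-1 ^+ n.+1) (fun x => V x + W x).
  apply: bn_le (bn_add s10 bV bW) => //; rewrite exprS; set q := _ ^+ n; lra.
have := bn_add s0 (bn_drift bW) (bn_scale (- 4^-1) s0 (bn_add s0 (bn_quad bW bVW) (bn_quad bV bW))).
set c' := (X in bn s X _) => bN.
have [W' [bW' EW']] := bn_resolvent hs k0 kg bN.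
exists W'; split=> //.
  apply: bn_le bW' => //.
  have /andP[q0 q1] := half_le1 n; have /andP[p0 p1] := half_le1 n.+1.
  have cH0 : 0 <= cH.
    by rewrite sumr_ge0// => j _; rewrite sumr_ge0// => k _; exact: bn_ge0 (bh j k).
  (* Both iterates lie in the unit ball, so the two quadratic terms together cost at most 2 cH times
     the increment. *)
  have c'E : c' <= (2 * cF + 2 * cH) * 2^-1 ^+ n.+1.
    rewrite /c' normrN ger0_norm ?invr_ge0//.
    have -> : 2 * cF * 2^-1 ^+ n.+1 + 4^-1 * (4 * cH * (2^-1 ^+ n.+1 * (1 - 2^-1 ^+ n.+1)) +
       4 * cH * ((1 - 2^-1 ^+ n) * 2^-1 ^+ n.+1)) = (2 * cF + cH * (2 - 2^-1 ^+ n.+1 - 2^-1 ^+ n)) * 2^-1 ^+ n.+1.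
      by field.
    rewrite ler_wpM2r// lerD2l mulrC ler_wpM2r//; lra.
  apply: (@le_trans _ _ (kappa * ((2 * cF + 2 * cH) * 2^-1 ^+ n.+1))).
    by rewrite ler_wpM2l// ltW.
  by rewrite mulrA [leRHS]exprS ler_wpM2r.
move=> x; rewrite (laplacianD x bVW bW') (picard_rhsD x bV bW) -(EW' x) -E.
by rewrite mulrDr opprD addrACA.
Qed.

Let cvg_bigsum (I : Type) (r : seq I) (u : I -> nat -> R) (l : I -> R) :
  (forall i, u i n @[n --> \oo] --> l i) ->
  \sum_(i <- r) u i n @[n --> \oo] --> \sum_(i <- r) l i.
Proof.
move=> ul; elim: r => [|i r IH].
  by rewrite big_nil; under eq_cvg do rewrite big_nil; exact: cvg_cst.
by rewrite big_cons; under eq_cvg do rewrite big_cons; exact: cvgD.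
Qed.

Lemma picard_solution : exists V, bn (s + 1) 1 V /\
  forall x, gamma * V x - laplacian V x = picard_rhs V x.
Proof.
(* A step only asserts that an increment exists. Packing index, iterate and increment with the
   invariant lets choice produce a total map on [T], which can be iterated. *)
pose T := {p : nat * (('cV[R]_d -> R) * ('cV[R]_d -> R)) | inv p.1 p.2.1 p.2.2}.
(* The iteration starts from 0, where the right-hand side is [ell]; the first increment therefore
   solves the linear equation. *)
have [W0 [bW0 EW0]] := bn_resolvent hs k0 kg bl.
have z0 : bn (s + 1) 0 (fun _ : 'cV[R]_d => 0 : R) by exact: bn0.
have p0 j : partial j (fun _ : 'cV[R]_d => 0 : R) = fun=> 0.
  by apply/funext => x; exact: derive_cst.
have inv0 : inv 0 (fun=> 0) W0.
  split.
  - by rewrite expr0 subrr.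
  - by rewrite expr1; apply: bn_le bW0.
  - move=> x; rewrite (_ : (fun y => 0 + W0 y) = W0); last by apply/funext => y; rewrite add0r.
    rewrite add0r EW0 /picard_rhs /drift /quad big1 => [|j _]; last by rewrite p0 mulr0.
    rewrite big1 => [|j _]; first by rewrite mulr0 subr0 addr0.
    by rewrite big1// => k _; rewrite !p0 !mulr0.
have nxt (p : T) : exists q : T, (projT1 q).1 = (projT1 p).1.+1 /\
    (projT1 q).2.1 = fun x => (projT1 p).2.1 x + (projT1 p).2.2 x.
  case: p => -[n [V W]] /= iVW; have [W' iW'] := step iVW.
  by exists (exist _ (n.+1, (fun x => V x + W x, W')) iW').
have /choice[F FE] := nxt.
pose st n : T := iter n F (exist _ (0%N, (fun=> 0, W0)) inv0).
pose Vn n := (projT1 (st n)).2.1; pose Wn n := (projT1 (st n)).2.2.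
have idx n : (projT1 (st n)).1 = n by elim: n => //= n IH; have [-> _] := FE (st n); rewrite IH.
have invn n : inv n (Vn n) (Wn n) by have := projT2 (st n); rewrite /= idx.
have VS n : Vn n.+1 = fun x => Vn n x + Wn n x by rewrite /Vn /=; have [_ ->] := FE (st n).
have V0 : Vn 0 = fun=> 0 by [].
have bWn k : bn (s + 1) (2^-1 ^+ k.+1) (Wn k) by have [] := invn k.
have bVn k : bn (s + 1) (1 - 2^-1 ^+ k) (Vn k) by have [] := invn k.
(* The increments are bounded by 1/2, 1/4, ..., so the limit stays in the closed unit ball. *)
have sumc n : \sum_(0 <= k < n) (2^-1 ^+ k.+1 : R) <= 1.
  have -> : \sum_(0 <= k < n) (2^-1 ^+ k.+1 : R) = 1 - 2^-1 ^+ n.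
    elim: n => [|n IH]; first by rewrite big_geq// expr0 subrr.
    by rewrite big_nat_recr//= IH exprS; field.
  by have /andP[q _] := half_le1 n; rewrite gerBl.
have [V [bV cV cP cP2]] := bn_series hs bWn sumc.
have VnE n x : Vn n x = \sum_(0 <= k < n) Wn k x.
  by elim: n => [|n IH]; [rewrite V0 big_geq|rewrite VS big_nat_recr//= IH].
have PnE j n x : partial j (Vn n) x = \sum_(0 <= k < n) partial j (Wn k) x.
  elim: n => [|n IH]; first by rewrite V0 big_geq// p0.
  by rewrite VS (partialD j (bVn n) (bWn n)) big_nat_recr//= IH.
have P2nE j n x : partials [:: j; j] (Vn n) x = \sum_(0 <= k < n) partials [:: j; j] (Wn k) x.
  elim: n => [|n IH]; first by rewrite V0 big_geq// /partials /= !p0.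
  by rewrite VS (partials2D j (bVn n) (bWn n)) big_nat_recr// IH.
exists V; split=> // x.
have c1 : Vn n x @[n --> \oo] --> V x by under eq_cvg do rewrite VnE; exact: cV.
have c2 j : partial j (Vn n) x @[n --> \oo] --> partial j V x by under eq_cvg do rewrite PnE; exact: cP.
have c3 : laplacian (Vn n) x @[n --> \oo] --> laplacian V x.
  by apply: cvg_bigsum => j; under eq_cvg do rewrite P2nE; exact: cP2.
(* The equation couples iterate n + 1 on the left with iterate n on the right, so the left-hand
   limit is taken along the shifted sequence. *)
have L : gamma * Vn n.+1 x - laplacian (Vn n.+1) x @[n --> \oo] --> gamma * V x - laplacian V x.
  apply: cvgB; last by rewrite (cvg_shiftS (fun n => laplacian (Vn n) x)).
  by apply: cvgM; [exact: cvg_cst|rewrite (cvg_shiftS (fun n => Vn n x))].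
have Rr : picard_rhs (Vn n) x @[n --> \oo] --> picard_rhs V x.
  apply: cvgB.
    by apply: cvgD; [exact: cvg_cst|apply: cvg_bigsum => j; apply: cvgM; [exact: cvg_cst|exact: c2]].
  apply: cvgM; first exact: cvg_cst.
  apply: cvg_bigsum => j; apply: cvg_bigsum => k; apply: cvgM; first exact: cvg_cst.
  by apply: cvgM; exact: c2.
have E n : gamma * Vn n.+1 x - laplacian (Vn n.+1) x = picard_rhs (Vn n) x.
  by rewrite VS; have [_ _ ->] := invn n.
have ER : (fun n => gamma * Vn n.+1 x - laplacian (Vn n.+1) x) = (fun n => picard_rhs (Vn n) x).
  by apply/funext => n; exact: E.
by rewrite ER in L; exact: (cvg_unique _ L Rr).
Qed.

End picard.

(** * Minimisation of a linear plus quadratic function of the control *)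

Section linear_quadratic.
Context {R : realType} {m : nat} (Q : 'M[R]_m) (hQ : posdef Q).

(** If the determinant vanished, a nonzero vector in the kernel would have quadratic form 0. *)
Lemma posdef_unitmx : Q \in unitmx.
Proof.
have [_ pos] := hQ; apply/negPn/negP; rewrite unitmxE unitfE negbK => /det0P[v v0 vQ].
have v0' : v^T != 0 by apply: contra_neq v0 => /(congr1 trmx); rewrite trmxK trmx0.
by have := pos _ v0'; rewrite trmxK vQ mul0mx mxE ltxx.
Qed.

(** The point [u] is critical: Q u = - w / 2, so the two cross terms of the square restore the
    linear term. *)
Lemma complete_square (w v : 'cV[R]_m) (u := - 2^-1 *: (invmx Q *m w)) :
  dot v w + (v^T *m Q *m v) 0 0 =
  - 4^-1 * (w^T *m invmx Q *m w) 0 0 + ((v - u)^T *m Q *m (v - u)) 0 0.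
Proof.
have [Qs _] := hQ; have uQ := posdef_unitmx.
have Ps : (invmx Q)^T = invmx Q by rewrite trmx_inv Qs.
have dE (a b : 'cV[R]_m) : dot a b = (a^T *m b) 0 0.
  by rewrite mxE; apply: eq_bigr => i _; rewrite mxE.
have Qu : Q *m u = - 2^-1 *: w by rewrite /u -scalemxAr mulKVmx.
have uQ' : u^T *m Q = - 2^-1 *: w^T by rewrite -[u^T *m Q]trmxK trmx_mul trmxK Qs Qu linearZ.
have Bvu : (v^T *m Q *m u) 0 0 = - 2^-1 * dot v w by rewrite -mulmxA Qu -scalemxAr mxE dE.
have Buv : (u^T *m Q *m v) 0 0 = - 2^-1 * dot v w by rewrite uQ' -scalemxAl mxE dotC dE.
have Buu : (u^T *m Q *m u) 0 0 = 4^-1 * (w^T *m invmx Q *m w) 0 0.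
  rewrite uQ' -scalemxAl mxE /u -scalemxAr mxE mulmxA mulrA; congr (_ * _); by field.
have -> : ((v - u)^T *m Q *m (v - u)) 0 0 = (v^T *m Q *m v) 0 0 - (v^T *m Q *m u) 0 0
    - (u^T *m Q *m v) 0 0 + (u^T *m Q *m u) 0 0.
  have D (A B : 'M[R]_1) : (A - B) 0 0 = A 0 0 - B 0 0 by rewrite !mxE.
  have -> : (v - u)^T = v^T - u^T by apply/matrixP => i j; rewrite !mxE.
  by rewrite !mulmxBl !mulmxBr !D opprB addrA addrAC.
by rewrite Bvu Buv Buu; field.
Qed.

(** The equality case is kept with the bound because an optimal control must be the only
    minimiser. *)
Lemma complete_square_min (w v : 'cV[R]_m) (u := - 2^-1 *: (invmx Q *m w)) :
  - 4^-1 * (w^T *m invmx Q *m w) 0 0 <= dot v w + (v^T *m Q *m v) 0 0 ?= iff (v == u).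
Proof.
have [_ pos] := hQ; rewrite complete_square -/u; split.
  rewrite lerDl; have [->|vu] := eqVneq v u; first by rewrite subrr mulmx0 mxE.
  by apply/ltW/pos; rewrite subr_eq0.
apply/eqP/eqP => [E|->]; last by rewrite subrr mulmx0 [X in _ + X]mxE addr0.
apply/eqP; rewrite -subr_eq0; apply/negPn/negP => /pos.
by rewrite -(ltrDl (- 4^-1 * (w^T *m invmx Q *m w) 0 0)) -E ltxx.
Qed.

End linear_quadratic.

(** * From the semilinear equation to an optimal solution *)

Section hjb_solution.
Context {R : realType} {d m : nat}.
Variables (s : R) (Q : 'M[R]_m) (f : 'cV[R]_d -> 'cV[R]_d) (g : 'cV[R]_d -> 'M[R]_(d, m)).
Variables (ell : 'cV[R]_d -> R).
Hypotheses (hs : 2 <= s) (hQ : posdef Q).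
Hypothesis bf : forall j, exists c, bn s c (fun x => f x j 0).
Hypothesis bg : forall j k, exists c, bn s c (fun x => g x j k).
Hypothesis bl : exists c, bn s c ell.

Definition feedback V x : 'cV[R]_m := - 2^-1 *: (invmx Q *m ((g x)^T *m grad V x)).

(** At fixed x the Hamiltonian is a constant plus the expression of [complete_square_min] with w =
    g^T grad V. The semilinear equation says exactly that its least value is gamma V(x). *)
Lemma feedback_optimal gamma (V : 'cV[R]_d -> R) : Ck 2 V ->
  (forall x, gamma * V x - laplacian V x =
    ell x + dot (f x) (grad V x) - 4^-1 * ((grad V x)^T *m (g x *m invmx Q *m (g x)^T) *m grad V x) 0 0) ->
  optimal_solution f g ell Q gamma (feedback V) V.
Proof.
move=> cV E.
have H x v : hamiltonian f g ell Q V x v = dot (f x) (grad V x) + laplacian V x + ell x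
    + (dot v ((g x)^T *m grad V x) + (v^T *m Q *m v) 0 0).
  have -> : dot v ((g x)^T *m grad V x) = dot (g x *m v) (grad V x).
    have dE n (a b : 'cV[R]_n) : dot a b = (a^T *m b) 0 0.
      by rewrite mxE; apply: eq_bigr => i _; rewrite mxE.
    by rewrite !dE trmx_mul mulmxA.
  by rewrite /hamiltonian dotDl; ring.
have M x v := complete_square_min hQ ((g x)^T *m grad V x) v.
have Hu x : hamiltonian f g ell Q V x (feedback V x) = gamma * V x.
  have [_ /esym] := M x (feedback V x); rewrite eqxx => /esym/eqP Mu.
  rewrite H -Mu; have := E x.
  by rewrite trmx_mul trmxK !mulmxA => E'; rewrite mulNr; lra.
have Hle x v : hamiltonian f g ell Q V x (feedback V x) <= hamiltonian f g ell Q V x v ?= iff (v == feedback V x).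
  rewrite !H; have [_ /esym] := M x (feedback V x); rewrite eqxx => /esym/eqP <-.
  have [le eq] := M x v; split; first by rewrite lerD2l.
  by rewrite (inj_eq (addrI _)) eq.
split=> // [x|x].
- exists (gamma * V x); rewrite mulNr addNr; split=> //; split.
    by exists (feedback V x).
  by move=> _ [v _ <-]; rewrite -Hu; have [] := Hle x v.
- apply/seteqP; split => [v /= Hv|v /= -> w]; last by have [] := Hle x w.
  by apply/eqP; have [le <-] := Hle x v; rewrite eq_le le /=; exact: Hv.
Qed.

Let s0 : 0 <= s. Proof. by rewrite (le_trans _ hs). Qed.
Let s1 : 1 <= s. Proof. by rewrite (le_trans _ hs)// ler1n. Qed.

Lemma bn_solution : exists C : R, 0 < C /\ forall gamma, C <= gamma ->
  exists (u : 'cV[R]_d -> 'cV[R]_m) (V : 'cV[R]_d -> R),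
  [/\ forall j, exists c, bn s c (fun x => u x j 0), exists c, bn (s + 1) c V &
    optimal_solution f g ell Q gamma u V].
Proof.
have /choice[cf cfE] := bf; have [cl clE] := bl.
pose P := invmx Q.
(* The entries of g Q^-1 g^T are linear combinations of products of entries of g, hence remain in
   the algebra. *)
have bh j k : exists c, bn s c (fun x => (g x *m P *m (g x)^T) j k).
  have /choice[c1 c1E] := bg j; have /choice[c2 c2E] := bg k.
  exists (\sum_b 2 * ((\sum_a `|P a b| * c1 a) * c2 b)).
  rewrite (_ : (fun x => _) = fun x => \sum_b (\sum_a P a b * g x j a) * g x k b).
    apply: bn_sum => // b; apply: bn_mul => //; apply: bn_sum => // a; exact: bn_scale.
  apply/funext => x; rewrite mxE; apply: eq_bigr => b _; rewrite !mxE; congr (_ * _).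
  by apply: eq_bigr => a _; rewrite mulrC.
have /choice[ch0 ch0E] : forall j, exists c : 'I_d -> R, forall k, bn s (c k) (fun x => (g x *m P *m (g x)^T) j k).
  by move=> j; have /choice[c cE] := bh j; exists c.
pose cF := \sum_j cf j; pose cH := \sum_j \sum_k ch0 j k.
have cF0 : 0 <= cF by rewrite sumr_ge0// => j _; exact: bn_ge0 (cfE j).
have cH0 : 0 <= cH by rewrite sumr_ge0// => j _; rewrite sumr_ge0// => k _; exact: bn_ge0 (ch0E j k).
have cl0 : 0 <= cl by exact: bn_ge0 clE.
(* kappa = 1 / D. The leading factor 2 yields the bounds 1/2 in both smallness conditions, and the 1
   makes D positive. *)
pose D := 2 * (cl + 2 * cF + 2 * cH) + 1.
have D0 : 0 < D by rewrite /D; lra.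
(* The threshold D + D^2 / 4 is the condition of the resolvent estimate at kappa = 1 / D; it is
   fixed before gamma. *)
exists (D^-1^-1 + D^-1 ^- 2 / 4); split.
  by rewrite invrK ltr_pwDl// divr_ge0// invr_ge0 exprn_ge0// invr_ge0 ltW.
move=> gamma gC.
have kl : D^-1 * cl <= 2^-1 by rewrite ler_pdivrMl// /D; lra.
have kc : D^-1 * (2 * cF + 2 * cH) <= 2^-1 by rewrite ler_pdivrMl// /D; lra.
have Di0 : 0 < D^-1 by rewrite invr_gt0.
have [V [bV EV]] := picard_solution hs cfE ch0E clE Di0 gC kl kc.
exists (feedback V), V; split; [|by exists 1|].
- move=> j.
  have /choice[c cE] : forall k, exists c, bn s c (fun x => \sum_a P j a * g x k a).
    move=> k; have /choice[c1 c1E] := bg k; exists (\sum_a `|P j a| * c1 a).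
    by apply: bn_sum => // a; exact: bn_scale.
  exists (`|- 2^-1| * \sum_k 2 * (c k * 1)).
  rewrite (_ : (fun x => _) = fun x => - 2^-1 * \sum_k (\sum_a P j a * g x k a) * partial k V x).
    apply: bn_scale => //; apply: bn_sum => // k; apply: bn_mul => //.
    by have [] := bn_partial k s1 bV.
  apply/funext => x; rewrite /feedback mxE; congr (_ * _).
  rewrite mulmxA mxE; apply: eq_bigr => k _; rewrite !mxE; congr (_ * _).
  by apply: eq_bigr => a _; rewrite mxE.
- apply: feedback_optimal => [|x].
    by apply: bn_Ck bV; rewrite lerD2r.
  rewrite EV /picard_rhs; congr (_ + _ - _ * _).
    by apply: eq_bigr => j _; rewrite [grad _ _ _ _]mxE.
  rewrite /quad mxE exchange_big; apply: eq_bigr => k _; rewrite mxE mulr_suml.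
  by apply: eq_bigr => j _; rewrite ![grad _ _ _ _]mxE [(_^T) _ _]mxE [grad _ _ _ _]mxE; ring.
Qed.

End hjb_solution.

(** * Inversion of the Hartley transform *)

Section dominated.
Context d (T : measurableType d) (R : realType) (mu : {measure set T -> \bar R}).

Lemma Rintegral_dominated_cvg (f_ : nat -> T -> R) (f g : T -> R) :
  (forall n, measurable_fun setT (f_ n)) -> measurable_fun setT f ->
  (forall x, f_ n x @[n --> \oo] --> f x) -> mu.-integrable setT (EFin \o g) ->
  (forall n x, `|f_ n x| <= g x) ->
  (fun n => \int[mu]_x f_ n x) @ \oo --> \int[mu]_x f x.
Proof.
move=> mf_ mf cf ig fg.
have [|||||iff _ cI] := @dominated_convergence _ _ _ mu setT measurableT (fun n x => (f_ n x)%:E)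
  (fun x => (f x)%:E) (EFin \o g).
- by move=> n; exact/measurable_EFinP.
- exact/measurable_EFinP.
- by apply: aeW => x _; apply/fine_cvgP; split; [exact: nearW|exact: cf].
- exact: ig.
- by apply: aeW => x n _; rewrite lee_fin.
have E : (\int[mu]_x (f x)%:E)%E = (\int[mu]_x f x)%:E.
  by rewrite /Rintegral fineK//; exact: integrable_fin_num.
by rewrite /= E in cI; move/fine_cvg : cI.
Qed.

End dominated.

Section hartley_inversion.
Context {R : realType} {d : nat}.
Local Notation mu := (lebesgue_cV R d).
Implicit Types (x y z xi : 'cV[R]_d) (H phi : 'cV[R]_d -> R).

Let measurable_cas_dot2 : measurable_fun [set: 'cV[R]_d * 'cV[R]_d] (fun p : 'cV[R]_d * 'cV[R]_d => cas (dot p.1 p.2)).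
Proof.
apply: measurableT_comp; first exact: measurable_cas.
by apply: measurable_dot; [exact: measurable_fst|exact: measurable_snd].
Qed.

Let measurable_laplace_cV (e : R) : measurable_fun [set: 'cV[R]_d] (laplace_cV e).
Proof.
apply: measurable_prod => i _.
apply: (@measurableT_comp _ _ _ _ _ _ (laplace e) _ (fun x : 'cV[R]_d => x i 0)); last exact: measurable_coord.
exact: continuous_measurable_fun (continuous_laplace (e := e)).
Qed.

Lemma laplace_cV_le1 (e : R) x : 0 <= e -> 0 <= laplace_cV e x <= 1.
Proof.
move=> e0; rewrite prodr_ge0 => [|i _]; last exact: laplace_ge0.
by apply: prodr_ile1 => i _; rewrite laplace_ge0 /laplace -expR0 ler_expR oppr_le0 mulr_ge0.
Qed.

Lemma integrable_laplace_cV (e : R) : 0 < e -> mu.-integrable setT (EFin \o laplace_cV e).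
Proof.
move=> e0; have [+ _ _ _] := Rintegral_laplace_cV (0 : 'cV[R]_d) e0.
apply: eq_integrable => // x _ /=; congr EFin.
by rewrite (_ : dot x 0 = 0) ?cos0 ?mulr1// /dot big1// => i _; rewrite mxE mulr0.
Qed.

(** cas a cas b = cos(a - b) + sin(a + b). The sine integrates to 0 against the even damping factor,
    and the cosine gives the Poisson kernel at xi - y. *)
Lemma Rintegral_laplace_cas_cas (e : R) xi y : 0 < e ->
  \int[mu]_x (laplace_cV e x * cas (dot x xi) * cas (dot x y)) =
  \prod_i (2 * e / (e ^+ 2 + (xi - y) i 0 ^+ 2)).
Proof.
move=> e0; have [i1 _ E1 _] := Rintegral_laplace_cV (xi - y) e0.
have [_ i2 _ E2] := Rintegral_laplace_cV (xi + y) e0.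
rewrite -[RHS]addr0 -{1}E2 -E1 -RintegralD//; apply: eq_Rintegral => x _.
by rewrite !dotDr dotNr /cas cosB sinD; ring.
Qed.

(** Unnormalised: its mass (2 pi)^d is the constant of the inversion formula. *)
Definition poisson z : R := \prod_i (2 / (1 + z i 0 ^+ 2)).

Lemma poisson_ge0 z : 0 <= poisson z.
Proof. by apply: prodr_ge0 => i _; rewrite divr_ge0// addr_ge0// sqr_ge0. Qed.

Lemma Rintegral_poisson : mu.-integrable setT (EFin \o poisson) /\
  \int[mu]_z poisson z = (2 * pi) ^+ d.
Proof.
have i1 : (@lebesgue_measure R).-integrable setT (EFin \o (fun x : R => 2 / (1 + x ^+ 2))).
  by apply: RintegrableZ; exact: integrable_cauchy.
have [i2 E] := @Rintegral_prod_coord R d (fun _ (r : R) => 2 / (1 + r ^+ 2)) (fun _ => i1).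
split=> //; rewrite E prodr_const card_ord; congr (_ ^+ _).
rewrite RintegralZl//; last exact: integrable_cauchy.
by rewrite /Rintegral integral_cauchy.
Qed.

Definition poisson_scaled (e : R) z : R := \prod_i (2 * e / (e ^+ 2 + z i 0 ^+ 2)).

Lemma poisson_scaled_ge0 (e : R) z : 0 <= e -> 0 <= poisson_scaled e z.
Proof.
move=> e0; apply: prodr_ge0 => i _.
by rewrite divr_ge0 ?mulr_ge0// addr_ge0// sqr_ge0.
Qed.

Lemma poisson_scaled_le (e : R) z : 0 < e -> poisson_scaled e z <= (2 / e) ^+ d.
Proof.
move=> e0; have -> : (2 / e) ^+ d = \prod_(i < d) (2 / e) by rewrite prodr_const card_ord.
apply: ler_prod => i _.
have den0 : 0 < e ^+ 2 + z i 0 ^+ 2 by rewrite ltr_pwDl ?exprn_gt0// sqr_ge0.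
apply/andP; split; first by rewrite divr_ge0 ?mulr_ge0// ltW.
rewrite ler_pdivrMr// mulrDr (_ : 2 / e * e ^+ 2 = 2 * e); last by field; rewrite gt_eqF.
by rewrite lerDl mulr_ge0 ?sqr_ge0// divr_ge0// ltW.
Qed.

Lemma measurable_poisson_scaled (e : R) : 0 < e -> measurable_fun [set: 'cV[R]_d] (poisson_scaled e).
Proof.
move=> e0; apply: measurable_prod => i _; apply: measurable_funM; first exact: measurable_cst.
have -> : (fun z : 'cV[R]_d => (e ^+ 2 + z i 0 ^+ 2)^-1) =
    (fun r : R => r `^ (-1)) \o (fun z : 'cV[R]_d => e ^+ 2 + z i 0 ^+ 2).
  by apply/funext => z; rewrite [RHS]powR_inv1// addr_ge0// sqr_ge0.
apply: measurableT_comp; first exact: measurable_powR.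
apply: measurable_funD; first exact: measurable_cst.
by apply: measurable_funX; exact: measurable_coord.
Qed.

(** Rescaling removes e from the kernel and leaves it only in the argument of phi, so that one
    integrable majorant serves for all e. *)
Lemma poisson_scaledE (e : R) z : 0 < e -> e ^+ d * poisson_scaled e (e *: z) = poisson z.
Proof.
move=> e0; have -> : e ^+ d = \prod_(i < d) e by rewrite prodr_const card_ord.
rewrite -big_split; apply: eq_bigr => i _ /=; rewrite mxE exprMn.
have d1 : 1 + z i 0 ^+ 2 != 0 by rewrite gt_eqF// ltr_pwDl// sqr_ge0.
have -> : e ^+ 2 + e ^+ 2 * z i 0 ^+ 2 = e ^+ 2 * (1 + z i 0 ^+ 2) by ring.
by field; rewrite d1 gt_eqF.
Qed.

(** Damping makes the double integral over x and y absolutely convergent. After Fubini the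
    x-integral is a Poisson kernel, and y = xi - e z turns the rest into an average of phi at scale
    e around xi. *)
Lemma Rintegral_poisson_scaled (e : R) (phi : 'cV[R]_d -> R) xi : 0 < e ->
  mu.-integrable setT (EFin \o phi) ->
  \int[mu]_x (laplace_cV e x * cas (dot x xi) * hartley phi x) =
  \int[mu]_z (poisson z * phi (xi + e *: (- z))).
Proof.
move=> e0 iphi; have il := integrable_laplace_cV e0.
have ilc : mu.-integrable setT (EFin \o (fun x => laplace_cV e x * cas (dot x xi))).
  apply: (Rintegrable_bounded (C := 2) il); last by move=> x; exact: cas_le2.
  by apply: measurableT_comp; [exact: measurable_cas|apply: measurable_dot; [exact: measurable_id|exact: measurable_cst]].
have [_ E] := Rintegral_kernel_swap ilc iphi measurable_cas_dot2 (fun p => cas_le2 _).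
rewrite /hartley [LHS]E {E ilc il}.
pose G y := phi y * poisson_scaled e (xi - y).
transitivity (\int[mu]_y G y).
  by apply: eq_Rintegral => y _; rewrite Rintegral_laplace_cas_cas.
have iG : mu.-integrable setT (EFin \o G).
  apply: (Rintegrable_bounded (C := (2 / e) ^+ d) iphi).
    apply: measurableT_comp; first exact: measurable_poisson_scaled.
    apply: measurable_cV_add; first exact: measurable_cst.
    by apply: measurable_cV_opp; exact: measurable_id.
  move=> y; rewrite ger0_norm; first exact: poisson_scaled_le.
  exact: poisson_scaled_ge0 (ltW e0).
have N0 : - e != 0 by rewrite oppr_eq0 gt_eqF.
have [iGe ->] := Rintegral_affine_cV xi N0 iG.
rewrite -(RintegralZl _ measurableT iGe); apply: eq_Rintegral => z _.
rewrite normrN (gtr0_norm e0) /G.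
have -> : - e *: z + xi = xi + e *: (- z) by rewrite scalerN scaleNr addrC.
have -> : xi - (xi + e *: - z) = e *: z by rewrite opprD addrA subrr add0r scalerN opprK.
by rewrite mulrCA (poisson_scaledE z e0) mulrC.
Qed.

Lemma laplace_cV_cvg x : laplace_cV n.+1%:R^-1 x @[n --> \oo] --> (1 : R).
Proof.
have E (e : R) : laplace_cV e x = expR (- (e * \sum_i `|x i 0|)).
  rewrite mulr_sumr -sumrN (big_morph expR (@expRD R) (@expR0 R)).
  by [].
set S := \sum_i _ in E.
have L : expR (- (n.+1%:R^-1 * S)) @[n --> \oo] --> expR (- (0 * S)).
  apply: continuous_cvg; first exact: continuous_expR.
  by apply: cvgN; apply: cvgM; [exact: cvg_harmonic|exact: cvg_cst].
rewrite mul0r oppr0 expR0 in L.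
by rewrite (_ : (fun n => _) = (fun n => expR (- (n.+1%:R^-1 * S)))); last by apply/funext => n; exact: E.
Qed.

Variables (H phi : 'cV[R]_d -> R) (B : R).
Hypothesis iH : mu.-integrable setT (EFin \o H).
Hypothesis iphi : mu.-integrable setT (EFin \o phi).
Hypothesis ihphi : mu.-integrable setT (EFin \o hartley phi).
Hypothesis phiB : forall x, `|phi x| <= B.
(** Continuity in the form in which it is met: the Poisson average samples phi at xi - z / (n +
    1). *)
Hypothesis phic : forall x z, phi (x + n.+1%:R^-1 *: z) @[n --> \oo] --> phi x.

Let mphi : measurable_fun setT phi := integrable_measurable iphi.

Let eps (n : nat) : R := n.+1%:R^-1.
Let eps0 n : 0 < eps n. Proof. by rewrite invr_gt0 ltr0n. Qed.

(** The damped inverse transform of [hartley phi] at damping [eps n], written as a Poisson average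
    of phi. *)
Let J (n : nat) xi := \int[mu]_z (poisson z * phi (xi + eps n *: (- z))).

Let scaled_measurable n xi : measurable_fun [set: 'cV[R]_d] (fun z => phi (xi + eps n *: (- z))).
Proof.
apply: measurableT_comp => //.
rewrite (_ : (fun z => _) = fun z => (- eps n) *: z + xi); first exact: measurable_affine_cV.
by apply/funext => z; rewrite scalerN scaleNr addrC.
Qed.

Let ipoisson_phi n xi : mu.-integrable setT (EFin \o (fun z => poisson z * phi (xi + eps n *: (- z)))).
Proof.
have [ip _] := Rintegral_poisson.
by apply: (Rintegrable_bounded (C := B)) => //; exact: scaled_measurable.
Qed.

Let J_cvg xi : J n xi @[n --> \oo] --> (2 * pi) ^+ d * phi xi.
Proof.
have [ip Ep] := Rintegral_poisson.
rewrite -Ep mulrC -RintegralZl//.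
apply: (Rintegral_dominated_cvg (g := fun z => B * poisson z)).
- by move=> n; exact: integrable_measurable (ipoisson_phi n xi).
- by apply: measurable_funM => //; exact: integrable_measurable ip.
- move=> z; rewrite mulrC; apply: cvgM; [exact: cvg_cst|exact: phic].
- exact: RintegrableZ.
- by move=> n z; rewrite normrM mulrC (ger0_norm (poisson_ge0 z)) ler_wpM2r// poisson_ge0.
Qed.

Let J_bound n xi : `|J n xi| <= B * (2 * pi) ^+ d.
Proof.
have [ip Ep] := Rintegral_poisson.
apply: (le_trans (le_normr_Rintegral measurableT (ipoisson_phi n xi))).
rewrite -Ep -RintegralZl//; apply: le_Rintegral => //.
- exact/integrable_norm/ipoisson_phi.
- exact: RintegrableZ.
- by move=> z _; rewrite normrM mulrC (ger0_norm (poisson_ge0 z)) ler_wpM2r// poisson_ge0.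
Qed.

Let iHJ n : mu.-integrable setT (EFin \o (fun xi => H xi * J n xi)).
Proof.
have [ip _] := Rintegral_poisson.
have mk : measurable_fun [set: 'cV[R]_d * 'cV[R]_d] (fun p : 'cV[R]_d * 'cV[R]_d => phi (p.1 + eps n *: (- p.2))).
  apply: measurableT_comp => //; apply: measurable_cV_add; first exact: measurable_fst.
  rewrite (_ : (fun t => _) = (fun z => (- eps n) *: z + 0) \o snd).
    by apply: measurableT_comp; [exact: measurable_affine_cV|exact: measurable_snd].
  by apply/funext => p /=; rewrite addr0 scalerN scaleNr.
by have [] := Rintegral_kernel_swap iH ip mk (fun p => phiB _).
Qed.

Lemma hartley_inversion :
  mu.-integrable setT (EFin \o (fun x => hartley phi x * hartley H x)) /\
  \int[mu]_x (hartley phi x * hartley H x) = (2 * pi) ^+ d * \int[mu]_xi (H xi * phi xi).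
Proof.
have [iPH _] := Rintegral_kernel_swap ihphi iH measurable_cas_dot2 (fun p => cas_le2 _).
split=> //.
have mPH := integrable_measurable iPH.
have L1 : (fun n => \int[mu]_x (laplace_cV (eps n) x * (hartley phi x * hartley H x))) @ \oo -->
    \int[mu]_x (hartley phi x * hartley H x).
  apply: (Rintegral_dominated_cvg (g := fun x => `|hartley phi x * hartley H x|)) => //.
  - by move=> n; exact: measurable_funM.
  - move=> x; rewrite -[X in _ --> X]mul1r; apply: cvgM; last exact: cvg_cst.
    exact: laplace_cV_cvg.
  - exact: integrable_norm.
  - move=> n x; have /andP[l0 l1] := laplace_cV_le1 x (ltW (eps0 n)).
    by rewrite normrM ger0_norm// ler_piMl.
have E n : \int[mu]_x (laplace_cV (eps n) x * (hartley phi x * hartley H x)) = \int[mu]_xi (H xi * J n xi).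
  have ia : mu.-integrable setT (EFin \o (fun x => hartley phi x * laplace_cV (eps n) x)).
    apply: (Rintegrable_bounded (C := 1)) => // x.
    by have /andP[l0 l1] := laplace_cV_le1 x (ltW (eps0 n)); rewrite ger0_norm.
  have [_ E] := Rintegral_kernel_swap ia iH measurable_cas_dot2 (fun p => cas_le2 _).
  transitivity (\int[mu]_x (hartley phi x * laplace_cV (eps n) x * \int[mu]_y (H y * cas (dot x y)))).
    by apply: eq_Rintegral => x _; rewrite /hartley mulrCA mulrA.
  rewrite E; apply: eq_Rintegral => xi _; congr (_ * _).
  rewrite /J -(Rintegral_poisson_scaled _ (eps0 n) iphi).
  by apply: eq_Rintegral => x _; rewrite /=; ring.
have L2 : (fun n => \int[mu]_xi (H xi * J n xi)) @ \oo --> \int[mu]_xi ((2 * pi) ^+ d * (H xi * phi xi)).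
  apply: (Rintegral_dominated_cvg (g := fun xi => B * (2 * pi) ^+ d * `|H xi|)).
  - by move=> n; exact: integrable_measurable (iHJ n).
  - by apply: measurable_funM => //; apply: measurable_funM => //; exact: integrable_measurable iH.
  - by move=> xi; rewrite mulrCA; apply: cvgM; [exact: cvg_cst|exact: J_cvg].
  - by apply: RintegrableZ; exact: integrable_norm.
  - by move=> n xi; rewrite normrM mulrC ler_wpM2r// J_bound.
rewrite -RintegralZl//; last exact: (Rintegrable_bounded (C := B)).
rewrite (_ : (fun n => _) = (fun n => \int[mu]_xi (H xi * J n xi))) in L1; last exact/funext.
exact: (cvg_unique _ L1 L2).
Qed.

End hartley_inversion.

(** * Schwartz functions *)

Section schwartz_functions.
Context {R : realType} {d : nat}.
Local Notation mu := (lebesgue_cV R d).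
Implicit Types (x y xi : 'cV[R]_d) (phi psi : 'cV[R]_d -> R).

Lemma partials_rcons (l : seq 'I_d) i phi : partials l (partial i phi) = partials (rcons l i) phi.
Proof. by rewrite /partials foldr_rcons. Qed.

Lemma schwartz_partial i phi : schwartz_real phi -> schwartz_real (partial i phi).
Proof.
move=> [Cphi Bphi]; split => [k l lk|N l].
  by rewrite partials_rcons; have := Cphi k.+1 (rcons l i); rewrite size_rcons !ltnS => /(_ lk).
by rewrite partials_rcons; exact: Bphi.
Qed.

Lemma schwartz_derivable phi i x : schwartz_real phi -> derivable phi x (delta_mx i 0).
Proof. by move=> [C _]; have [_ D] := C 1%N [::] isT; exact: D. Qed.

Lemma schwartz_continuous phi : schwartz_real phi -> continuous phi.
Proof. by move=> [C _]; have [] := C 0%N [::] isT. Qed.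

Lemma schwartz_sub phi psi : schwartz_real phi -> schwartz_real psi ->
  schwartz_real (fun x => phi x - psi x).
Proof.
move=> Sphi Spsi; have [C1 B1] := Sphi; have [C2 B2] := Spsi.
have E l : partials l (fun x => phi x - psi x) = fun x => partials l phi x - partials l psi x.
  elim: l => //= i l ->; apply/funext => x.
  have [_ D1] := C1 (size l).+1 l (leqnSn _); have [_ D2] := C2 (size l).+1 l (leqnSn _).
  exact: (deriveB (D1 (ltnSn _) i x) (D2 (ltnSn _) i x)).
split=> [k l lk|N l].
  have [c1 D1] := C1 k l lk; have [c2 D2] := C2 k l lk.
  rewrite E; split => [x|lk' i x]; first exact: (continuousB (c1 x) (c2 x)).
  exact: (derivableB (D1 lk' i x) (D2 lk' i x)).
have [M1 H1] := B1 N l; have [M2 H2] := B2 N l; exists (M1 + M2) => x.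
rewrite E; apply: (@le_trans _ _ ((1 + enorm x) ^+ N * (`|partials l phi x| + `|partials l psi x|))).
  by rewrite ler_wpM2l ?ler_normB// exprn_ge0// addr_ge0// enorm_ge0.
by rewrite mulrDr lerD.
Qed.

(** An integrable majorant: its integral factorises, and it stays above (1 + |x|)^(- 2 d), so decay
    of that order implies integrability. *)
Definition cauchy_cV x : R := \prod_i (1 + x i 0 ^+ 2)^-1.

Lemma cauchy_cV_ge0 x : 0 <= cauchy_cV x.
Proof. by apply: prodr_ge0 => i _; rewrite invr_ge0 addr_ge0// sqr_ge0. Qed.

Lemma integrable_cauchy_cV : mu.-integrable setT (EFin \o cauchy_cV).
Proof.
by have [] := @Rintegral_prod_coord R d (fun _ (r : R) => (1 + r ^+ 2)^-1) (fun _ => integrable_cauchy).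
Qed.

Lemma cauchy_cV_inv_le x : \prod_i (1 + x i 0 ^+ 2) <= (1 + enorm x) ^+ (2 * d).
Proof.
rewrite exprM (_ : _ ^+ d = \prod_(i < d) (1 + enorm x) ^+ 2); last by rewrite prodr_const card_ord.
apply: ler_prod => i _; rewrite addr_ge0 ?sqr_ge0//=.
have := coord_le_enorm x i; have := enorm_ge0 x; set r := enorm x => r0 xr.
have H : x i 0 ^+ 2 <= r ^+ 2 by rewrite -[leLHS]ger0_norm ?sqr_ge0// normrX lerXn2r ?nnegrE.
by rewrite sqrrD expr1n; lra.
Qed.

Lemma cauchy_cVK x : \prod_i (1 + x i 0 ^+ 2) * cauchy_cV x = 1.
Proof.
rewrite -big_split big1// => i _; apply: mulfV.
by rewrite gt_eqF// ltr_pwDl// sqr_ge0.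
Qed.

Lemma decay_cauchy (a M : R) x : 0 <= a -> (1 + enorm x) ^+ (2 * d) * a <= M -> a <= M * cauchy_cV x.
Proof.
move=> a0 aM; rewrite -[leLHS]mulr1 -(cauchy_cVK x) mulrA ler_wpM2r ?cauchy_cV_ge0//.
by apply: le_trans aM; rewrite mulrC ler_wpM2r// cauchy_cV_inv_le.
Qed.

Lemma schwartz_cauchy phi : schwartz_real phi -> exists2 M, 0 <= M &
  forall x, (1 + enorm x) * `|phi x| <= M * cauchy_cV x.
Proof.
move=> [_ B]; have [M HM] := B (2 * d).+1 [::].
have M0 : 0 <= M.
  by apply: le_trans (HM 0); rewrite mulr_ge0// exprn_ge0// addr_ge0// enorm_ge0.
exists M => // x; apply: decay_cauchy; first by rewrite mulr_ge0// addr_ge0// enorm_ge0.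
by rewrite mulrA -exprSr; exact: HM.
Qed.

Lemma schwartz_measurable phi : schwartz_real phi -> measurable_fun [set: 'cV[R]_d] phi.
Proof. by move=> /schwartz_continuous; exact: continuous_cV_measurable. Qed.

Lemma schwartz_bfin phi : schwartz_real phi -> exists c, bfin 1 phi c.
Proof.
move=> Sphi; have [M M0 HM] := schwartz_cauchy Sphi.
have mphi := schwartz_measurable Sphi.
have ic := RintegrableZ M integrable_cauchy_cV.
exists (\int[mu]_x (M * cauchy_cV x)); split=> //.
rewrite /bnorm; apply: (@le_trans _ _ (\int[mu]_x (M * cauchy_cV x)%:E)%E); last first.
  by rewrite /Rintegral fineK//; exact: integrable_fin_num.
apply: ge0_le_integral => //=.
- by move=> x _; rewrite lee_fin mulr_ge0// wt_ge0.
- by apply/measurable_EFinP; apply: measurable_funM; [exact: measurableT_comp|exact: measurable_wt].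
- by apply/measurable_EFinP; exact: integrable_measurable ic.
- by move=> x _; rewrite lee_fin wt1 mulrC.
Qed.

Lemma schwartz_integrable phi : schwartz_real phi -> mu.-integrable setT (EFin \o phi).
Proof. by move=> /schwartz_bfin[c Hc]; exact: bfin_integrable0 Hc. Qed.

Lemma schwartz_hartley_measurable phi : schwartz_real phi -> measurable_fun [set: 'cV[R]_d] (hartley phi).
Proof.
by move=> /schwartz_bfin[c Hc]; apply: continuous_cV_measurable; exact: hartley_continuous Hc.
Qed.

Lemma schwartz_hartley_bounded phi : schwartz_real phi -> exists c, forall x, `|hartley phi x| <= c.
Proof. by move=> /schwartz_bfin[c Hc]; exists (2 * c) => x; exact: hartley_bound Hc. Qed.

Lemma is_derive_line phi i x (u : R) : (forall y, derivable phi y (delta_mx i 0)) ->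
  is_derive u 1 (fun t : R => phi (x + t *: delta_mx i 0)) (partial i phi (x + u *: delta_mx i 0)).
Proof.
move=> D; have := D (x + u *: delta_mx i 0).
have E : (fun h : R => h^-1 *: (phi (x + (h *: (1 : R) + u) *: delta_mx i 0) - phi (x + u *: delta_mx i 0))) =
    (fun h : R => h^-1 *: (phi (h *: delta_mx i 0 + (x + u *: delta_mx i 0)) - phi (x + u *: delta_mx i 0))).
  apply/funext => h; congr (_ *: (phi _ - _)).
  by rewrite /GRing.scale /= mulr1 -/(GRing.scale _ _) scalerDl addrCA.
by move=> Dx; split; rewrite /derivable /partial /derive /= E.
Qed.

Lemma partial_mean_value phi i x (t : R) : (forall y, derivable phi y (delta_mx i 0)) ->
  exists2 c, `|c| <= `|t| & phi (x + t *: delta_mx i 0) - phi x = partial i phi (x + c *: delta_mx i 0) * t.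
Proof.
move=> D; have [c] := mean_value 0 t (fun u => is_derive_line x u D).
by rewrite !subr0 scale0r addr0 => ct E; exists c.
Qed.

(** Two applications of the mean value theorem along the i-th axis; this loses the factor 1/2 of
    Taylor's formula. *)
Lemma partial_taylor2 phi i x (t M : R) : schwartz_real phi ->
  (forall c, `|c| <= `|t| -> `|partial i (partial i phi) (x + c *: delta_mx i 0)| <= M) ->
  `|phi (x + t *: delta_mx i 0) - phi x - t * partial i phi x| <= M * t ^+ 2.
Proof.
move=> Sphi HM; have Dphi y := @schwartz_derivable phi i y Sphi.
have Dphi' y := @schwartz_derivable _ i y (schwartz_partial i Sphi).
have [c ct ->] := partial_mean_value x t Dphi.
rewrite [t * _]mulrC -mulrBl.
have [c' cc' ->] := partial_mean_value x c Dphi'.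
rewrite !normrM -mulrA; have H := HM c' (le_trans cc' ct).
apply: (@le_trans _ _ (M * (`|t| * `|t|))).
  by rewrite ler_pM// ?mulr_ge0// ler_wpM2r.
by rewrite -normrM -expr2 ger0_norm ?sqr_ge0.
Qed.

Lemma enorm_delta i : enorm (delta_mx i 0 : 'cV[R]_d) = 1.
Proof. by rewrite /enorm dot_delta mxE !eqxx sqrtr1. Qed.

Lemma enormZ (a : R) x : enorm (a *: x) = `|a| * enorm x.
Proof. by rewrite /enorm dotZl dotZr mulrA -expr2 sqrtrM ?sqr_ge0// sqrtr_sqr. Qed.

(** A shift of length at most 1 changes 1 + |x| by at most a factor 2. The resulting majorant is
    uniform in the shift, which makes the Taylor remainder integrable. *)
Lemma schwartz_shift_bound phi i : schwartz_real phi -> exists2 M, 0 <= M &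
  forall x (c : R), `|c| <= 1 -> `|phi (x + c *: delta_mx i 0)| <= M * cauchy_cV x.
Proof.
move=> [_ B]; have [M HM] := B (2 * d)%N [::].
have M0 : 0 <= M.
  by apply: le_trans (HM 0); rewrite mulr_ge0// exprn_ge0// addr_ge0// enorm_ge0.
exists (2 ^+ (2 * d) * M) => [|x c c1]; first by rewrite mulr_ge0// exprn_ge0.
apply: decay_cauchy => //; set y := x + _.
have xy : 1 + enorm x <= 2 * (1 + enorm y).
  have -> : x = y + (- c) *: delta_mx i 0 by rewrite /y scaleNr addrK.
  have := enormD y ((- c) *: delta_mx i 0); rewrite enormZ enorm_delta normrN mulr1.
  by have := enorm_ge0 y; move: c1; lra.
apply: (@le_trans _ _ ((2 * (1 + enorm y)) ^+ (2 * d) * `|phi y|)).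
  by rewrite ler_wpM2r// lerXn2r ?nnegrE ?mulr_ge0 ?addr_ge0 ?enorm_ge0.
by rewrite exprMn -mulrA ler_wpM2l ?exprn_ge0//; exact: HM.
Qed.

(** Serves to equate the first-order coefficients of two expansions in t. *)
Lemma linear_quadratic_eq0 (X C : R) : (forall t, `|t| <= 1 -> `|t * X| <= C * t ^+ 2) -> X = 0.
Proof.
move=> H; have C0 : 0 <= C by have := H 1; rewrite normr1 expr1n mul1r mulr1 => /(_ (lexx _)); exact: le_trans.
apply/eqP; rewrite -normr_eq0; apply/negPn/negP => X0.
have Xp : 0 < `|X| by rewrite lt_def X0/=.
(* The second entry makes C t < |X|, contradicting the bound divided by t. *)
pose t := Num.min 1 (`|X| / (2 * (C + 1))).
have C1 : 0 < C + 1 by rewrite ltr_wpDl.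
have t0 : 0 < t by rewrite lt_min ltr01 divr_gt0// mulr_gt0.
have t1 : t <= 1 by rewrite ge_min lexx.
have t2 : t <= `|X| / (2 * (C + 1)) by rewrite ge_min lexx orbT.
have := H t; rewrite ger0_norm ?(ltW t0)// => /(_ t1).
rewrite normrM (ger0_norm (ltW t0)) mulrC expr2 mulrA ler_pM2r//.
apply/negP; rewrite -ltNge.
move: t2; rewrite ler_pdivlMr ?mulr_gt0// => t2.
have : C * t <= (C + 1) * t by rewrite ler_wpM2r ?(ltW t0)// lerDl.
have : 0 < t * (C + 1) by rewrite mulr_gt0.
move: t2; rewrite mulrCA [(C + 1) * t]mulrC; set q := t * (C + 1); lra.
Qed.

(** Integration by parts in which translation invariance of the integral replaces the boundary
    terms. *)
Lemma hartley_partial i phi x : schwartz_real phi ->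
  hartley (partial i phi) x = - x i 0 * hartley phi (- x).
Proof.
move=> Sphi; have Sphi' := schwartz_partial i Sphi.
have Sphi'' := schwartz_partial i Sphi'.
have iphi := schwartz_integrable Sphi; have iphi' := schwartz_integrable Sphi'.
have [M M0 HM] := schwartz_shift_bound i Sphi''.
have ic := integrable_cauchy_cV.
(* Expand int phi(y + t e_i) cas(x . y) dy = int phi(y) cas(x . y - t x_i) dy to
   first order in t on both sides. *)
suff : hartley (partial i phi) x + x i 0 * hartley phi (- x) = 0.
  by move=> /eqP; rewrite addr_eq0 mulNr => /eqP.
(* One summand per remainder: the first from the Taylor bound of phi times |cas| <= 2, the second
   from the Taylor bound of cas at the increment - t x_i. *)
apply: (@linear_quadratic_eq0 _ (\int[mu]_y (2 * M * cauchy_cV y) + \int[mu]_y (2 * x i 0 ^+ 2 * `|phi y|))) => t t1.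
pose e : 'cV[R]_d := delta_mx i 0.
have [ishift _] := Rintegral_shift (t *: e) iphi.
have cx := integrable_cas x iphi; have cx' := integrable_cas x iphi'.
have cs := integrable_cas x ishift.
have cN := integrable_cas (- x) iphi.
have mcs : measurable_fun [set: 'cV[R]_d] (fun y => cas (dot x y - t * x i 0)).
  apply: measurableT_comp; first exact: measurable_cas.
  by apply: measurable_funB => //; exact: measurable_dot.
have cm : mu.-integrable setT (EFin \o (fun y => phi y * cas (dot x y - t * x i 0))).
  by apply: (Rintegrable_bounded (C := 2) iphi mcs) => y; exact: cas_le2.
have SE : \int[mu]_y (phi (y + t *: e) * cas (dot x y)) = \int[mu]_y (phi y * cas (dot x y - t * x i 0)).
  have [_ ->] := Rintegral_shift (t *: e) cm.
  by apply: eq_Rintegral => y _; rewrite dotDr dotZr dot_delta addrK.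
have I1 : `|\int[mu]_y ((phi (y + t *: e) - phi y - t * partial i phi y) * cas (dot x y))| <=
    \int[mu]_y (2 * M * cauchy_cV y) * t ^+ 2.
  have iD : mu.-integrable setT (EFin \o (fun y => phi (y + t *: e) - phi y - t * partial i phi y)).
    by apply: RintegrableB; [exact: RintegrableB|exact: RintegrableZ].
  have iDc := integrable_cas x iD.
  apply: (le_trans (le_normr_Rintegral measurableT iDc)).
  rewrite [leRHS]mulrC -RintegralZl//; last exact: RintegrableZ.
  apply: le_Rintegral => //; first exact: integrable_norm.
    by do 2 apply: RintegrableZ.
  move=> y _; rewrite normrM.
  have := @partial_taylor2 phi i y t (M * cauchy_cV y) Sphi (fun c ct => HM y c (le_trans ct t1)).
  move=> K; apply: (@le_trans _ _ (M * cauchy_cV y * t ^+ 2 * 2)); last by rewrite le_eqVlt; apply/orP; left; apply/eqP; ring.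
  by rewrite ler_pM// cas_le2.
have I2 : `|\int[mu]_y (phi y * (cas (dot x y - t * x i 0) - cas (dot x y) + t * x i 0 * cas (- dot x y)))| <=
    \int[mu]_y (2 * x i 0 ^+ 2 * `|phi y|) * t ^+ 2.
  have iE : mu.-integrable setT (EFin \o (fun y => phi y * (cas (dot x y - t * x i 0) - cas (dot x y) + t * x i 0 * cas (- dot x y)))).
    have := RintegrableD (RintegrableB cm cx) (RintegrableZ (t * x i 0) cN).
    by apply: eq_integrable => // y _ /=; rewrite dotNl; congr EFin; ring.
  apply: (le_trans (le_normr_Rintegral measurableT iE)).
  rewrite [leRHS]mulrC -RintegralZl//; last by apply: RintegrableZ; exact: integrable_norm.
  apply: le_Rintegral => //; first exact: integrable_norm.
    by do 2 apply: RintegrableZ; exact: integrable_norm.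
  move=> y _; rewrite normrM.
  have := cas_taylor2 (dot x y) (- (t * x i 0)); rewrite mulNr opprK => K.
  apply: (@le_trans _ _ (`|phi y| * (2 * (- (t * x i 0)) ^+ 2))); first by rewrite ler_wpM2l.
  by rewrite le_eqVlt; apply/orP; left; apply/eqP; ring.
have -> : t * (hartley (partial i phi) x + x i 0 * hartley phi (- x)) =
   \int[mu]_y (phi y * (cas (dot x y - t * x i 0) - cas (dot x y) + t * x i 0 * cas (- dot x y))) -
   \int[mu]_y ((phi (y + t *: e) - phi y - t * partial i phi y) * cas (dot x y)).
  have -> : \int[mu]_y (phi y * (cas (dot x y - t * x i 0) - cas (dot x y) + t * x i 0 * cas (- dot x y))) =
      \int[mu]_y (phi y * cas (dot x y - t * x i 0)) - hartley phi x + t * x i 0 * hartley phi (- x).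
    rewrite /hartley -RintegralB// -RintegralZl// -RintegralD//; [|exact: RintegrableB|exact: RintegrableZ].
    by apply: eq_Rintegral => y _; rewrite dotNl; ring.
  have -> : \int[mu]_y ((phi (y + t *: e) - phi y - t * partial i phi y) * cas (dot x y)) =
      \int[mu]_y (phi (y + t *: e) * cas (dot x y)) - hartley phi x - t * hartley (partial i phi) x.
    rewrite /hartley -RintegralB// -RintegralZl// -RintegralB//; [|exact: RintegrableB|exact: RintegrableZ].
    by apply: eq_Rintegral => y _; ring.
  by rewrite SE; ring.
by rewrite mulrDl [leRHS]addrC; apply: (le_trans (ler_normB _ _)); exact: lerD.
Qed.

(* Applying prod_i (1 - d_i^2) to phi multiplies its transform by
   prod_i (1 + x_i^2), which gives the decay needed for integrability. *)
Lemma schwartz_hartley_weight phi (r : seq 'I_d) : schwartz_real phi ->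
  exists2 psi, schwartz_real psi & forall x, hartley psi x = \prod_(i <- r) (1 + x i 0 ^+ 2) * hartley phi x.
Proof.
move=> Sphi; elim: r => [|i r [psi Spsi E]].
  by exists phi => // x; rewrite big_nil mul1r.
have S1 := schwartz_partial i Spsi; have S2 := schwartz_partial i S1.
exists (fun x => psi x - partial i (partial i psi) x); first exact: schwartz_sub.
move=> x; rewrite big_cons -mulrA -E.
have -> : hartley (fun x => psi x - partial i (partial i psi) x) x =
    hartley psi x - hartley (partial i (partial i psi)) x.
  have i1 := integrable_cas x (schwartz_integrable Spsi).
  have i2 := integrable_cas x (schwartz_integrable S2).
  by rewrite /hartley -RintegralB//; apply: eq_Rintegral => y _; rewrite mulrBl.
rewrite (hartley_partial i x S1) (hartley_partial i (- x) Spsi) opprK mxE.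
move: (hartley psi x) => ?; ring.
Qed.

Lemma schwartz_hartley_integrable phi : schwartz_real phi -> mu.-integrable setT (EFin \o hartley phi).
Proof.
move=> Sphi; have [psi Spsi E] := schwartz_hartley_weight (index_enum ('I_d : finType)) Sphi.
have [c Hc] := schwartz_hartley_bounded Spsi.
apply: (Rintegrable_le (g := fun x => c * cauchy_cV x)).
- exact: schwartz_hartley_measurable.
- move=> x; rewrite -[hartley phi x]mul1r -(cauchy_cVK x) mulrAC -E normrM.
  by rewrite (ger0_norm (cauchy_cV_ge0 x)) ler_wpM2r// cauchy_cV_ge0.
- by apply: RintegrableZ; exact: integrable_cauchy_cV.
Qed.

Lemma continuous_radial phi x z : continuous phi -> phi (x + n.+1%:R^-1 *: z) @[n --> \oo] --> phi x.
Proof.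
move=> cphi; apply: continuous_cvg => //; first exact: cphi.
apply/cvg_ballP => e e0.
have := @cvg_harmonic R; move/cvgrPdist_lt => /(_ (e / (enorm z + 1))).
have z1 : 0 < enorm z + 1 by rewrite ltr_wpDl// enorm_ge0.
rewrite divr_gt0// => /(_ isT); apply: filterS => n Hn; split=> // i j.
rewrite ord1 !mxE /ball /= opprD addrA subrr add0r normrN normrM.
move: Hn; rewrite sub0r normrN ltr_pdivlMr// => Hn.
apply: le_lt_trans Hn; rewrite ler_wpM2l// (le_trans (coord_le_enorm _ _))// lerDl.
by [].
Qed.

Lemma schwartz_inversion (H : 'cV[R]_d -> R) phi : mu.-integrable setT (EFin \o H) -> schwartz_real phi ->
  mu.-integrable setT (EFin \o (fun x => hartley phi x * hartley H x)) /\
  \int[mu]_x (hartley phi x * hartley H x) = (2 * pi) ^+ d * \int[mu]_xi (H xi * phi xi).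
Proof.
move=> iH Sphi; have [_ /(_ 0%N [::])[B HB]] := Sphi.
apply: (@hartley_inversion R d H phi B) => //.
- exact: schwartz_integrable.
- exact: schwartz_hartley_integrable.
- by move=> x; have := HB x; rewrite expr0 mul1r.
- by move=> x z; apply: continuous_radial; exact: schwartz_continuous.
Qed.

Lemma hartley_opp phi x : mu.-integrable setT (EFin \o phi) ->
  hartley (fun y => phi (- y)) x = hartley phi (- x).
Proof.
move=> iphi; rewrite /hartley; have [_ ->] := Rintegral_oppV (integrable_cas (- x) iphi).
by apply: eq_Rintegral => y _; rewrite dotNl dotNr opprK.
Qed.

(** Reflection is treated through the hypotheses of [hartley_inversion], so no derivatives of phi(-
    y) have to be computed. Together with the unreflected formula it separates even and odd
    parts. *)
Lemma schwartz_inversion_opp (H : 'cV[R]_d -> R) phi : mu.-integrable setT (EFin \o H) -> schwartz_real phi ->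
  mu.-integrable setT (EFin \o (fun x => hartley (fun y => phi (- y)) x * hartley H x)) /\
  \int[mu]_x (hartley (fun y => phi (- y)) x * hartley H x) = (2 * pi) ^+ d * \int[mu]_xi (H xi * phi (- xi)).
Proof.
move=> iH Sphi; have [_ /(_ 0%N [::])[B HB]] := Sphi.
have iphi := schwartz_integrable Sphi.
have [iN _] := Rintegral_oppV iphi.
apply: (@hartley_inversion R d H (fun y => phi (- y)) B) => //.
- have [iI _] := Rintegral_oppV (schwartz_hartley_integrable Sphi).
  by apply: eq_integrable iI => // x _ /=; rewrite hartley_opp.
- by move=> x; have := HB (- x); rewrite expr0 mul1r.
- move=> x z; have := @continuous_radial phi (- x) (- z) (schwartz_continuous Sphi).
  by under eq_cvg do rewrite scalerN -opprD.
Qed.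

End schwartz_functions.

(** * Barron functions as Hartley integrals *)

Section barron_interface.
Context {R : realType} {d : nat}.
Local Notation mu := (lebesgue_cV R d).

Let norm_Re_le (z : R[i]) : `|complex.Re z| <= Normc.normc z.
Proof.
case: z => a b /=; rewrite -sqrtr_sqr ler_wsqrtr// lerDl; exact: sqr_ge0.
Qed.

Let norm_Im_le (z : R[i]) : `|complex.Im z| <= Normc.normc z.
Proof.
case: z => a b /=; rewrite -sqrtr_sqr ler_wsqrtr// lerDr; exact: sqr_ge0.
Qed.

Let normc_le (z : R[i]) : Normc.normc z <= `|complex.Re z| + `|complex.Im z|.
Proof.
case: z => a b /=; rewrite -(@ler_pXn2r _ 2)// ?nnegrE ?addr_ge0 ?sqrtr_ge0//.
rewrite sqr_sqrtr ?addr_ge0 ?sqr_ge0// sqrrD !real_normK ?num_real//.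
by rewrite lerD2r lerDl mulrn_wge0// mulr_ge0.
Qed.

Let measurable_normc (F : 'cV[R]_d -> R[i]) : measurable_fun [set: 'cV[R]_d] (@complex.Re R \o F) ->
  measurable_fun [set: 'cV[R]_d] (@complex.Im R \o F) ->
  measurable_fun [set: 'cV[R]_d] (fun xi => Normc.normc (F xi)).
Proof.
move=> mR mI; have -> : (fun xi => Normc.normc (F xi)) =
  (fun r : R => r `^ 2^-1) \o (fun xi => complex.Re (F xi) ^+ 2 + complex.Im (F xi) ^+ 2).
  apply/funext => xi /=; rewrite powR12_sqrt ?addr_ge0 ?sqr_ge0//.
  by case: (F xi).
apply: measurableT_comp; first exact: measurable_powR.
by apply: measurable_funD; apply: measurable_funX.
Qed.

(** With F = a + i b, the real part of the inversion formula reads f = hcos a - hsin b. A cosine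
    transform is half the sum, and a sine transform half the difference, of the Hartley integrals of
    a density and of its reflection. *)
Lemma barron_bn s (f : 'cV[R]_d -> R) : 0 <= s -> barron s f -> exists c, bn s c f.
Proof.
move=> s0 [F [[[iRe iIm] _ fE] Fs]].
have mRe := integrable_measurable iRe; have mIm := integrable_measurable iIm.
pose c := fine (weighted_norm s F).
have w0 : (0 <= weighted_norm s F)%E.
  by apply: integral_ge0 => xi _; rewrite lee_fin mulr_ge0 ?powR_ge0//; case: (F xi) => a b; exact: sqrtr_ge0.
have wE : weighted_norm s F = c%:E by rewrite fineK// ge0_fin_numE.
have L (G : 'cV[R]_d -> R) : measurable_fun setT G -> (forall xi, `|G xi| <= Normc.normc (F xi)) -> bfin s G c.
  move=> mG GF; split=> //; rewrite -wE; apply: ge0_le_integral => //=.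
  - by move=> x _; rewrite lee_fin mulr_ge0// wt_ge0.
  - by apply/measurable_EFinP; apply: measurable_funM; [exact: measurableT_comp|exact: measurable_wt].
  - by apply/measurable_EFinP; apply: measurable_funM; [exact: measurable_normc|exact: measurable_wt].
  - by move=> x _; rewrite lee_fin ler_wpM2r// powR_ge0.
pose A xi := complex.Re (F xi); pose B xi := (-1) * complex.Im (F xi).
have bA : bfin s A c by apply: L => // xi; exact: norm_Re_le.
have bB : bfin s B c.
  by apply: L => [|xi]; [exact: measurable_funM|rewrite /B mulN1r normrN; exact: norm_Im_le].
have iA := bfin_integrable0 s0 bA; have iB := bfin_integrable0 s0 bB.
have bA' := bfin_opp bA; have bB' := bfin_opp bB.
have bnA : bn s c (hartley A) by exists A.
have bnA' : bn s c (hartley (fun xi => A (- xi))) by exists (fun xi => A (- xi)).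
have bnB : bn s c (hartley B) by exists B.
have bnB' : bn s c (hartley (fun xi => B (- xi))) by exists (fun xi => B (- xi)).
have := bn_scale 2^-1 s0 (bn_add s0 (bn_add s0 bnA bnA') (bn_add s0 bnB (bn_scale (-1) s0 bnB'))).
set e := _ * _; rewrite (_ : (fun x => _) = f); first by exists e.
apply/funext => x.
have fx : f x = hcos A x + hsin B x.
  have := fE x; rewrite /cintegral => /(congr1 (@complex.Re R)) /= ->.
  rewrite /hcos /hsin -RintegralD//; [|exact: integrable_cos|exact: integrable_sin].
  apply: eq_Rintegral => xi _; rewrite /A /B; case: (F xi) => a b /=; ring.
have [iA' _] := Rintegral_oppV iA; have [iB' _] := Rintegral_oppV iB.
rewrite fx (hartleyE x iA) (hartleyE x iB) (hartleyE x iA') (hartleyE x iB').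
rewrite (hcos_opp x iA) (hsin_opp x iA) (hcos_opp x iB) (hsin_opp x iB).
by move: (hcos A x) (hsin A x) (hcos B x) (hsin B x) => ? ? ? ?; field.
Qed.

Lemma bn_barron w c (h : 'cV[R]_d -> R) : 0 <= w -> bn w c h -> barron w h.
Proof.
move=> w0 [H [Hc ->]].
have iH := bfin_integrable0 w0 Hc; have Hc' := bfin_opp Hc; have iH' := bfin_integrable0 w0 Hc'.
pose A xi := 2^-1 * (H xi + H (- xi)); pose B xi := 2^-1 * (H xi - H (- xi)).
pose F xi : R[i] := Complex (A xi) (- B xi).
have iA : mu.-integrable setT (EFin \o A) by apply: RintegrableZ; exact: RintegrableD.
have iB : mu.-integrable setT (EFin \o B) by apply: RintegrableZ; exact: RintegrableB.
have iNB : mu.-integrable setT (EFin \o (fun xi => - B xi)).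
  by apply: eq_integrable (RintegrableZ (-1) iB) => // xi _ /=; rewrite mulN1r.
have mA := integrable_measurable iA; have mNB := integrable_measurable iNB.
have linI (G1 G2 : 'cV[R]_d -> R) (k : 'cV[R]_d -> R) (a b : R) :
    mu.-integrable setT (EFin \o (fun xi => G1 xi * k xi)) ->
    mu.-integrable setT (EFin \o (fun xi => G2 xi * k xi)) ->
    mu.-integrable setT (EFin \o (fun xi => 2^-1 * (a * G1 xi + b * G2 xi) * k xi)).
  move=> i1 i2; apply: eq_integrable (RintegrableZ 2^-1 (RintegrableD (RintegrableZ a i1) (RintegrableZ b i2))) => // x _ /=.
  by congr EFin; ring.
have lin (G1 G2 : 'cV[R]_d -> R) (k : 'cV[R]_d -> R) (a b : R) :
    mu.-integrable setT (EFin \o (fun xi => G1 xi * k xi)) ->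
    mu.-integrable setT (EFin \o (fun xi => G2 xi * k xi)) ->
    \int[mu]_xi (2^-1 * (a * G1 xi + b * G2 xi) * k xi) =
    2^-1 * (a * \int[mu]_xi (G1 xi * k xi) + b * \int[mu]_xi (G2 xi * k xi)).
  move=> i1 i2; have i1' := RintegrableZ a i1; have i2' := RintegrableZ b i2.
  have i3 := RintegrableD i1' i2'.
  rewrite -(RintegralZl a measurableT i1) -(RintegralZl b measurableT i2) -(RintegralD measurableT i1' i2').
  rewrite -(RintegralZl 2^-1 measurableT i3); apply: eq_Rintegral => xi _; ring.
(* [A] and [B] are the even and odd parts of H: the first carries its whole cosine transform, the
   second its whole sine transform. *)
have cA x : hcos A x = hcos H x.
  rewrite [RHS](_ : _ = 2^-1 * (1 * hcos H x + 1 * hcos (fun xi => H (- xi)) x)); last by rewrite (hcos_opp x iH); field.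
  rewrite /hcos -(lin _ _ _ _ _ (integrable_cos x iH) (integrable_cos x iH')).
  by apply: eq_Rintegral => xi _; rewrite /A !mul1r.
have sA x : hsin A x = 0.
  rewrite [RHS](_ : _ = 2^-1 * (1 * hsin H x + 1 * hsin (fun xi => H (- xi)) x)); last by rewrite (hsin_opp x iH); field.
  rewrite /hsin -(lin _ _ _ _ _ (integrable_sin x iH) (integrable_sin x iH')).
  by apply: eq_Rintegral => xi _; rewrite /A !mul1r.
have cB x : hcos B x = 0.
  rewrite [RHS](_ : _ = 2^-1 * (1 * hcos H x + (- 1) * hcos (fun xi => H (- xi)) x)); last by rewrite (hcos_opp x iH); field.
  rewrite /hcos -(lin _ _ _ _ _ (integrable_cos x iH) (integrable_cos x iH')).
  by apply: eq_Rintegral => xi _; rewrite /B !mul1r mulN1r.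
have sB x : hsin B x = hsin H x.
  rewrite [RHS](_ : _ = 2^-1 * (1 * hsin H x + (- 1) * hsin (fun xi => H (- xi)) x)); last by rewrite (hsin_opp x iH); field.
  rewrite /hsin -(lin _ _ _ _ _ (integrable_sin x iH) (integrable_sin x iH')).
  by apply: eq_Rintegral => xi _; rewrite /B !mul1r mulN1r.
exists F; split; last first.
  (* The modulus of F is at most |A| + |B|, hence at most |H(xi)| + |H(- xi)|, and the weight is
     even. *)
  apply: (@le_lt_trans _ _ (\int[mu]_xi ((`|H xi| * wt w xi)%:E + (`|H (- xi)| * wt w xi)%:E))%E); last first.
    have mm (G : 'cV[R]_d -> R) : measurable_fun setT G -> measurable_fun setT (fun xi => (`|G xi| * wt w xi)%:E).
      by move=> mG; apply/measurable_EFinP; apply: measurable_funM; [exact: measurableT_comp|exact: measurable_wt].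
    rewrite ge0_integralD//=; first last.
    - by apply: mm; have [] := Hc'.
    - by move=> x _; rewrite lee_fin mulr_ge0// wt_ge0.
    - by apply: mm; have [] := Hc.
    - by move=> x _; rewrite lee_fin mulr_ge0// wt_ge0.
    have [_ n1] := Hc; have [_ n2] := Hc'.
    by apply: (le_lt_trans (leeD n1 n2)); rewrite -EFinD ltry.
  apply: ge0_le_integral => //=.
  - by move=> x _; rewrite lee_fin mulr_ge0 ?sqrtr_ge0// powR_ge0.
  - by apply/measurable_EFinP; apply: measurable_funM; [exact: (measurable_normc (F := F))|exact: measurable_wt].
  - have mm (G : 'cV[R]_d -> R) : measurable_fun setT G -> measurable_fun setT (fun xi => (`|G xi| * wt w xi)%:E).
      by move=> mG; apply/measurable_EFinP; apply: measurable_funM; [exact: measurableT_comp|exact: measurable_wt].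
    by apply: emeasurable_funD; apply: mm; [have [] := Hc|have [] := Hc'].
  - move=> x _; rewrite -EFinD lee_fin -mulrDl ler_wpM2r ?wt_ge0//.
    apply: (le_trans (normc_le (F x))); rewrite /= normrN /A /B !normrM ger0_norm ?invr_ge0//.
    by have := ler_normD (H x) (H (- x)); have := ler_normB (H x) (H (- x)); lra.
have imeas : cintegrable F by split.
split=> // [phi [S1 S2]|x]; last first.
  rewrite /cintegral; apply/eqP; rewrite eq_complex /=; apply/andP; split; apply/eqP.
    rewrite (hartleyE x iH) -cA -sB /hcos /hsin -RintegralD//; [|exact: integrable_cos|exact: integrable_sin].
    by apply: eq_Rintegral => xi _; ring.
  rewrite -[LHS](subrr (0 : R)) -{1}(sA x) -(cB x) /hcos /hsin.
  rewrite -RintegralB//; [|exact: integrable_sin|exact: integrable_cos].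
  by apply: eq_Rintegral => xi _; ring.
pose p1 xi := complex.Re (phi xi); pose p2 xi := complex.Im (phi xi).
have i1 := schwartz_integrable S1; have i2 := schwartz_integrable S2.
pose P : R := (2 * pi) ^- d.
have P0 : (2 * pi) ^+ d != 0 :> R by rewrite expf_neq0// mulf_neq0// gt_eqF// pi_gt0.
have FR x : complex.Re (fourier phi x) = P * (hcos p1 x + hsin p2 x).
  rewrite /fourier /cintegral /= mul0r subr0; congr (_ * _).
  rewrite /hcos /hsin -RintegralD//; [|exact: integrable_cos|exact: integrable_sin].
  apply: eq_Rintegral => y _; rewrite /p1 /p2 (dotC y x); case: (phi y) => a b /=; rewrite cosN sinN; ring.
have FI x : complex.Im (fourier phi x) = P * (hcos p2 x - hsin p1 x).
  rewrite /fourier /cintegral /= mul0r addr0; congr (_ * _).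
  rewrite /hcos /hsin -RintegralB//; [|exact: integrable_cos|exact: integrable_sin].
  apply: eq_Rintegral => y _; rewrite /p1 /p2 (dotC y x); case: (phi y) => a b /=; rewrite cosN sinN; ring.
(* [hcos q] and [hsin q] are the even and odd parts of [hartley q], so half the sum and half the
   difference of the inversion formulas for q and its reflection pair q with A and with B. *)
have key q : schwartz_real q ->
    [/\ mu.-integrable setT (EFin \o (fun x => hcos q x * hartley H x)),
       mu.-integrable setT (EFin \o (fun x => hsin q x * hartley H x)),
       \int[mu]_x (hcos q x * hartley H x) = (2 * pi) ^+ d * \int[mu]_xi (A xi * q xi) &
       \int[mu]_x (hsin q x * hartley H x) = (2 * pi) ^+ d * \int[mu]_xi (B xi * q xi)].
  move=> Sq; have iq := schwartz_integrable Sq; have [iq' _] := Rintegral_oppV iq.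
  have [j1 E1] := schwartz_inversion iH Sq; have [j2 E2] := schwartz_inversion_opp iH Sq.
  have [_ /(_ 0%N [::])[b qb]] := Sq.
  have qb' xi : `|q xi| <= b by have := qb xi; rewrite expr0 mul1r.
  have mq := schwartz_measurable Sq.
  have iHq := Rintegrable_bounded iH mq qb'; have iHq' := Rintegrable_bounded iH' mq qb'.
  have Eopp : \int[mu]_xi (H xi * q (- xi)) = \int[mu]_xi (H (- xi) * q xi).
    have mq' : measurable_fun setT (fun xi : 'cV[R]_d => q (- xi)) by exact: integrable_measurable iq'.
    have [_ ->] := Rintegral_oppV (Rintegrable_bounded iH mq' (fun xi => qb' (- xi))).
    by apply: eq_Rintegral => xi _; rewrite opprK.
  have Ec x : hcos q x = 2^-1 * (1 * hartley q x + 1 * hartley (fun y => q (- y)) x).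
    rewrite (hartleyE x iq) (hartleyE x iq') (hcos_opp x iq) (hsin_opp x iq).
    by move: (hcos q x) (hsin q x) => ? ?; field.
  have Es x : hsin q x = 2^-1 * (1 * hartley q x + (- 1) * hartley (fun y => q (- y)) x).
    rewrite (hartleyE x iq) (hartleyE x iq') (hcos_opp x iq) (hsin_opp x iq).
    by move: (hcos q x) (hsin q x) => ? ?; field.
  split.
  - by apply: eq_integrable (linI _ _ _ 1 1 j1 j2) => // x _ /=; rewrite Ec.
  - by apply: eq_integrable (linI _ _ _ 1 (- 1) j1 j2) => // x _ /=; rewrite Es.
  - transitivity (\int[mu]_x (2^-1 * (1 * hartley q x + 1 * hartley (fun y => q (- y)) x) * hartley H x)).
      by apply: eq_Rintegral => x _; rewrite Ec.
    rewrite (lin _ _ _ _ _ j1 j2) E1 E2 Eopp.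
    transitivity ((2 * pi) ^+ d * \int[mu]_xi (2^-1 * (1 * H xi + 1 * H (- xi)) * q xi)); last first.
      by congr (_ * _); apply: eq_Rintegral => xi _; rewrite /A !mul1r.
    rewrite (lin _ _ _ _ _ iHq iHq'); move: (\int[mu]_xi _) (\int[mu]_xi _) ((2 * pi) ^+ d) => ? ? ?; ring.
  - transitivity (\int[mu]_x (2^-1 * (1 * hartley q x + (- 1) * hartley (fun y => q (- y)) x) * hartley H x)).
      by apply: eq_Rintegral => x _; rewrite Es.
    rewrite (lin _ _ _ _ _ j1 j2) E1 E2 Eopp.
    transitivity ((2 * pi) ^+ d * \int[mu]_xi (2^-1 * (1 * H xi + (- 1) * H (- xi)) * q xi)); last first.
      by congr (_ * _); apply: eq_Rintegral => xi _; rewrite /B !mul1r mulN1r.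
    rewrite (lin _ _ _ _ _ iHq iHq'); move: (\int[mu]_xi _) (\int[mu]_xi _) ((2 * pi) ^+ d) => ? ? ?; ring.
have [jc1 js1 Ec1 Es1] := key _ S1; have [jc2 js2 Ec2 Es2] := key _ S2.
have iAq q : schwartz_real q -> mu.-integrable setT (EFin \o (fun xi => A xi * q xi)) /\
    mu.-integrable setT (EFin \o (fun xi => B xi * q xi)).
  move=> Sq; have [_ /(_ 0%N [::])[b qb]] := Sq; have mq := schwartz_measurable Sq.
  have qb' xi : `|q xi| <= b by have := qb xi; rewrite expr0 mul1r.
  by split; [exact: Rintegrable_bounded iA mq qb'|exact: Rintegrable_bounded iB mq qb'].
have [iA1 iB1] := iAq _ S1; have [iA2 iB2] := iAq _ S2.
have PK (u : R) : P * ((2 * pi) ^+ d * u) = u by rewrite /P mulKf.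
have CR (a : R) (z : R[i]) : complex.Re (a%:C * z)%C = a * complex.Re z.
  by case: z => u v /=; rewrite mul0r subr0.
have CI (a : R) (z : R[i]) : complex.Im (a%:C * z)%C = a * complex.Im z.
  by case: z => u v /=; rewrite mul0r addr0.
rewrite /cintegral; congr Complex.
  transitivity (P * (\int[mu]_x (hcos p1 x * hartley H x) + \int[mu]_x (hsin p2 x * hartley H x))).
    rewrite -(RintegralD measurableT jc1 js2) -(RintegralZl P measurableT (RintegrableD jc1 js2)).
    by apply: eq_Rintegral => x _; rewrite CR FR mulrCA -mulrDl [hartley H x * _]mulrC.
  rewrite Ec1 Es2 mulrDr !PK -(RintegralD measurableT iA1 iB2).
  by apply: eq_Rintegral => xi _ /=; case: (phi xi) => a b /=; rewrite mulNr opprK.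
transitivity (P * (\int[mu]_x (hcos p2 x * hartley H x) - \int[mu]_x (hsin p1 x * hartley H x))).
  rewrite -(RintegralB measurableT jc2 js1) -(RintegralZl P measurableT (RintegrableB jc2 js1)).
  by apply: eq_Rintegral => x _; rewrite CI FI mulrCA -mulrBl [hartley H x * _]mulrC.
rewrite Ec2 Es1 mulrBr !PK -(RintegralB measurableT iA2 iB1).
by apply: eq_Rintegral => xi _ /=; case: (phi xi) => a b /=; rewrite mulNr.
Qed.

End barron_interface.

(** * From Hartley densities back to Barron spaces *)

Lemma cvg_Ck_loc_cst (R : realType) d k (f : 'cV[R]_d -> R) : Ck k f -> cvg_Ck_loc k (fun=> f) f.
Proof. by move=> cf; split=> // l _ P Pf; exists 0%N => // n _ /=; exact: nbhs_singleton Pf. Qed.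

Theorem theorem1 (R : realType) (d m : nat) (s : R) (Q : 'M[R]_m)
    (f : 'cV[R]_d -> 'cV[R]_d) (g : 'cV[R]_d -> 'M[R]_(d, m))
    (ell : 'cV[R]_d -> R)
    (hs : 2 <= s) (hQ : posdef Q)
    (hell0 : forall x, 0 <= ell x)
    (hf : barron_mx s f) (hg : barron_mx s g) (hell : barron s ell)
    (hg0 : (0 < barron_mx_norm s g)%E) :
  exists C : R, 0 < C /\
    forall gamma : R, C <= gamma ->
      exists (u_ : nat -> 'cV[R]_d -> 'cV[R]_m) (u : 'cV[R]_d -> 'cV[R]_m)
             (V_ : nat -> 'cV[R]_d -> R) (V : 'cV[R]_d -> R),
        [/\ forall i, barron_mx s (u_ i),
            forall j, cvg_Ck_loc 1 (fun i x => u_ i x j 0) (fun x => u x j 0),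
            forall i, barron (s + 1) (V_ i),
            cvg_Ck_loc 2 V_ V &
            optimal_solution f g ell Q gamma u V].
Proof.
have s0 : 0 <= s by rewrite (le_trans _ hs).
have [C [C0 HC]] := bn_solution hs hQ (fun j => barron_bn s0 (hf j 0))
  (fun j k => barron_bn s0 (hg j k)) (barron_bn s0 hell).
exists C; split=> // gamma /HC[u [V [bu [c bV] opt]]].
exists (fun=> u), u, (fun=> V), V; split; last exact: opt.
- by move=> _ j k; rewrite ord1; have [e be] := bu j; exact: bn_barron be.
- by move=> j; have [e be] := bu j; apply/cvg_Ck_loc_cst/(bn_Ck _ be); rewrite (le_trans _ hs).
- by move=> _; apply: bn_barron bV; rewrite addr_ge0.
- by apply/cvg_Ck_loc_cst/(bn_Ck _ bV); rewrite lerD2r.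
Qed.
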